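(* Let $C$ be a DG open Frobenius algebra of degree $m$ over $\mathbb{Q}$, with differential $d$, counit $\varepsilon$ and coaugmentation $\mathbb{Q}\hookrightarrow C$. For each integer $n\ge2$ define $$c_n:(HC_*(C)[m-2])^{\otimes n}\to HC_*(C)[m-2],\qquad \alpha_1\otimes\cdots\otimes\alpha_n\mapsto(-1)^{\epsilon}\,\mathrm E(\mathrm M(\alpha_1)\bullet\cdots\bullet\mathrm M(\alpha_n)),$$ where $\epsilon=(n-1)|\alpha_1|+(n-2)|\alpha_2|+\cdots+|\alpha_{n-1}|$. Then the cyclic homology $(HC_*(C)[m-2],\{c_n\})$ is a gravity algebra.
   Context: All vector spaces are over $\mathbb{Q}$; signs follow the Koszul rule. For a graded space $X$, $(X[r])_k=X_{k+r}$. **DG open Frobenius algebra of degree $m$.** A chain complex $(C,d)$ with a DG commutative algebra structure whose product is of degree $-m$, and a DG cocommutative coalgebra structure $\Delta(x)=x'\otimes x''$ (Sweedler notation), such that for all $x,y\in C$: $(x\cdot y)'\otimes(x\cdot y)''=(x\cdot y')\otimes y''=(-1)^{m|x'|}x'\otimes(x''\cdot y)$. Here $C$ also has a counit $\varepsilon:C\to\mathbb{Q}$ and a coaugmentation $\mathbb{Q}\hookrightarrow C$. **Hochschild and cyclic homology of the coalgebra $C$.** Let $\overline{C}=C/\mathbb{Q}\simeq\ker\varepsilon$, and let $\Sigma$ be desuspension (degrees shifted down by one). Put $CC_*(C)=\prod_{n\ge0}C\otimes(\Sigma\overline{C})^{\otimes n}$, with elements written $a_0[a_1|\cdots|a_n]$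 and $|[a_1|\cdots|a_n]|=\sum_i(|a_i|-1)$. The differential is $$b(a_0[a_1|\cdots|a_n])=da_0[a_1|\cdots|a_n]+\sum_{i=1}^n(-1)^{|a_0|+|[a_1|\cdots|a_{i-1}]|}a_0[a_1|\cdots|da_i|\cdots|a_n]$$ $$+\sum_{i=1}^n(-1)^{|a_0|+|[a_1|\cdots|a_{i-1}|a_i']|}a_0[a_1|\cdots|a_i'|a_i''|\cdots|a_n]+(-1)^{|a_0'|}a_0'\Big([a_0''|a_1|\cdots|a_n]-(-1)^{(|a_0''|-1)|[a_1|\cdots|a_n]|}[a_1|\cdots|a_n|a_0'']\Big).$$ Connes' operator is $$B(a_0[a_1|\cdots|a_n])=\sum_{i=1}^n(-1)^{|[a_i|\cdots|a_n]||[a_1|\cdots|a_{i-1}]|}\varepsilon(a_0)a_i[a_{i+1}|\cdots|a_n|a_1|\cdots|a_{i-1}].$$ $HH_*(C)$ is the homology of $(CC_*(C),b)$; $HC_*(C)$ is the homology of $CC_*(C)[u]$, where $u$ is a parameter of degree $2$, with differential $(b+u^{-1}B)(\alpha\otimes u^n)=b\alpha\otimes u^n+B\alpha\otimes u^{n-1}$ for $n>0$, and $=b\alpha$ for $n=0$. The short exact sequence $0\to CC_*(C)\to CC_*(C)[u]\xrightarrow{u^{-1}}CC_*(C)[u]\to0$ gives Connes' exact sequence $$\cdots\to HH_*(C)\xrightarrow{\mathrm E}HC_*(C)\to HC_{*-2}(C)\xrightarrow{\mathrm M}HH_{*-1}(C)\to\cdots,$$ so $\mathrm E:HH_*(C)\to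 HC_*(C)$ is induced by inclusion and $\mathrm M:HC_*(C)\to HH_{*+1}(C)$ is the connecting map. **Product.** $\bullet$ is the product on $HH_*(C)$ induced by $$a_0[a_1|\cdots|a_n]\bullet b_0[b_1|\cdots|b_r]=(-1)^{|b_0||[a_1|\cdots|a_n]|}a_0b_0[a_1|\cdots|a_n|b_1|\cdots|b_r].$$ **Gravity algebra.** A graded vector space $V$ with a sequence of graded skew-symmetric operators $\{x_1,\dots,x_k\}:V^{\otimes k}\to V$, $k=2,3,\dots$, of degree $2-k$, satisfying the generalized Jacobi identities $$\sum_{1\le i<j\le k}(-1)^{\epsilon(i,j)}\{\{x_i,x_j\},x_1,\dots,\widehat{x_i},\dots,\widehat{x_j},\dots,x_k,y_1,\dots,y_l\}=\begin{cases}\{\{x_1,\dots,x_k\},y_1,\dots,y_l\},&l>0,\\0,&l=0,\end{cases}$$ (with $k\ge2$ if $l>0$ and $k\ge3$ if $l=0$), where $\epsilon(i,j)=(|x_1|+\cdots+|x_{i-1}|)|x_i|+(|x_1|+\cdots+|x_{j-1}|)|x_j|+|x_i||x_j|$. In the claim the $k$-ary operator is $c_k$ on $V=HC_*(C)[m-2]$, and $|\cdot|$ is the degree in $V$.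
   Formalization: Signs corrected: in b the terms a_0[..|da_i|..] carry a minus; for odd m the product on C and the n-fold product of the M(α_i) carry the Koszul signs of a degree −m operation; the Jacobi identities carry the signature (−1)^{i+j−3} of moving x_i,x_j to the front and (−1)^{kl} on the right side. *)

(* Defs.v *)
From HB Require Import structures.
From mathcomp Require Import all_boot all_order all_algebra generic_quotient.
From mathcomp Require Import boolp classical_sets functions.
From mathcomp Require Import freeg.

Set Implicit Arguments.
Unset Strict Implicit.
Unset Printing Implicit Defensive.

Import Order.TTheory GRing.Theory Num.Theory.
Local Open Scope classical_set_scope.
Local Open Scope ring_scope.

Section Span.
Variables (K : pzRingType) (V : lmodType K).
Implicit Types (R : set V).

Definition lspan R : set V :=
  [set x | exists s : seq (K * V),
     {in s, forall p, R p.2} /\ x = \sum_(p <- s) p.1 *: p.2].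

Lemma span0 R : lspan R 0.
Proof. by exists [::]; rewrite big_nil; split=> // p. Qed.

Lemma span_lin R a x y : lspan R x -> lspan R y -> lspan R (a *: x + y).
Proof.
move=> [s [Rs ->]] [t [Rt ->]].
exists ([seq (a * p.1, p.2) | p <- s] ++ t); split.
  by move=> p; rewrite mem_cat => /orP[/mapP[q /Rs Rq ->]|/Rt].
rewrite big_cat big_map scaler_sumr /=; congr (_ + _).
by apply: eq_bigr => p _; rewrite scalerA.
Qed.

Lemma span_gen R x : R x -> lspan R x.
Proof.
by move=> Rx; exists [:: (1, x)]; rewrite big_seq1 scale1r; split=> // p /[!inE] /eqP->.
Qed.

Lemma spanD R x y : lspan R x -> lspan R y -> lspan R (x + y).
Proof. by move=> Rx Ry; rewrite -[x]scale1r; apply: span_lin. Qed.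

Lemma spanZ R a x : lspan R x -> lspan R (a *: x).
Proof. by move=> Rx; rewrite -[_ *: _]addr0; apply: span_lin => //; exact: span0. Qed.

Lemma spanN R x : lspan R x -> lspan R (- x).
Proof. by rewrite -scaleN1r; exact: spanZ. Qed.

End Span.

(* The quotient V / lspan R *)
Section Quot.
Variables (K : pzRingType) (V : lmodType K) (R : set V).
Local Open Scope quotient_scope.

Definition qrel : rel V := fun x y => `[< lspan R (x - y) >].

Lemma qrel_refl : reflexive qrel.
Proof. by move=> x; apply/asboolP; rewrite subrr; exact: span0. Qed.

Lemma qrel_sym : symmetric qrel.
Proof.
by move=> x y; apply/asboolP/asboolP => /spanN; rewrite opprB.
Qed.

Lemma qrel_trans : transitive qrel.
Proof.
move=> y x z /asboolP Rxy /asboolP Ryz; apply/asboolP.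
by rewrite -(subrKA y); exact: spanD.
Qed.

Canonical qrel_equiv := EquivRel qrel qrel_refl qrel_sym qrel_trans.

Definition quot : Type := {eq_quot qrel}.

HB.instance Definition _ := Choice.on quot.
HB.instance Definition _ : EqQuotient V qrel quot := EqQuotient.on quot.

Definition qpi (x : V) : quot := \pi_quot x.
Definition qrepr (t : quot) : V := repr t.

Lemma qreprK t : qpi (qrepr t) = t.
Proof. exact: reprK. Qed.

Lemma qpiP x y : qpi x = qpi y <-> lspan R (x - y).
Proof. by split=> [/eqmodP/asboolP//|h]; apply/eqmodP/asboolP. Qed.

Lemma qrepr_pi x : lspan R (qrepr (qpi x) - x).
Proof. by apply/qpiP; rewrite qreprK. Qed.

Let qadd (t u : quot) : quot := qpi (qrepr t + qrepr u).
Let qopp (t : quot) : quot := qpi (- qrepr t).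
Let qscale (a : K) (t : quot) : quot := qpi (a *: qrepr t).

Let qaddE x y : qadd (qpi x) (qpi y) = qpi (x + y).
Proof.
apply/qpiP; rewrite opprD addrACA; apply: spanD; exact: qrepr_pi.
Qed.
Let qoppE x : qopp (qpi x) = qpi (- x).
Proof. by apply/qpiP; rewrite -opprD; apply: spanN; exact: qrepr_pi. Qed.
Let qscaleE a x : qscale a (qpi x) = qpi (a *: x).
Proof. by apply/qpiP; rewrite -scalerBr; apply: spanZ; exact: qrepr_pi. Qed.

Let qind (P : quot -> Prop) : (forall x, P (qpi x)) -> forall t, P t.
Proof. by move=> h t; rewrite -[t]qreprK. Qed.

Let qaddA : associative qadd.
Proof.
by elim/qind => x; elim/qind => y; elim/qind => z; rewrite !qaddE addrA.
Qed.
Let qaddC : commutative qadd.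
Proof. by elim/qind => x; elim/qind => y; rewrite !qaddE addrC. Qed.
Let qadd0 : left_id (qpi 0) qadd.
Proof. by elim/qind => x; rewrite qaddE add0r. Qed.
Let qaddN : left_inverse (qpi 0) qopp qadd.
Proof. by elim/qind => x; rewrite qoppE qaddE addNr. Qed.

HB.instance Definition _ :=
  GRing.isZmodule.Build quot qaddA qaddC qadd0 qaddN.

Let qscaleA a b t : qscale a (qscale b t) = qscale (a * b) t.
Proof. by elim/qind: t => x; rewrite !qscaleE scalerA. Qed.
Let qscale1 : left_id 1 qscale.
Proof. by elim/qind => x; rewrite qscaleE scale1r. Qed.
Let qscaleDr : right_distributive qscale +%R.
Proof.
have addE u v : qpi u + qpi v = qpi (u + v) := qaddE u v.
move=> a; elim/qind => x; elim/qind => y.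
by rewrite addE !(qscaleE, addE) scalerDr.
Qed.
Let qscaleDl t : {morph qscale^~ t : a b / a + b}.
Proof.
elim/qind: t => x a b /=; rewrite !qscaleE scalerDl; exact/esym/qaddE.
Qed.

HB.instance Definition _ := GRing.Zmodule_isLmodule.Build K quot
  qscaleA qscale1 qscaleDr qscaleDl.

Lemma qpi_linear : linear qpi.
Proof.
by move=> a x y; rewrite [a *: qpi x]qscaleE; exact/esym/qaddE.
Qed.

HB.instance Definition _ := GRing.isLinear.Build K V quot _ qpi qpi_linear.

End Quot.

Definition is_grading (K : pzRingType) (V : lmodType K) (H : int -> set V) : Prop :=
  [/\ forall k, H k 0 /\ (forall a x y, H k x -> H k y -> H k (a *: x + y)),
      forall x, exists (s : seq int) (f : int -> V),
        [/\ uniq s, forall k, H k (f k) & x = \sum_(k <- s) f k]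
    & forall (s : seq int) (f : int -> V),
        uniq s -> (forall k, H k (f k)) -> \sum_(k <- s) f k = 0 ->
        {in s, forall k, f k = 0}].

(* A graded vector space, given as the direct sum of its homogeneous parts *)
Record gradedSpace (K : pzRingType) := GradedSpace {
  gcarrier :> lmodType K;
  gdeg : int -> set gcarrier;
  gdegP : is_grading gdeg
}.

Lemma gdeg0 (K : pzRingType) (C : gradedSpace K) k : gdeg (g := C) k 0.
Proof. by have [/(_ k)[]] := gdegP C. Qed.

(* Homogeneous elements of C, each carrying its degree *)
Section Letters.
Variables (K : fieldType) (C : gradedSpace K).

Definition letter : Type := {p : int * C | `[< gdeg p.1 p.2 >]}.
HB.instance Definition _ := Choice.on letter.
HB.instance Definition _ := SubType.on letter.

Definition deg (a : letter) : int := (val a).1.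
Definition elt (a : letter) : C := (val a).2.

Lemma letter0_subproof : `[< gdeg (0 : int) (0 : C) >].
Proof. exact/asboolP/gdeg0. Qed.
Definition letter0 : letter := exist _ (0 : int, 0 : C) letter0_subproof.

(* x in degree k, for x homogeneous of degree k (the zero letter otherwise) *)
Definition ltr (k : int) (x : C) : letter := insubd letter0 (k, x).

End Letters.

(* Linear combinations of words [a_0; ...; a_n] of homogeneous elements, modulo
   multilinearity and modulo the relations Q: for Q = set0 this is the direct
   sum of all tensor powers of C. *)
Section Words.
Variables (K : fieldType) (C : gradedSpace K).
Notation word := (seq (letter C)).
Definition freew : lmodType K := {freeg word / K}.
Definition gen (w : word) : freew := << w >>.

Definition multilinear_rel : set freew :=
  [set t | exists (pre post : word) (c : K) (x y z : letter C),
     [/\ deg x = deg z, deg y = deg z, elt z = c *: elt x + elt y &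
         t = gen (pre ++ z :: post) - c *: gen (pre ++ x :: post)
             - gen (pre ++ y :: post)]].

Variable Q : set freew.

Definition words := quot (multilinear_rel `|` Q).
HB.instance Definition _ := GRing.Lmodule.on words.

Definition wd (w : word) : words := qpi _ (gen w).

(* The linear map taking wd w to f w, for f compatible with the relations *)
Definition lin_ext (W : lmodType K) (f : word -> W) : {linear words -> W} :=
  match pselect (exists g : {linear words -> W}, forall w, g (wd w) = f w) with
  | left h => sval (cid h)
  | right _ => \0
  end.

Lemma words_spanned (t : words) : exists s : seq (K * word),
  t = \sum_(p <- s) p.1 *: wd p.2.
Proof.
rewrite -[t]qreprK; set r := qrepr t.
exists [seq (coeff w r, w) | w <- dom r]; rewrite big_map /=.
rewrite -[r in LHS]freeg_sumE linear_sum /=; apply: eq_bigr => w _.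
rewrite -linearZ /=; congr (qpi _ _).
by apply/eqP/freeg_eqP => v; rewrite coeffZ !coeffU mul1r.
Qed.

Lemma lin_ext_uniq (W : lmodType K) (g h : {linear words -> W}) :
  (forall w, g (wd w) = h (wd w)) -> g =1 h.
Proof.
move=> gh t; have [s ->] := words_spanned t.
by rewrite !linear_sum; apply: eq_bigr => p _; rewrite !linearZ /= gh.
Qed.

Lemma fglift_linear (W : lmodType K) (f : word -> W) : linear (fglift f).
Proof.
pose F := fglift f.
have F_B : zmod_morphism F := lift_is_additive f.
pose FA : {additive freew -> W} :=
  HB.pack F (GRing.isZmodMorphism.Build _ _ F F_B).
have FE : F =1 FA by [].
have FU k w : F << k *g w >> = k *: f w by rewrite /F liftU.
have FZ a x : F (a *: x) = a *: F x.
  have -> : a *: x = \sum_(w <- dom x) << a * coeff w x *g w >> by [].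
  rewrite -[x in RHS]freeg_sumE !FE !(raddf_sum FA) scaler_sumr.
  by apply: eq_bigr => w _; rewrite -!FE !FU scalerA.
by move=> a x y; rewrite -/F FE raddfD -!FE FZ.
Qed.

(* f is linear in each letter and vanishes on Q *)
Definition compatible (W : lmodType K) (f : word -> W) : Prop :=
  (forall (pre post : word) (c : K) (x y z : letter C),
     deg x = deg z -> deg y = deg z -> elt z = c *: elt x + elt y ->
     f (pre ++ z :: post) = c *: f (pre ++ x :: post) + f (pre ++ y :: post))
  /\ (forall t, Q t -> fglift f t = 0).

Lemma lin_extE (W : lmodType K) (f : word -> W) :
  compatible f -> forall w, lin_ext f (wd w) = f w.
Proof.
move=> [f_lin f_Q]; rewrite /lin_ext; case: pselect => [h|[]]; first by case: cid.
pose F : freew -> W := fglift f.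
have F_lin : linear F := fglift_linear f.
have F0 : F 0 = 0 by have := F_lin (-1) 0 0; rewrite scaleN1r oppr0 addr0 scaleN1r addNr.
have FZ a t : F (a *: t) = a *: F t by have := F_lin a t 0; rewrite F0 !addr0.
have FD t u : F (t + u) = F t + F u by have := F_lin 1 t u; rewrite !scale1r.
have FN t : F (- t) = - F t by rewrite -scaleN1r FZ scaleN1r.
have FU w : F (gen w) = f w by rewrite /F liftU scale1r.
have F_rel t : lspan (multilinear_rel `|` Q) t -> F t = 0.
  move=> [s [Rs ->]]; elim: s Rs => [|p s IHs] Rs; first by rewrite big_nil.
  rewrite big_cons FD IHs => [|q qs]; last by apply: Rs; rewrite inE qs orbT.
  rewrite addr0 FZ; have [|/f_Q Fp0] := Rs p (mem_head _ _); last first.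
    by rewrite [F _]Fp0 scaler0.
  move=> [pre [post [c [x [y [z [dx dy ez ->]]]]]]].
  rewrite !(FD, FN) FZ !FU (f_lin _ _ _ _ _ _ dx dy ez).
  by rewrite -addrA -opprD subrr scaler0.
pose g (t : words) := F (qrepr t).
have gE x : g (qpi _ x) = F x.
  by apply/eqP; rewrite -subr_eq0 -FN -FD; apply/eqP/F_rel; exact: qrepr_pi.
have g_lin : linear g.
  by move=> a t u; rewrite -[t]qreprK -[u]qreprK -linearP !gE F_lin.
exists (HB.pack_for {linear words -> W} g
  (GRing.isLinear.Build _ _ _ _ _ g_lin)) => w.
by rewrite [LHS]gE FU.
Qed.

End Words.
Arguments lin_ext {K C Q W} f.

Definition tens (K : fieldType) (C : gradedSpace K) := words (C := C) set0.

(* sum of f x' x'' over t = sum of x' (x) x'' *)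
Definition sweedler (K : fieldType) (C : gradedSpace K) (W : lmodType K)
    (f : letter C -> letter C -> W) (t : tens C) : W :=
  lin_ext (fun w => if w is [:: x; y] then f x y else 0) t.

Notation "\sw_ ( x , y <- t ) E" := (sweedler (fun x y => E) t)
  (at level 36, E at level 36, x name, y name, t at level 50,
   format "\sw_ ( x ,  y  <-  t )  E") : ring_scope.

Section WordLemmas.
Variables (K : fieldType) (C : gradedSpace K).
Notation word := (seq (letter C)).
Implicit Types (W : lmodType K).

Definition lcomb (c : K) (x y z : letter C) : Prop :=
  [/\ deg x = deg z, deg y = deg z & elt z = c *: elt x + elt y].

Lemma letterP (a : letter C) : gdeg (deg a) (elt a).
Proof. exact/asboolP/(valP a). Qed.

Lemma ltrP k (x : C) : gdeg k x -> deg (ltr k x) = k /\ elt (ltr k x) = x.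
Proof.
move=> kx; rewrite /deg /elt /ltr.
by rewrite (_ : val (insubd _ _) = (k, x)) // val_insubd (introT (asboolP _) kx).
Qed.

Definition multilin W (f : word -> W) : Prop :=
  forall pre post c x y z, lcomb c x y z ->
    f (pre ++ z :: post) = c *: f (pre ++ x :: post) + f (pre ++ y :: post).

Definition bilin W (f : letter C -> letter C -> W) : Prop :=
  (forall a c x y z, lcomb c x y z -> f a z = c *: f a x + f a y) /\
  (forall a c x y z, lcomb c x y z -> f z a = c *: f x a + f y a).

Lemma wd_multilin Q : multilin (wd (C := C) Q).
Proof.
move=> pre post c x y z [dx dy ez]; rewrite /wd -linearP; apply/qpiP.
by apply: span_gen; left; exists pre, post, c, x, y, z; split; rewrite // opprD addrA.
Qed.

Lemma multilin_head W (f : word -> W) post c x y z : multilin f ->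
  lcomb c x y z -> f (z :: post) = c *: f (x :: post) + f (y :: post).
Proof. by move=> f_lin; exact: (f_lin [::]). Qed.

Lemma compatible0 W (f : word -> W) : multilin f -> compatible set0 f.
Proof. by move=> f_lin; split=> // pre post c x y z dx dy ez; exact: f_lin. Qed.

Lemma compatible_gen W (f : word -> W) Q : multilin f ->
  (forall t, Q t -> exists2 w, t = gen w & f w = 0) -> compatible Q f.
Proof.
move=> f_lin f_Q; split=> [pre post c x y z dx dy ez|t /f_Q[w -> fw]].
  exact: f_lin.
by rewrite liftU fw scaler0.
Qed.

Definition on_pairs W (f : letter C -> letter C -> W) (w : word) : W :=
  if w is [:: x; y] then f x y else 0.

Lemma on_pairs_multilin W (f : letter C -> letter C -> W) :
  bilin f -> multilin (on_pairs f).
Proof.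
move=> [fr fl] [|a [|b pre]] post c x y z h /=.
- by case: post => [|b [|b' post]] /=; rewrite ?scaler0 ?addr0 //; exact: fl.
- by case: post => [|b post] /=; rewrite ?scaler0 ?addr0 //; exact: fr.
- by case: pre => [|? ?]; rewrite /= scaler0 addr0.
Qed.

Lemma sweedlerE W (f : letter C -> letter C -> W) x y :
  bilin f -> sweedler f (wd set0 [:: x; y]) = f x y.
Proof. by move=> /on_pairs_multilin/compatible0/lin_extE/(_ [:: x; y]). Qed.

Lemma sweedler_linear W (f : letter C -> letter C -> W) : linear (sweedler f).
Proof. by move=> a t u; exact: linearP. Qed.

Lemma sweedler_lcomb W (f g h : letter C -> letter C -> W) c t :
  bilin f -> bilin g -> bilin h -> (forall x y, h x y = c *: f x y + g x y) ->
  sweedler h t = c *: sweedler f t + sweedler g t.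
Proof.
move=> fb gb hb hE; have [s ->] := words_spanned t.
rewrite /sweedler !linear_sum -big_split /=; apply: eq_bigr => p _.
rewrite !linearZ /= !lin_extE; [|exact/compatible0/on_pairs_multilin..].
rewrite -scalerDr; congr (_ *: _).
by case: p.2 => [|x [|y [|? ?]]]; rewrite ?scaler0 ?addr0.
Qed.

Section Splits.
Variable W : lmodType K.
Variable F : word -> letter C -> word -> W.

Definition splits (s : word) : W :=
  \sum_(i < size s) F (take i s) (nth (letter0 C) s i) (drop i.+1 s).

End Splits.

Lemma splits_nil W (F : word -> letter C -> word -> W) : splits F [::] = 0.
Proof. by rewrite /splits big_ord0. Qed.

Lemma splits_cons W (F : word -> letter C -> word -> W) a s :
  splits F (a :: s) = F [::] a s + splits (fun p => F (a :: p)) s.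
Proof. by rewrite /splits big_ord_recl /= drop0. Qed.

Lemma splits_cat W (F : word -> letter C -> word -> W) p z q :
  splits F (p ++ z :: q) =
  splits (fun p' x q' => F p' x (q' ++ z :: q)) p + F p z q
  + splits (fun q' => F (p ++ z :: q')) q.
Proof.
elim: p F => [|a p IHp] F /=; first by rewrite splits_cons splits_nil add0r.
by rewrite !splits_cons IHp !addrA.
Qed.

Lemma splits_lcomb W (F G H : word -> letter C -> word -> W) c s :
  (forall p x q, H p x q = c *: F p x q + G p x q) ->
  splits H s = c *: splits F s + splits G s.
Proof.
move=> HE; rewrite /splits scaler_sumr -big_split /=.
by apply: eq_bigr => i _; exact: HE.
Qed.

(* F is linear in each of its letters *)
Definition split_lin W (F : word -> letter C -> word -> W) : Prop :=
  forall c x y z, lcomb c x y z ->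
  [/\ forall p p' a q, F (p ++ z :: p') a q =
        c *: F (p ++ x :: p') a q + F (p ++ y :: p') a q,
      forall p q, F p z q = c *: F p x q + F p y q
    & forall p a q q', F p a (q ++ z :: q') =
        c *: F p a (q ++ x :: q') + F p a (q ++ y :: q')].

Lemma splits_multilin W (F : word -> letter C -> word -> W) :
  split_lin F -> multilin (splits F).
Proof.
move=> F_lin pre post c x y z /F_lin[Fl Fm Fr]; rewrite !splits_cat.
rewrite (splits_lcomb (H := fun p' a q' => F p' a (q' ++ z :: post))
  (F := fun p' a q' => F p' a (q' ++ x :: post))
  (G := fun p' a q' => F p' a (q' ++ y :: post)) (c := c)) //.
rewrite (splits_lcomb (H := fun q' => F (pre ++ z :: q'))
  (F := fun q' => F (pre ++ x :: q')) (G := fun q' => F (pre ++ y :: q')) (c := c)) //.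
by rewrite Fm !scalerDr [X in X + _ = _]addrACA [LHS]addrACA.
Qed.

End WordLemmas.

(* The product is an operator of degree -m, and the signs are the Koszul signs
   of such an operator. Equivalently, (-1)^(m |x|) x y makes C[m] a DG
   commutative algebra. For odd m these are the only signs compatible with
   frobl and frobr for which fourfold products do not vanish identically. *)
Record openFrobenius (K : fieldType) (m : int) := OpenFrobenius {
  fcarrier :> gradedSpace K;
  dif : {linear fcarrier -> fcarrier};
  fmul : fcarrier -> fcarrier -> fcarrier;
  cop : {linear fcarrier -> tens fcarrier};
  eps : {scalar fcarrier};
  coaug : fcarrier;

  dif_deg : forall k x, gdeg k x -> gdeg (k - 1) (dif x);
  difK : forall x, dif (dif x) = 0;

  mul_linl : forall y, linear (fmul^~ y);
  mul_linr : forall x, linear (fmul x);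
  mul_deg : forall i j x y,
    gdeg i x -> gdeg j y -> gdeg (i + j - m) (fmul x y);
  mul_assoc : forall i x y z, gdeg i x ->
    fmul (fmul x y) z = (-1) ^ (m * i + m) *: fmul x (fmul y z);
  mul_comm : forall i j x y, gdeg i x -> gdeg j y ->
    fmul x y = (-1) ^ (i * j + m) *: fmul y x;
  dif_mul : forall i x y, gdeg i x ->
    dif (fmul x y) = (-1) ^ m *: (fmul (dif x) y + (-1) ^ i *: fmul x (dif y));

  cop_deg : forall k x, gdeg k x ->
    lspan [set t | exists a b : letter fcarrier,
                    deg a + deg b = k /\ t = wd set0 [:: a; b]] (cop x);
  cop_assoc : forall x,
    \sw_(a, b <- cop x) lin_ext (fun w => wd set0 (rcons w b)) (cop (elt a)) =
    \sw_(a, b <- cop x) lin_ext (fun w => wd set0 (a :: w)) (cop (elt b));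
  cop_comm : forall x,
    \sw_(a, b <- cop x) ((-1) ^ (deg a * deg b) *: wd set0 [:: b; a]) = cop x;
  cop_counitl : forall x, \sw_(a, b <- cop x) (eps (elt a) *: elt b) = x;
  cop_counitr : forall x, \sw_(a, b <- cop x) (eps (elt b) *: elt a) = x;
  dif_cop : forall x,
    cop (dif x) =
    \sw_(a, b <- cop x) (wd set0 [:: ltr (deg a - 1) (dif (elt a)); b]
      + (-1) ^ deg a *: wd set0 [:: a; ltr (deg b - 1) (dif (elt b))]);
  eps_deg : forall k x, gdeg k x -> k != 0 -> eps x = 0;
  eps_dif : forall x, eps (dif x) = 0;

  one_deg : gdeg 0 coaug;
  eps_one : eps coaug = 1;
  dif_one : dif coaug = 0;
  cop_one : cop coaug = wd set0 [:: ltr 0 coaug; ltr 0 coaug];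

  frobl : forall i x y, gdeg i x ->
    cop (fmul x y) =
    \sw_(a, b <- cop y) wd set0 [:: ltr (i + deg a - m) (fmul x (elt a)); b];
  frobr : forall j x y, gdeg j y ->
    cop (fmul x y) =
    \sw_(a, b <- cop x)
      ((-1) ^ (m * deg a) *: wd set0 [:: a; ltr (deg b + j - m) (fmul (elt b) y)])
}.

Arguments dif {K m o}.
Arguments fmul {K m o}.
Arguments cop {K m o}.
Arguments eps {K m o}.
Arguments coaug {K m} o.

Section Homology.
Variables (K : pzRingType) (V : lmodType K) (H : int -> set V).
Variable D : {linear V -> V}.

Definition chains : set V := lspan [set x | exists k, H k x].
Definition cyclep : {pred V} := fun x => `[< chains x /\ D x = 0 >].

Lemma cyclep_submod : submod_closed cyclep.
Proof.
split; first by apply/asboolP; split; [exact: span0 | rewrite linear0].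
move=> a x y /asboolP[Hx Dx] /asboolP[Hy Dy]; apply/asboolP; split.
  exact: span_lin.
by rewrite linearP Dx Dy scaler0 addr0.
Qed.
HB.instance Definition _ :=
  GRing.isSubmodClosed.Build K V cyclep cyclep_submod.

Definition cycles : Type := {x : V | cyclep x}.
HB.instance Definition _ := SubChoice.on cycles.
HB.instance Definition _ := [SubChoice_isSubLmodule of cycles by <:].

Definition homology :=
  quot [set z : cycles | exists2 y, chains y & D y = val z].
HB.instance Definition _ := GRing.Lmodule.on homology.

(* the class of the cycle x (0 if x is not a cycle) *)
Definition hclass (x : V) : homology := qpi _ (insubd (0 : cycles) x).
Definition hrepr (t : homology) : V := val (qrepr t).
Definition hdeg (k : int) : set homology :=
  [set t | exists z, [/\ H k z, D z = 0 & t = hclass z]].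

End Homology.

Section Cyclic.
Variables (K : fieldType) (m : int) (C : openFrobenius K m).
Notation word := (seq (letter C)).

Definition dif_l (a : letter C) : letter C := ltr (deg a - 1) (dif (elt a)).
Definition mul_l (a b : letter C) : letter C :=
  ltr (deg a + deg b - m) (fmul (elt a) (elt b)).
(* the representative in ker eps of the class of a modulo the coaugmentation *)
Definition red_l (a : letter C) : letter C :=
  ltr (deg a) (elt a - eps (elt a) *: coaug C).
Definition cop_l (a : letter C) : tens C := cop (elt a).

(* The word a_0 :: [a_1; ...; a_n] stands for a_0[a_1|...|a_n]. A letter a_i
   with i > 0 represents its class in Cbar = C / K.1, so words with the
   coaugmentation in such a position are set to 0. *)
Definition unit_rel : set (freew C) :=
  [set t | exists (a : letter C) (pre post : word) (u : letter C),
     elt u = coaug C /\ t = gen (a :: pre ++ u :: post)].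
Definition ccw := words unit_rel.
Notation "<[ w ]>" := (wd unit_rel w) (format "<[ w ]>").

Definition bdeg (s : word) : int := \sum_(a <- s) (deg a - 1).
Definition wdeg (w : word) : int := if w is a :: s then deg a + bdeg s else 0.

Notation ith s i := (nth (letter0 C) s i).

(* The letter dif a_i enters with a minus sign because the differential of the
   desuspension Sigma Cbar is minus that of Cbar; with a plus sign, b + u^-1 B
   would not square to zero. *)
Definition bint_word (w : word) : ccw :=
  if w is a :: s then
    <[dif_l a :: s]>
    - \sum_(i < size s) (-1) ^ (deg a + bdeg (take i s)) *:
        <[a :: take i s ++ dif_l (ith s i) :: drop i.+1 s]>
  else 0.

Definition bcop_word (w : word) : ccw :=
  if w is a :: s then
    \sum_(i < size s) \sw_(x, y <- cop_l (ith s i))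
      ((-1) ^ (deg a + bdeg (rcons (take i s) x)) *:
        <[a :: take i s ++ x :: y :: drop i.+1 s]>)
    + \sw_(x, y <- cop_l a)
        ((-1) ^ deg x *:
          (<[x :: y :: s]> - (-1) ^ ((deg y - 1) * bdeg s) *: <[x :: rcons s y]>))
  else 0.

Definition B_word (w : word) : ccw :=
  if w is a :: s then
    \sum_(i < size s) (-1) ^ (bdeg (drop i s) * bdeg (take i s)) *:
      (eps (elt a) *: <[red_l (ith s i) :: drop i.+1 s ++ take i s]>)
  else 0.

Definition dot_word (v w : word) : ccw :=
  match v, w with
  | a :: s, b :: r => (-1) ^ (deg b * bdeg s) *: <[mul_l a b :: s ++ r]>
  | _, _ => 0
  end.

Definition bint : {linear ccw -> ccw} := lin_ext bint_word.
Definition bcop : {linear ccw -> ccw} := lin_ext bcop_word.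
Definition Bop : {linear ccw -> ccw} := lin_ext B_word.
Definition dot (s t : ccw) : ccw :=
  lin_ext (fun v => lin_ext (dot_word v) t) s.

(* CC_k is the product over n of the degree k part of C (x) (Sigma Cbar)^(x) n;
   the n-th component of a chain is alpha n. *)
Definition CC (k : int) : set (nat -> ccw) :=
  [set al | forall n,
     lspan [set t | exists w : word,
                     [/\ size w = n.+1, wdeg w = k & t = <[w]>]] (al n)].

Definition bCC (al : nat -> ccw) : nat -> ccw :=
  fun n => bint (al n) + (if n is p.+1 then bcop (al p) else 0).
Definition BCC (al : nat -> ccw) : nat -> ccw := fun n => Bop (al n.+1).
Definition dotCC (al be : nat -> ccw) : nat -> ccw :=
  fun n => \sum_(i < n.+1) dot (al i) (be (n - i)%N).

(* CC[u], u of degree 2; the coefficient of u^j in alpha is alpha j. *)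
Definition CCu (k : int) : set (nat -> nat -> ccw) :=
  [set al | (forall j, CC (k - 2 * j%:Z) (al j)) /\
            exists N, forall j, (N <= j)%N -> al j = 0].

Definition bCCu (al : nat -> nat -> ccw) : nat -> nat -> ccw :=
  fun j => bCC (al j) + BCC (al j.+1).

Lemma bCC_linear : linear bCC.
Proof.
move=> a x y; apply/funext => n.
rewrite -[RHS]/(a *: bCC x n + bCC y n) /bCC !linearP scalerDr addrACA.
by case: n => [|n]; rewrite ?linearP ?scaler0 ?addr0.
Qed.
HB.instance Definition _ :=
  GRing.isLinear.Build K (nat -> ccw) (nat -> ccw) _ bCC bCC_linear.

Lemma BCC_linear : linear BCC.
Proof. by move=> a x y; apply/funext => n; rewrite /BCC [LHS]linearP. Qed.
HB.instance Definition _ :=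
  GRing.isLinear.Build K (nat -> ccw) (nat -> ccw) _ BCC BCC_linear.

Lemma bCCu_linear : linear bCCu.
Proof.
move=> a x y; apply/funext => j.
rewrite -[RHS]/(a *: bCCu x j + bCCu y j) /bCCu scalerDr addrACA.
by rewrite -!linearP.
Qed.
HB.instance Definition _ :=
  GRing.isLinear.Build K (nat -> nat -> ccw) (nat -> nat -> ccw) _
    bCCu bCCu_linear.

Definition HH := homology CC bCC.
Definition HC := homology CCu bCCu.
HB.instance Definition _ := GRing.Lmodule.on HH.
HB.instance Definition _ := GRing.Lmodule.on HC.

Definition HH_deg : int -> set HH := hdeg (H := CC) (D := bCC).
Definition HC_deg : int -> set HC := hdeg (H := CCu) (D := bCCu).

Definition incl (al : nat -> ccw) : nat -> nat -> ccw :=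
  fun j => if j is 0 then al else 0.
(* multiplication by u, a section of u^-1 *)
Definition mulu (al : nat -> nat -> ccw) : nat -> nat -> ccw :=
  fun j => if j is i.+1 then al i else 0.

Definition Emap (t : HH) : HC := hclass CCu bCCu (incl (hrepr t)).

(* The connecting map: lift a cycle along u^-1, apply the differential, and
   read off the result in CC (the coefficient of u^0). *)
Definition Mmap (t : HC) : HH := hclass CC bCC (bCCu (mulu (hrepr t)) 0).

Definition HHdot (s t : HH) : HH := hclass CC bCC (dotCC (hrepr s) (hrepr t)).

(* The product of degree 0 on HH[m], for x in HH_i. The Koszul sign of the
   shift makes it associative and graded commutative, which HHdot is only up
   to sign when m is odd. *)
Definition HHstar (i : int) (x y : HH) : HH := (-1) ^ (m * i) *: HHdot x y.

Fixpoint HHprod (s : seq (int * HH)) : HH :=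
  match s with
  | [::] => 0
  | [:: x] => x.2
  | x :: s' => HHstar x.1 x.2 (HHprod s')
  end.

(* c_n on (alpha_1, ..., alpha_n), each listed with its degree in HC[m-2]; an
   element of degree k there is sent by M to HH_(k + m - 1). *)
Definition cyc_bracket (s : seq (int * HC)) : HC :=
  (-1) ^ (\sum_(i < size s) (size s - i.+1)%N%:Z * (nth (0, 0) s i).1) *:
  Emap (HHprod [seq (al.1 + (m - 2) + 1, Mmap al.2) | al <- s]).

End Cyclic.
Arguments unit_rel {K m} C _.
Arguments bint {K m} C.
Arguments bcop {K m} C.
Arguments Bop {K m} C.
Arguments HC_deg {K m} C _ _.
Arguments cyc_bracket {K m} C _.

Section CyclicLemmas.
Variables (K : fieldType) (m : int) (C : openFrobenius K m).
Notation word := (seq (letter C)).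
Notation "<[ w ]>" := (wd (unit_rel C) w) (format "<[ w ]>").

Lemma dif_lP (a : letter C) :
  deg (dif_l a) = deg a - 1 /\ elt (dif_l a) = dif (elt a).
Proof. exact/ltrP/dif_deg/letterP. Qed.

Lemma mul_lP (a b : letter C) :
  deg (mul_l a b) = deg a + deg b - m /\ elt (mul_l a b) = fmul (elt a) (elt b).
Proof. apply/ltrP/mul_deg; exact: letterP. Qed.

Lemma red_lP (a : letter C) :
  deg (red_l a) = deg a /\ elt (red_l a) = elt a - eps (elt a) *: coaug C.
Proof.
apply: ltrP; have [gr _ _] := gdegP C.
have gdegB k x y : gdeg (g := C) k x -> gdeg k y -> gdeg k (x - y).
  by move=> kx ky; rewrite addrC -scaleN1r; apply: (gr k).2.
apply: gdegB; first exact: letterP.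
have [->|da] := eqVneq (deg a) 0.
  rewrite -[_ *: _]addr0; apply: (gr 0).2; [exact: one_deg | exact: (gr 0).1].
by rewrite (eps_deg (letterP a) da) scale0r; exact: (gr _).1.
Qed.

Lemma dif_l_lcomb c (x y z : letter C) :
  lcomb c x y z -> lcomb c (dif_l x) (dif_l y) (dif_l z).
Proof.
move=> [dx dy ez]; split; rewrite ?(dif_lP _).1 ?dx ?dy // !(dif_lP _).2 ez.
exact: linearP.
Qed.

Lemma mul_l_lcombl c (x y z b : letter C) :
  lcomb c x y z -> lcomb c (mul_l x b) (mul_l y b) (mul_l z b).
Proof.
move=> [dx dy ez]; split; rewrite ?(mul_lP _ _).1 ?dx ?dy // !(mul_lP _ _).2 ez.
exact: mul_linl.
Qed.

Lemma mul_l_lcombr c (x y z b : letter C) :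
  lcomb c x y z -> lcomb c (mul_l b x) (mul_l b y) (mul_l b z).
Proof.
move=> [dx dy ez]; split; rewrite ?(mul_lP _ _).1 ?dx ?dy // !(mul_lP _ _).2 ez.
exact: mul_linr.
Qed.

Lemma red_l_lcomb c (x y z : letter C) :
  lcomb c x y z -> lcomb c (red_l x) (red_l y) (red_l z).
Proof.
move=> [dx dy ez]; split; rewrite ?(red_lP _).1 ?dx ?dy // !(red_lP _).2 ez.
by rewrite linearP /= scalerDl -scalerA scalerBr opprD addrACA.
Qed.

Lemma cop_l_lcomb c (x y z : letter C) :
  lcomb c x y z -> cop_l z = c *: cop_l x + cop_l y.
Proof. by move=> [_ _ ez]; rewrite /cop_l ez linearP. Qed.

Lemma bdeg_cat (p q : word) : bdeg (p ++ q) = bdeg p + bdeg q.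
Proof. exact: big_cat. Qed.

Lemma bdeg_cons a (q : word) : bdeg (a :: q) = deg a - 1 + bdeg q.
Proof. exact: big_cons. Qed.

Lemma bdeg_rcons (q : word) a : bdeg (rcons q a) = bdeg q + (deg a - 1).
Proof. by rewrite -cats1 bdeg_cat bdeg_cons /bdeg big_nil addr0. Qed.

Definition bdegE := (bdeg_cat, bdeg_cons, bdeg_rcons).

Lemma sgn_lin (W : lmodType K) (s1 s2 s3 c : K) (a b d : W) :
  s1 = s3 -> s2 = s3 -> d = c *: a + b -> s3 *: d = c *: (s1 *: a) + s2 *: b.
Proof. by move=> -> -> ->; rewrite scalerDr !scalerA mulrC. Qed.

Lemma wd_unit a pre post (u : letter C) :
  elt u = coaug C -> <[a :: pre ++ u :: post]> = 0.
Proof.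
move=> u1; rewrite /wd -[RHS](linear0 (qpi _)); apply/qpiP; rewrite subr0.
by apply: span_gen; right; exists a, pre, post, u.
Qed.

Lemma wd_elt0 pre post (u : letter C) : elt u = 0 -> <[pre ++ u :: post]> = 0.
Proof.
move=> u0; rewrite (@wd_multilin _ _ _ pre post (-1) u u u) ?scaleN1r ?addNr //.
by split; rewrite // u0 scaler0 addr0.
Qed.

Definition unit_zero (W : lmodType K) (f : word -> W) : Prop :=
  forall a pre post (u : letter C), elt u = coaug C -> f (a :: pre ++ u :: post) = 0.

Lemma compatible_unit (W : lmodType K) (f : word -> W) :
  multilin f -> unit_zero f -> compatible (unit_rel C) f.
Proof.
move=> f_lin f_unit; apply: compatible_gen => // t [a [pre [post [u [u1 ->]]]]].
by exists (a :: pre ++ u :: post) => //; exact: f_unit.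
Qed.

Lemma splits_unit (W : lmodType K) (F : word -> letter C -> word -> W) pre u post :
  (forall p p' x q, F (p ++ u :: p') x q = 0) ->
  (forall p q, F p u q = 0) ->
  (forall p x q q', F p x (q ++ u :: q') = 0) ->
  splits F (pre ++ u :: post) = 0.
Proof.
move=> Fl Fm Fr; rewrite splits_cat Fm addr0.
by rewrite /splits !big1 ?addr0.
Qed.

Let bintF (a : letter C) p x q : ccw C :=
  (-1) ^ (deg a + bdeg p) *: <[a :: p ++ dif_l x :: q]>.

Lemma bint_wordE a s :
  bint_word (a :: s) = <[dif_l a :: s]> - splits (bintF a) s.
Proof. by []. Qed.

Lemma bintF_lin a : split_lin (bintF a).
Proof.
move=> c x y z h; have [dx dy _] := h; split=> [p p' b q|p q|p b q q'].
- apply: sgn_lin; rewrite ?bdegE ?dx ?dy // -!catA !cat_cons.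
  exact: (wd_multilin _ (a :: p)).
- by apply: sgn_lin => //; exact: (wd_multilin _ (a :: p) q (dif_l_lcomb h)).
- apply: sgn_lin => //.
  by have := wd_multilin (unit_rel C) (a :: p ++ dif_l b :: q) q' h; rewrite /= -!catA.
Qed.

Lemma bint_word_multilin : multilin (@bint_word K m C).
Proof.
move=> [|a pre] post c x y z h; rewrite ?cat0s ?cat_cons !bint_wordE.
  have [dx dy _] := h.
  rewrite (multilin_head _ (wd_multilin _) (dif_l_lcomb h)).
  rewrite (splits_lcomb (c := c) (F := bintF x) (G := bintF y)) => [|p b q].
    by rewrite scalerBr opprD addrACA.
  apply: sgn_lin; rewrite ?dx ?dy //.
  exact: (multilin_head _ (wd_multilin _) h).
rewrite (splits_multilin (bintF_lin a) pre post h).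
rewrite -!cat_cons (wd_multilin _ (dif_l a :: pre) post h).
by rewrite scalerBr opprD addrACA.
Qed.

Lemma bint_word_unit : unit_zero (@bint_word K m C).
Proof.
move=> a pre post u u1; rewrite bint_wordE wd_unit // splits_unit ?subrr //.
- by move=> p p' x q; rewrite /bintF -catA cat_cons wd_unit ?scaler0.
- move=> p q; rewrite /bintF -cat_cons wd_elt0 ?scaler0 //.
  by rewrite (dif_lP u).2 u1 dif_one.
- move=> p x q q'; have := wd_unit a (p ++ dif_l x :: q) q' u1.
  by rewrite /bintF -catA cat_cons => ->; rewrite scaler0.
Qed.

Lemma bint_wd w : bint C <[w]> = bint_word w.
Proof.
apply: lin_extE; apply: compatible_unit; [exact: bint_word_multilin | exact: bint_word_unit].
Qed.

Let bcopF (a : letter C) p x q : ccw C :=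
  \sw_(u, v <- cop_l x)
    ((-1) ^ (deg a + bdeg (rcons p u)) *: <[a :: p ++ u :: v :: q]>).

Let bcop0 s (x y : letter C) : ccw C :=
  (-1) ^ deg x *:
    (<[x :: y :: s]> - (-1) ^ ((deg y - 1) * bdeg s) *: <[x :: rcons s y]>).

Lemma bcop_wordE a s :
  bcop_word (a :: s) = splits (bcopF a) s + \sw_(x, y <- cop_l a) bcop0 s x y.
Proof. by []. Qed.

Lemma bcopF_bilin a p q : bilin (fun u v =>
  (-1) ^ (deg a + bdeg (rcons p u)) *: <[a :: p ++ u :: v :: q]>).
Proof.
split=> [b|b] c x y z h; have [dx dy _] := h; apply: sgn_lin => //.
- have := wd_multilin (unit_rel C) (a :: p ++ [:: b]) q h.
  by rewrite /= -!catA.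
- by rewrite !bdegE dx.
- by rewrite !bdegE dy.
- exact: (wd_multilin (unit_rel C) (a :: p) _ h).
Qed.

Lemma bcop0_bilin s : bilin (bcop0 s).
Proof.
split=> [b|b] c x y z h; have [dx dy _] := h; apply: sgn_lin; rewrite ?dx ?dy //.
- rewrite (wd_multilin _ [:: b] s h) /=.
  have -> : (-1) ^ ((deg z - 1) * bdeg s) *: <[b :: rcons s z]> =
    c *: ((-1) ^ ((deg x - 1) * bdeg s) *: <[b :: rcons s x]>) +
    (-1) ^ ((deg y - 1) * bdeg s) *: <[b :: rcons s y]>.
    apply: sgn_lin; rewrite ?dx ?dy //.
    by have := wd_multilin (unit_rel C) (b :: s) [::] h; rewrite /= !cats1.
  by rewrite scalerBr opprD addrACA dx dy.
- rewrite (multilin_head _ (wd_multilin _) h).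
  have -> : (-1) ^ ((deg b - 1) * bdeg s) *: <[z :: rcons s b]> =
    c *: ((-1) ^ ((deg b - 1) * bdeg s) *: <[x :: rcons s b]>) +
    (-1) ^ ((deg b - 1) * bdeg s) *: <[y :: rcons s b]>.
    apply: sgn_lin => //.
    exact: (multilin_head _ (wd_multilin _) h).
  by rewrite scalerBr opprD addrACA.
Qed.

Lemma bcopF_lin a : split_lin (bcopF a).
Proof.
move=> c x y z h; have [dx dy _] := h; split=> [p p' b q|p q|p b q q'].
- apply: sweedler_lcomb; try exact: bcopF_bilin.
  move=> u v; apply: sgn_lin; rewrite ?bdegE ?dx ?dy // -!catA !cat_cons.
  exact: (wd_multilin _ (a :: p)).
- by rewrite /bcopF (cop_l_lcomb h) sweedler_linear.
- apply: sweedler_lcomb; try exact: bcopF_bilin.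
  move=> u v; apply: sgn_lin => //.
  by have := wd_multilin (unit_rel C) (a :: p ++ u :: v :: q) q' h; rewrite /= -!catA.
Qed.

Lemma bcop0_lcomb s1 s2 s3 c x y :
  bdeg s1 = bdeg s3 -> bdeg s2 = bdeg s3 ->
  (forall pre post, <[pre ++ s3 ++ post]> =
     c *: <[pre ++ s1 ++ post]> + <[pre ++ s2 ++ post]>) ->
  bcop0 s3 x y = c *: bcop0 s1 x y + bcop0 s2 x y.
Proof.
move=> d1 d2 h; apply: sgn_lin => //.
have := h [:: x; y] [::]; rewrite !cats0 /= => ->.
have := h [:: x] [:: y]; rewrite /= !cats1 => ->.
by rewrite d1 d2 scalerBr scalerDr opprD !scalerA [_ * c]mulrC addrACA.
Qed.

Lemma bcop_word_multilin : multilin (@bcop_word K m C).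
Proof.
move=> [|a pre] post c x y z h; rewrite ?cat0s ?cat_cons !bcop_wordE;
  have [dx dy _] := h.
  rewrite (cop_l_lcomb h) sweedler_linear scalerDr addrACA; congr (_ + _).
  apply: splits_lcomb => p b q; apply: sweedler_lcomb; try exact: bcopF_bilin.
  move=> u v; apply: sgn_lin; rewrite ?dx ?dy //.
  exact: (multilin_head _ (wd_multilin _) h).
rewrite (splits_multilin (bcopF_lin a) pre post h) scalerDr addrACA; congr (_ + _).
apply: sweedler_lcomb; try exact: bcop0_bilin.
move=> u v; apply: bcop0_lcomb; rewrite ?bdegE ?dx ?dy // => p q.
by have := wd_multilin (unit_rel C) (p ++ pre) (post ++ q) h; rewrite -!catA.
Qed.

Lemma sweedler0 (W : lmodType K) (f : letter C -> letter C -> W) t :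
  (forall x y, f x y = 0) -> sweedler f t = 0.
Proof.
move=> f0; have fb : bilin f by split=> *; rewrite !f0 scaler0 addr0.
by rewrite (@sweedler_lcomb _ _ _ f f f (-1) t) ?scaleN1r ?addNr // => x y;
  rewrite !f0 scaler0 addr0.
Qed.

Lemma bcop_word_unit : unit_zero (@bcop_word K m C).
Proof.
move=> a pre post u u1; rewrite bcop_wordE splits_unit ?add0r.
- apply: sweedler0 => x y; rewrite /bcop0.
  rewrite -(cat_cons y pre) wd_unit // -cats1 -catA cat_cons wd_unit //.
  by rewrite scaler0 subr0 scaler0.
- move=> p p' x q; apply: sweedler0 => v w.
  by rewrite -catA cat_cons wd_unit ?scaler0.
- move=> p q; rewrite /bcopF /cop_l u1 cop_one sweedlerE; last exact: bcopF_bilin.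
  have [_ e1] := ltrP (one_deg C).
  by rewrite (@wd_unit a p (ltr 0 (coaug C) :: q)) ?scaler0.
- move=> p x q q'; apply: sweedler0 => v w.
  have := wd_unit a (p ++ v :: w :: q) q' u1; rewrite -catA !cat_cons => ->.
  by rewrite scaler0.
Qed.

Lemma bcop_wd w : bcop C <[w]> = bcop_word w.
Proof.
apply: lin_extE; apply: compatible_unit; [exact: bcop_word_multilin | exact: bcop_word_unit].
Qed.

Let BF (a : letter C) p x q : ccw C :=
  (-1) ^ (bdeg (x :: q) * bdeg p) *: (eps (elt a) *: <[red_l x :: q ++ p]>).

Lemma B_wordE a s : B_word (a :: s) = splits (BF a) s.
Proof.
by apply: eq_bigr => i _; rewrite [drop i s](drop_nth (letter0 C)).
Qed.

Lemma wd_eps_lin (a : letter C) w1 w2 w3 c :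
  <[w3]> = c *: <[w1]> + <[w2]> ->
  eps (elt a) *: <[w3]> = c *: (eps (elt a) *: <[w1]>) + eps (elt a) *: <[w2]>.
Proof. by move=> ->; rewrite scalerDr !scalerA mulrC. Qed.

Lemma BF_lin a : split_lin (BF a).
Proof.
move=> c x y z h; have [dx dy _] := h; split=> [p p' b q|p q|p b q q'];
  apply: sgn_lin; rewrite ?bdegE ?dx ?dy //; apply: wd_eps_lin.
- have := wd_multilin (unit_rel C) (red_l b :: q ++ p) p' h.
  by rewrite /= -!catA.
- exact: (multilin_head _ (wd_multilin _) (red_l_lcomb h)).
- have := wd_multilin (unit_rel C) (red_l b :: q) (q' ++ p) h.
  by rewrite /= -!catA.
Qed.

Lemma B_word_multilin : multilin (@B_word K m C).
Proof.
move=> [|a pre] post c x y z h; rewrite ?cat0s ?cat_cons !B_wordE; last first.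
  exact: (splits_multilin (BF_lin a)).
apply: splits_lcomb => p b q; apply: sgn_lin => //.
have [_ _ ->] := h; rewrite linearP /= scalerDl -!scalerA.
by [].
Qed.

Lemma B_word_unit : unit_zero (@B_word K m C).
Proof.
move=> a pre post u u1; rewrite B_wordE splits_unit //.
- move=> p p' x q; have := wd_unit (red_l x) (q ++ p) p' u1.
  by rewrite /BF -catA => ->; rewrite !scaler0.
- move=> p q; rewrite /BF (@wd_elt0 [::]) ?scaler0 //.
  by rewrite (red_lP u).2 u1 eps_one scale1r subrr.
- move=> p x q q'; have := wd_unit (red_l x) q (q' ++ p) u1.
  by rewrite /BF -catA cat_cons => ->; rewrite !scaler0.
Qed.

Lemma Bop_wd w : Bop C <[w]> = B_word w.
Proof.
apply: lin_extE; apply: compatible_unit; [exact: B_word_multilin | exact: B_word_unit].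
Qed.

Lemma dot_wordr_compat v : compatible (unit_rel C) (@dot_word K m C v).
Proof.
case: v => [|a s]; first by apply: compatible_unit => *; [move=> * |];
  rewrite /= ?scaler0 ?addr0.
apply: compatible_unit => [[|b pre] post c x y z h|b pre post u u1] /=.
- have [dx dy _] := h; apply: sgn_lin; rewrite ?dx ?dy //.
  exact: (multilin_head _ (wd_multilin _) (mul_l_lcombr _ h)).
- apply: sgn_lin => //.
  by have := wd_multilin (unit_rel C) (mul_l a b :: s ++ pre) post h; rewrite /= -!catA.
- by rewrite catA wd_unit ?scaler0.
Qed.

Lemma dot_wordl_compat (t : ccw C) :
  compatible (unit_rel C) (fun v => lin_ext (@dot_word K m C v) t).
Proof.
have [l ->] := words_spanned t.
have E v : lin_ext (@dot_word K m C v) (\sum_(p <- l) p.1 *: <[p.2]>) =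
    \sum_(p <- l) p.1 *: dot_word v p.2.
  rewrite linear_sum; apply: eq_bigr => p _; rewrite linearZ /=.
  by rewrite lin_extE //; exact: dot_wordr_compat.
apply: compatible_unit => [pre post c x y z h|a pre post u u1]; rewrite !E.
  rewrite scaler_sumr -big_split; apply: eq_bigr => -[k w] _ /=.
  apply: sgn_lin => //; have [dx dy _] := h.
  case: w pre => [|b r] [|a pre] /=; rewrite ?scaler0 ?addr0 //.
  - by apply: sgn_lin => //; exact: (multilin_head _ (wd_multilin _) (mul_l_lcombl _ h)).
  - apply: sgn_lin; rewrite ?bdegE ?dx ?dy // -!catA !cat_cons.
    exact: (wd_multilin _ (mul_l a b :: pre)).
rewrite big1 // => -[k w] _ /=; case: w => [|b r]; rewrite ?scaler0 //.
by rewrite -catA cat_cons wd_unit ?scaler0.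
Qed.

Lemma dot_wd v w : dot <[v]> <[w]> = dot_word v w.
Proof.
rewrite /dot (lin_extE (dot_wordl_compat _)) lin_extE //.
exact: dot_wordr_compat.
Qed.

Lemma dot_linl (t : ccw C) : linear (fun s => dot s t).
Proof. by move=> a x y; exact: linearP. Qed.

End CyclicLemmas.

Definition gshift (V : Type) (H : int -> set V) (r : int) : int -> set V :=
  fun k => H (k + r).

Section Gravity.
Variables (K : fieldType) (V : lmodType K) (H : int -> set V).
(* A multilinear operation on V is given by its values on homogeneous elements,
   each listed with its degree; the arity is the length of the list. *)
Variable br : seq (int * V) -> V.

Definition homog (s : seq (int * V)) : Prop := {in s, forall p, H p.1 p.2}.
Definition dsum (s : seq (int * V)) : int := \sum_(p <- s) p.1.
Definition brk (s : seq (int * V)) : int * V :=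
  (dsum s + 2 - (size s)%:Z, br s).

Notation ith s i := (nth (0, 0) s i).

Definition eps_sign (xs : seq (int * V)) (i j : nat) : int :=
  dsum (take i xs) * (ith xs i).1 + dsum (take j xs) * (ith xs j).1
  + (ith xs i).1 * (ith xs j).1.

(* xs without its entries of indices i < j *)
Definition remove2 (xs : seq (int * V)) (i j : nat) : seq (int * V) :=
  take i xs ++ drop i.+1 (take j xs) ++ drop j.+1 xs.

(* eps_sign is the Koszul sign of moving x_i and x_j to the front. As the
   brackets are skew-symmetric, it comes with the signature of that
   permutation, which for indices counted from 0 is (-1)^(i + j - 1): without
   it, the case k = 3, l = 0 would give {{x, y}, z} = 0 in even degrees.
   Likewise (-1)^(k l) is the Koszul sign of a bracket of degree 2 - k against
   l further skew-symmetric arguments. *)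
Record is_gravity : Prop := {
  grav_grading : is_grading H;
  grav_deg : forall s, (2 <= size s)%N -> homog s ->
    H (brk s).1 (brk s).2;
  grav_lin : forall pre post k a x y,
    (2 <= size (pre ++ (k, x) :: post))%N ->
    homog (pre ++ (k, x) :: post) -> H k y ->
    br (pre ++ (k, a *: x + y) :: post) =
    a *: br (pre ++ (k, x) :: post) + br (pre ++ (k, y) :: post);
  grav_skew : forall pre post x y,
    homog (pre ++ x :: y :: post) ->
    br (pre ++ x :: y :: post) =
    - ((-1) ^ (x.1 * y.1) *: br (pre ++ y :: x :: post));
  grav_jacobi : forall xs ys, homog xs -> homog ys ->
    let k := size xs in let l := size ys in
    (2 <= k)%N -> (2 < k)%N || (0 < l)%N ->
    \sum_(j < k) \sum_(i < j)
       ((-1) ^+ (i + j.-1) * (-1) ^ eps_sign xs i j) *: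
       br (brk [:: ith xs i; ith xs j] :: remove2 xs i j ++ ys) =
    if (0 < l)%N then (-1) ^+ (k * l) *: br (brk xs :: ys) else 0
}.

End Gravity.

(* Main.v *)
(* E and M induce Delta = M E on HH, which is the map induced by Connes' operator
   B, and E Delta = 0. A class in the image of M is represented by a cycle killed
   by B. Pairing a letter a of X with the head z of Z through eps(z a) and
   inserting the tail of Z in its place (iota) is a homotopy for the
   commutativity of the product; summing this over the cyclic rotations of the
   tail of X (theta, theta1) gives homotopies which together show that B(Z X Y)
   is, up to boundaries, the combination of B(Z X) Y, X B(Z Y), Z B(X Y) and
   X Z B(Y) expected of an operator of second order, as soon as B Z = B X = 0.
   Hence {z, w} = Delta(z w) - (+/-) z Delta(w) is a derivation in w, so that
   Delta(x_1 ... x_k) is the sum over i < j of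
   (+/-) Delta(x_i x_j) x_1 ... x_k with x_i and x_j removed from the product.
   Multiplying by y_1 ... y_l and applying E gives the generalized Jacobi
   identities, where E Delta = 0 accounts for the case l = 0. *)

From HB Require Import structures.
From mathcomp Require Import all_boot all_order all_algebra.
From mathcomp Require Import zify.
From mathcomp Require Import boolp classical_sets functions.
Require Import Defs.

Set Implicit Arguments.
Unset Strict Implicit.
Unset Printing Implicit Defensive.

Import Order.TTheory GRing.Theory Num.Theory.
Local Open Scope ring_scope.

(** * A decision procedure for linear identities with Koszul signs *)

(** Contraction works because of the Frobenius relation: pairing one half of the coproduct of a with
    z through eps returns z a in the other half. So a chain z[zs] acts on the cobar construction as
    the derivation replacing a by eps(z a) zs, and b of the chain corresponds to the commutator of
    this derivation with the cobar differential. The correspondence fails by the inner derivation of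
    eps(z 1) zs, because tail letters live modulo the coaugmentation 1. These defects, and the words
    headed by the coaugmentation that rotations produce, are what each identity has to cancel. The
    factors eps(a) and eps(z a) vanish unless |a| = 0, respectively |z| + |a| = m, and many signs
    agree only under this constraint. It is therefore applied by hand, term by term, before a parity
    check closes the identity. The second-order relation needs representatives on which B itself
    vanishes; a class with Delta = 0 would not be enough. The image of M provides such
    representatives. *)

Definition parity (n : int) : bool := odd `|n|%N.

Lemma parityD a b : parity (a + b) = parity a (+) parity b.
Proof. by rewrite /parity; lia. Qed.

Lemma parityM a b : parity (a * b) = parity a && parity b.
Proof. by rewrite /parity abszM oddM. Qed.

Lemma exprz_parity (K : fieldType) (n : int) : (-1 : K) ^ n = (-1) ^+ parity n.
Proof.
case: n => n; rewrite /parity; first by rewrite absz_nat signr_odd.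
by rewrite NegzE abszN absz_nat signr_odd -exprz_inv invrN1.
Qed.

(** Syntax for exponents of -1, for scalars and for vectors. Scalars have no sums: each coefficient
    is a signed monomial, so an identity of vectors becomes an identity of multisets of terms. *)
Inductive pexp := PVar of nat | POne | PTwo | PZero | POpp of pexp
  | PAdd of pexp & pexp | PMul of pexp & pexp.
Inductive sexp := SVar of nat | SOne | SSgn of pexp | SMul of sexp & sexp | SOpp of sexp.
Inductive vexp := VVar of nat | VZero | VAdd of vexp & vexp | VOpp of vexp
  | VScale of sexp & vexp.

Section SignedModule.
Variables (K : fieldType) (V : lmodType K).
Variables (ei : seq int) (es : seq K) (ev : seq V).

Fixpoint peval e : int := match e with
  | PVar n => nth 0 ei n | POne => 1 | PTwo => 2 | PZero => 0 | POpp a => - peval a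
  | PAdd a b => peval a + peval b | PMul a b => peval a * peval b end.
Fixpoint seval e : K := match e with
  | SVar n => nth 0 es n | SOne => 1 | SSgn p => (-1) ^ peval p
  | SMul a b => seval a * seval b | SOpp a => - seval a end.
Fixpoint veval e : V := match e with
  | VVar n => nth 0 ev n | VZero => 0 | VAdd a b => veval a + veval b
  | VOpp a => - veval a | VScale s a => seval s *: veval a end.

Fixpoint pbool (rho : seq bool) e : bool := match e with
  | PVar n => nth false rho n | POne => true | PTwo | PZero => false | POpp a => pbool rho a
  | PAdd a b => pbool rho a (+) pbool rho b | PMul a b => pbool rho a && pbool rho b end.
Fixpoint smono rho e : bool * seq nat := match e with
  | SVar n => (false, [:: n]) | SOne => (false, [::]) | SSgn p => (pbool rho p, [::])
  | SMul a b => ((smono rho a).1 (+) (smono rho b).1, (smono rho a).2 ++ (smono rho b).2)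
  | SOpp a => (~~ (smono rho a).1, (smono rho a).2) end.
Fixpoint vlin rho (c : bool * seq nat) e : seq (bool * (seq nat * nat)) := match e with
  | VVar n => [:: (c.1, (sort leq c.2, n))] | VZero => [::]
  | VAdd a b => vlin rho c a ++ vlin rho c b
  | VOpp a => vlin rho (~~ c.1, c.2) a
  | VScale s a => vlin rho (c.1 (+) (smono rho s).1, c.2 ++ (smono rho s).2) a end.

Fixpoint assigns n : seq (seq bool) :=
  if n is n'.+1 then [seq b :: r | b <- [:: true; false], r <- assigns n'] else [:: [::]].

Definition cancels (l : seq (bool * (seq nat * nat))) :=
  perm_eq [seq x.2 | x <- l & x.1] [seq x.2 | x <- l & ~~ x.1].

(** Fixing the parity of each integer atom makes all signs explicit. The negative terms must then be
    a permutation of the positive ones; no arithmetic on coefficients occurs, so the test is valid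
    over every field. *)
Definition vcheck e :=
  all (fun rho => cancels (vlin rho (false, [::]) e)) (assigns (size ei)).

Let sprod (l : seq nat) := \prod_(i <- l) nth 0 es i.
Let kval (k : seq nat * nat) : V := sprod k.1 *: nth 0 ev k.2.
Let tval (x : bool * (seq nat * nat)) : V := (-1) ^+ x.1 *: kval x.2.
Let rho0 := map parity ei.

Let pboolP e : pbool rho0 e = parity (peval e).
Proof.
elim: e => //= [n|a ->|a -> b ->|a -> b ->]; rewrite ?parityD ?parityM //; last first.
  by rewrite /parity abszN.
have [h|h] := ltnP n (size ei); first by rewrite (nth_map 0).
by rewrite !nth_default ?size_map.
Qed.

Let smonoP e : seval e = (-1) ^+ (smono rho0 e).1 * sprod (smono rho0 e).2.
Proof.
elim: e => //= [n||p|a -> b ->|a ->].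
- by rewrite /sprod big_seq1 mul1r.
- by rewrite /sprod big_nil mul1r.
- by rewrite /sprod big_nil mulr1 exprz_parity pboolP.
- by rewrite /sprod big_cat signr_addb /= mulrACA.
- by rewrite signrN mulNr.
Qed.

Let vlinP e c :
  \sum_(x <- vlin rho0 c e) tval x = ((-1) ^+ c.1 * sprod c.2) *: veval e.
Proof.
elim: e c => //= [n|||a IHa|s a IHa] c.
- rewrite big_seq1 /tval /kval /= scalerA; congr (_ * _ *: _).
  by apply: perm_big; rewrite perm_sort.
- by rewrite big_nil scaler0.
- by move=> IHa b IHb c'; rewrite big_cat IHa IHb scalerDr.
- by rewrite IHa /= signrN mulNr scalerN scaleNr.
- by rewrite IHa /= smonoP scalerA /sprod big_cat signr_addb /= mulrACA.
Qed.

Let rho0_in : rho0 \in assigns (size ei).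
Proof.
rewrite /rho0; elim: ei => [|n l IHl] //=; rewrite mem_cat.
by case: (parity n); rewrite ?cats0 (map_f (cons _)) ?orbT.
Qed.

Lemma vcheckP e : vcheck e -> veval e = 0.
Proof.
move=> /allP/(_ _ rho0_in); rewrite /cancels; set l := vlin _ _ _ => eql.
have := vlinP e (false, [::]); rewrite /sprod big_nil mul1r scale1r => <-.
rewrite -/l (bigID fst) /=.
have E (P : pred (bool * (seq nat * nat))) (c : K) : (forall x, P x -> (-1) ^+ x.1 = c) ->
    \sum_(x <- l | P x) tval x = c *: \sum_(k <- [seq x.2 | x <- l & P x]) kval k.
  move=> h; rewrite big_map big_filter scaler_sumr; apply: eq_bigr => x /h hx.
  by rewrite /tval hx.
rewrite (E fst (-1)) ?(E _ 1) => [|[[]] //|[[]] //].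
by rewrite (perm_big _ eql) scaleN1r scale1r addNr.
Qed.

End SignedModule.

(** The match on [Set] runs a tactic while a term is being built; its failure backtracks to the next
    entry of the list. *)
Ltac index_of x l := lazymatch l with
  | cons ?y ?t => match constr:(Set) with
    | _ => let _ := match constr:(Set) with _ => constr_eq x y end in constr:(O)
    | _ => let n := index_of x t in constr:(S n) end end.
Ltac index_upto x l := lazymatch l with
  | cons ?y ?t => match constr:(Set) with
    | _ => let _ := match constr:(Set) with _ => unify x y end in constr:(O)
    | _ => let n := index_upto x t in constr:(S n) end end.
Ltac index_of2 x l := match constr:(Set) with
  | _ => index_of x l
  | _ => index_upto x l end.
Ltac insert_in x l := match constr:(Set) with
  | _ => let _ := index_of2 x l in l
  | _ => constr:(cons x l) end.

Ltac collect_p e ei := match e with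
  | (?a + ?b)%R => let ei := collect_p a ei in collect_p b ei
  | (?a * ?b)%R => let ei := collect_p a ei in collect_p b ei
  | (- ?a)%R => collect_p a ei
  | 1%R => ei | 0%R => ei | (GRing.natmul 1 2)%R => ei
  | _ => insert_in e ei end.
Ltac collect_s e env := match e with
  | (?a * ?b)%R => let env := collect_s a env in collect_s b env
  | (- ?a)%R => collect_s a env
  | 1%R => env
  | (exprz (- 1) ?n) => match env with (?i, ?s, ?v) => let i := collect_p n i in constr:((i, s, v)) end
  | _ => match env with (?i, ?s, ?v) => let s := insert_in e s in constr:((i, s, v)) end end.
Ltac collect_v e env := match e with
  | (?a + ?b)%R => let env := collect_v a env in collect_v b env
  | (- ?a)%R => collect_v a env
  | (?c *: ?a)%R => let env := collect_s c env in collect_v a env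
  | 0%R => env
  | _ => match env with (?i, ?s, ?v) => let v := insert_in e v in constr:((i, s, v)) end end.

Ltac reify_p e ei := match e with
  | (?a + ?b)%R => let x := reify_p a ei in let y := reify_p b ei in constr:(PAdd x y)
  | (?a * ?b)%R => let x := reify_p a ei in let y := reify_p b ei in constr:(PMul x y)
  | (- ?a)%R => let x := reify_p a ei in constr:(POpp x)
  | 1%R => constr:(POne) | 0%R => constr:(PZero) | (GRing.natmul 1 2)%R => constr:(PTwo)
  | _ => let n := index_of2 e ei in constr:(PVar n) end.
Ltac reify_s e ei es := match e with
  | (?a * ?b)%R => let x := reify_s a ei es in let y := reify_s b ei es in constr:(SMul x y)
  | (- ?a)%R => let x := reify_s a ei es in constr:(SOpp x)
  | 1%R => constr:(SOne)
  | (exprz (- 1) ?n) => let x := reify_p n ei in constr:(SSgn x)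
  | _ => let n := index_of2 e es in constr:(SVar n) end.
Ltac reify_v e ei es ev := match e with
  | (?a + ?b)%R => let x := reify_v a ei es ev in let y := reify_v b ei es ev in constr:(VAdd x y)
  | (- ?a)%R => let x := reify_v a ei es ev in constr:(VOpp x)
  | (?c *: ?a)%R => let s := reify_s c ei es in let x := reify_v a ei es ev in constr:(VScale s x)
  | 0%R => constr:(VZero)
  | _ => let n := index_of2 e ev in constr:(VVar n) end.

Lemma eq_of_subr0 (V : zmodType) (x y : V) : x - y = 0 -> x = y.
Proof. by move/eqP; rewrite subr_eq0 => /eqP. Qed.

Lemma parity_congr (K : fieldType) (V : lmodType K) ei es (ev : seq V) e x :
  vcheck ei e -> veval ei es ev e = x -> x = 0.
Proof. by move=> /vcheckP h <-. Qed.

Ltac koszul :=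
  apply: eq_of_subr0;
  lazymatch goal with |- @eq ?T ?x _ =>
    let S := match x with
      | context [GRing.scale ?c _] => type of c
      | _ => constr:(rat) end in
    let env := collect_v x constr:((@nil int, @nil S, @nil T)) in
    match env with (?ei, ?es, ?ev) =>
      let e := reify_v x ei es ev in
      refine (parity_congr (ei := ei) (es := es) (ev := ev) (e := e) _ _);
      [vm_compute; reflexivity | cbv [veval seval peval nth]; reflexivity]
    end end.

(** Linear combination: a hypothesis times a chosen scalar is subtracted from the goal, and the
    remaining signed identity is left to [koszul]. *)
Lemma eq_comb (K : fieldType) (V : lmodType K) (c : K) (l r x y : V) :
  l = r -> x - y = c *: (l - r) -> x = y.
Proof. by move=> ->; rewrite subrr scaler0 => /eq_of_subr0. Qed.

Lemma eq_comb2 (K : fieldType) (V : lmodType K) (c c' : K) (l r l' r' x y : V) :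
  l = r -> l' = r' -> x - y = c *: (l - r) + c' *: (l' - r') -> x = y.
Proof. by move=> -> ->; rewrite !subrr !scaler0 addr0 => /eq_of_subr0. Qed.

(** * Letters and words *)

Section Letters.
Variables (K : fieldType) (C : gradedSpace K).
Implicit Types (W : lmodType K).

Lemma letter_eq (a b : letter C) : deg a = deg b -> elt a = elt b -> a = b.
Proof. by case: a b => [[i x] px] [[j y] py] /= hd he; apply: val_inj; congr (_, _). Qed.

(** [lcomb] relates letters of one degree only, so this is linearity on each homogeneous part of
    C. *)
Definition llin W (g : letter C -> W) : Prop :=
  forall c x y z, lcomb c x y z -> g z = c *: g x + g y.

Lemma llin0 W (g : letter C -> W) a : llin g -> elt a = 0 -> g a = 0.
Proof.
move=> gl a0; rewrite (gl (-1) a a a) ?scaleN1r ?addNr //.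
by split; rewrite // a0 scaler0 addr0.
Qed.

Lemma llinZ W (g : letter C -> W) c x z : llin g -> deg x = deg z ->
  elt z = c *: elt x -> g z = c *: g x.
Proof.
move=> gl dx ez; have k0 : gdeg (g := C) (deg z) 0 := gdeg0 C _.
have [d0 e0] := Defs.ltrP k0.
by rewrite (gl c x (ltr (deg z) 0)) ?(llin0 gl e0) ?addr0 //; split; rewrite // e0 addr0.
Qed.

Lemma llin_sum W (g : letter C -> W) (l : seq (K * letter C)) a : llin g ->
  {in l, forall p, deg p.2 = deg a} -> elt a = \sum_(p <- l) p.1 *: elt p.2 ->
  g a = \sum_(p <- l) p.1 *: g p.2.
Proof.
move=> gl; elim: l a => [|[c b] l IHl] a ld; rewrite ?big_nil ?big_cons => ea.
  exact: llin0.
(* The rest of the sum has to be a letter in its own right, hence homogeneous of the degree of a. *)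
have ka : gdeg (g := C) (deg a) (\sum_(p <- l) p.1 *: elt p.2).
  have [/(_ (deg a))[k0 kP] _ _] := gdegP C.
  elim: l ld {IHl ea} => [|[d e] l IHl] ld; rewrite ?big_nil ?big_cons //.
  apply: kP; first by rewrite /= -(ld (d, e)) ?inE ?eqxx ?orbT //; exact: letterP.
  by apply: IHl => p; rewrite inE => /orP[/eqP->|pl]; apply: ld; rewrite !inE ?eqxx ?pl ?orbT.
have [da' ea'] := Defs.ltrP ka.
rewrite (gl c b (ltr (deg a) (\sum_(p <- l) p.1 *: elt p.2))) /=; last first.
  by split; rewrite ?ea' //; apply: (ld (c, b)); rewrite inE eqxx.
by congr (_ + _); apply: IHl => // p pl; rewrite da' (ld p) // inE pl orbT.
Qed.

End Letters.

Section Frobenius.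
Variables (K : fieldType) (m : int) (C : openFrobenius K m).
Implicit Types (W : lmodType K).
Notation word := (seq (letter C)).
Notation "<[ w ]>" := (wd (unit_rel C) w) (format "<[ w ]>").

(** The scalars of the spanning combination are absorbed into the first letters. *)
Lemma cop_l_splits (a : letter C) : exists l : seq (letter C * letter C),
  cop_l a = \sum_(u <- l) wd set0 [:: u.1; u.2] /\
  {in l, forall u, deg u.1 + deg u.2 = deg a}.
Proof.
rewrite /cop_l; have [s [sP ->]] := cop_deg (letterP a).
elim: s sP => [|[c t] s IHs] sP; first by exists [::]; rewrite !big_nil.
have [|l [sE lP]] := IHs; first by move=> p ps; apply: sP; rewrite inE ps orbT.
have /= [|x [y [dxy xy]]] := sP (c, t); first by rewrite inE eqxx.
have kx : gdeg (g := C) (deg x) (c *: elt x).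
  have [/(_ (deg x))[k0 kP] _ _] := gdegP C.
  by rewrite -[_ *: _]addr0; apply: kP => //; exact: letterP.
have [dx ex] := Defs.ltrP kx.
exists ((ltr (deg x) (c *: elt x), y) :: l); rewrite !big_cons sE /= xy; split.
  congr (_ + _); apply/esym.
  have h : llin (fun x => wd (C := C) set0 [:: x; y]).
    by move=> c' x1 x2 x3 h; exact: (multilin_head _ (wd_multilin _) h).
  by rewrite (llinZ h (x := x) (c := c)) // dx.
move=> u; rewrite inE => /orP[/eqP-> /=|/lP//].
by rewrite dx.
Qed.

(* A chosen expansion of the coproduct, so that sums over it are plain bigops. *)
Definition cops (a : letter C) : seq (letter C * letter C) := sval (cid (cop_l_splits a)).

Lemma copsE a : cop_l a = \sum_(u <- cops a) wd set0 [:: u.1; u.2].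
Proof. by rewrite /cops; case: cid => l []. Qed.

Lemma cops_deg a u : u \in cops a -> deg u.1 + deg u.2 = deg a.
Proof. by have [_ /(_ u)] := svalP (cid (cop_l_splits a)). Qed.

Lemma sweedler_cops W (f : letter C -> letter C -> W) a : bilin f ->
  sweedler f (cop_l a) = \sum_(u <- cops a) f u.1 u.2.
Proof.
move=> fb; rewrite copsE /sweedler linear_sum; apply: eq_bigr => u _.
exact: sweedlerE.
Qed.

Definition csum W (f : letter C -> letter C -> W) a := \sum_(u <- cops a) f u.1 u.2.

Lemma csumE W (f : letter C -> letter C -> W) a : bilin f -> csum f a = sweedler f (cop_l a).
Proof. by move=> /sweedler_cops->. Qed.

Lemma eq_csum W (f g : letter C -> letter C -> W) a :
  (forall x y, deg x + deg y = deg a -> f x y = g x y) -> csum f a = csum g a.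
Proof. by move=> h; apply: eq_big_seq => u /cops_deg; exact: h. Qed.

Lemma csumD W (f g : letter C -> letter C -> W) a :
  csum (fun x y => f x y + g x y) a = csum f a + csum g a.
Proof. exact: big_split. Qed.

Lemma csumZ W c (f : letter C -> letter C -> W) a :
  csum (fun x y => c *: f x y) a = c *: csum f a.
Proof. by rewrite /csum -scaler_sumr. Qed.

Lemma csumN W (f : letter C -> letter C -> W) a :
  csum (fun x y => - f x y) a = - csum f a.
Proof. exact: sumrN. Qed.

Lemma csum_linear W W' (g : {linear W -> W'}) (f : letter C -> letter C -> W) a :
  g (csum f a) = csum (fun x y => g (f x y)) a.
Proof. exact: linear_sum. Qed.

Lemma wd2_llinr (b : letter C) : llin (fun y => wd (C := C) set0 [:: b; y]).
Proof. by move=> c x y z h; exact: (wd_multilin set0 [:: b] [::] h). Qed.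

Lemma wd2_llinl (b : letter C) : llin (fun y => wd (C := C) set0 [:: y; b]).
Proof. by move=> c x y z h; exact: (wd_multilin set0 [::] [:: b] h). Qed.

Lemma bilin_wd2 : bilin (fun x y : letter C => wd set0 [:: x; y]).
Proof. by split=> b; [exact: wd2_llinr|exact: wd2_llinl]. Qed.

Lemma bilin_signed W (f : letter C -> letter C -> W) (e : int -> int -> int) : bilin f ->
  bilin (fun x y => (-1) ^ e (deg x) (deg y) *: f x y).
Proof.
move=> [fr fl]; split=> b c x y z h; have [dx dy _] := h; apply: sgn_lin; rewrite ?dx ?dy //.
  exact: fr.
exact: fl.
Qed.

Lemma bilin_swap W (f : letter C -> letter C -> W) : bilin f -> bilin (fun x y => f y x).
Proof. by move=> [fr fl]; split=> b; [exact: fl|exact: fr]. Qed.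

Lemma csum_comm W (f : letter C -> letter C -> W) a : bilin f ->
  csum f a = csum (fun x y => (-1) ^ (deg x * deg y) *: f y x) a.
Proof.
move=> fb; have hs := bilin_signed (fun i j => i * j) (bilin_swap fb).
have hw := bilin_signed (fun i j => i * j) (bilin_swap bilin_wd2).
rewrite !csumE // -{1}[cop_l a](cop_comm (elt a)) -/(cop_l a).
rewrite sweedler_cops // [RHS]sweedler_cops // /sweedler linear_sum; apply: eq_bigr => u _; rewrite linearZ /=.
by congr (_ *: _); exact: sweedlerE.
Qed.

Lemma eps_deg0 (a : letter C) : eps (elt a) != 0 -> deg a = 0.
Proof. by apply: contra_neq_eq => h; exact: (eps_deg (letterP a)). Qed.

(** Since eps is concentrated in degree 0, signs under a factor eps(a) may be computed with |a| =
    0. *)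
Lemma eps_scale_eq W (a : letter C) (x y : W) :
  (deg a = 0 -> x = y) -> eps (elt a) *: x = eps (elt a) *: y.
Proof. by have [->|/eps_deg0 -> ->//] := eqVneq (eps (elt a)) 0; rewrite !scale0r. Qed.

Lemma counit_bilin W (g : letter C -> W) : llin g ->
  bilin (fun x y => eps (elt x) *: g y).
Proof.
move=> gl; split=> b c x y z h; first by rewrite (gl _ _ _ _ h) scalerDr !scalerA mulrC.
by have [_ _ ->] := h; rewrite linearP scalerDl scalerA.
Qed.

Lemma csum_counitl W (g : letter C -> W) a : llin g ->
  csum (fun x y => eps (elt x) *: g y) a = g a.
Proof.
move=> gl; rewrite /csum.
(* Pairs whose first letter has nonzero degree are dropped, eps being 0 there. The remaining second
   letters all have the degree of a, as [llin_sum] requires. *)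
pose l := [seq (eps (elt u.1), u.2) | u <- cops a & deg u.1 == 0].
have E (V : lmodType K) (h : letter C -> V) : \sum_(u <- cops a) eps (elt u.1) *: h u.2 =
    \sum_(p <- l) p.1 *: h p.2 :> V.
  rewrite big_map big_filter [RHS]big_mkcond; apply: eq_bigr => u _.
  by case: eqVneq => // /(eps_deg (letterP _)) ->; rewrite scale0r.
rewrite E; apply/esym; apply: llin_sum => //.
  move=> p /mapP[u]; rewrite mem_filter => /andP[/eqP u0 /cops_deg ua] -> /=.
  by rewrite -ua u0 add0r.
rewrite -(E C (fun x => elt x)) -[LHS](cop_counitl (elt a)) -/(cop_l a).
apply: sweedler_cops; apply: counit_bilin => c x y z [_ _ //].
Qed.

Lemma csum_counitr W (g : letter C -> W) a : llin g ->
  csum (fun x y => eps (elt y) *: g x) a = g a.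
Proof.
move=> gl; rewrite csum_comm; last exact/bilin_swap/counit_bilin.
rewrite -[RHS](csum_counitl _ gl); apply: eq_csum => x y _.
have [->|/eps_deg0->] := eqVneq (eps (elt x)) 0; first by rewrite !scale0r scaler0.
by rewrite mul0r expr0z scale1r.
Qed.

Lemma llin_csum W (f : letter C -> letter C -> W) : bilin f -> llin (csum f).
Proof.
by move=> fb c u v w h; rewrite !csumE // (cop_l_lcomb h) sweedler_linear.
Qed.

Lemma csum_mull W (f : letter C -> letter C -> W) x y : bilin f ->
  csum f (mul_l x y) = csum (fun a b => f (mul_l x a) b) y.
Proof.
move=> fb; have hb : bilin (fun a b => f (mul_l x a) b).
  split=> b c u v w h; first exact: fb.1.
  by apply: fb.2; exact: mul_l_lcombr.
have hw : bilin (fun a b => wd (C := C) set0 [:: mul_l x a; b]).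
  split=> b c u v w h; first exact: (wd_multilin _ [:: _] [::] h).
  exact: (multilin_head _ (wd_multilin _) (mul_l_lcombr x h)).
rewrite !csumE // /cop_l (mul_lP x y).2 (frobl _ (letterP x)) -/(cop_l y).
rewrite (sweedler_cops _ hw) [RHS]sweedler_cops // /sweedler linear_sum.
by apply: eq_bigr => u _; exact: sweedlerE.
Qed.

Lemma llin_mul_comm W (g : letter C -> W) x y : llin g ->
  g (mul_l x y) = (-1) ^ (deg x * deg y + m) *: g (mul_l y x).
Proof.
move=> gl; apply: llinZ => //; first by rewrite !(mul_lP _ _).1 [deg y + _]addrC.
by rewrite !(mul_lP _ _).2; apply: mul_comm; exact: letterP.
Qed.

(** y is moved to the left by commutativity, the Frobenius relation for a left factor is applied,
    and y is moved back. *)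
Lemma csum_mulr W (f : letter C -> letter C -> W) x y : bilin f ->
  csum f (mul_l x y) = csum (fun a b => (-1) ^ (deg y * deg b) *: f (mul_l a y) b) x.
Proof.
move=> fb; rewrite llin_mul_comm.
  rewrite csum_mull // -csumZ; apply: eq_csum => a b ab.
  rewrite (@llin_mul_comm _ (f^~ b)) => [|c u v w h]; last exact: fb.2.
  by rewrite -ab; koszul.
exact: llin_csum.
Qed.

Lemma deg_red (a : letter C) : deg (red_l a) = deg a. Proof. exact: (red_lP a).1. Qed.
Lemma deg_dif (a : letter C) : deg (dif_l a) = deg a - 1. Proof. exact: (dif_lP a).1. Qed.
Lemma deg_mul (a b : letter C) : deg (mul_l a b) = deg a + deg b - m.
Proof. exact: (mul_lP a b).1. Qed.

Definition one_l : letter C := ltr 0 (coaug C).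
Lemma deg_one : deg one_l = 0. Proof. exact: (Defs.ltrP (one_deg C)).1. Qed.
Lemma elt_one : elt one_l = coaug C. Proof. exact: (Defs.ltrP (one_deg C)).2. Qed.

(** Elements of ker eps are the canonical representatives of Cbar = C / K.1; [red_l] fixes them. *)
Definition reduced (p : word) : bool := all (fun a => eps (elt a) == 0) p.

Lemma eps_red (a : letter C) : eps (elt (red_l a)) = 0.
Proof. by rewrite (red_lP a).2 linearB /= linearZ /= eps_one mulr1 subrr. Qed.

Lemma eps_dif_l (a : letter C) : eps (elt (dif_l a)) = 0.
Proof. by rewrite (dif_lP a).2 eps_dif. Qed.

Lemma llin_red W (g : letter C -> W) a : llin g ->
  g (red_l a) = g a - eps (elt a) *: g one_l.
Proof.
move=> gl; have [a0|/eps_deg0 a0] := eqVneq (eps (elt a)) 0.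
  rewrite a0 scale0r subr0; congr g; apply: letter_eq; first exact: deg_red.
  by rewrite (red_lP a).2 a0 scale0r subr0.
rewrite addrC -scaleNr; apply: gl; split; rewrite ?deg_red ?deg_one ?a0 //.
by rewrite (red_lP a).2 elt_one addrC scaleNr.
Qed.

Lemma red_id (a : letter C) : eps (elt a) = 0 -> red_l a = a.
Proof.
move=> a0; apply: letter_eq; first exact: deg_red.
by rewrite (red_lP a).2 a0 scale0r subr0.
Qed.

Lemma wd_one a pre post : <[a :: pre ++ one_l :: post]> = 0.
Proof. by apply: wd_unit; exact: elt_one. Qed.

Lemma wd_red a pre x post : <[a :: pre ++ red_l x :: post]> = <[a :: pre ++ x :: post]>.
Proof.
rewrite (@llin_red _ (fun x => <[a :: pre ++ x :: post]>)) ?wd_one ?scaler0 ?subr0 //.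
by move=> c u v w; exact: (wd_multilin (unit_rel C) (a :: pre)).
Qed.

End Frobenius.
Arguments one_l {K m C}.

(** * The differential on words *)

Section Operators.
Variables (K : fieldType) (m : int) (C : openFrobenius K m).
Implicit Types (W : lmodType K).
Notation word := (seq (letter C)).
Notation "<[ w ]>" := (wd (unit_rel C) w) (format "<[ w ]>").
Variables s t : K.

Lemma bdeg_nil : bdeg ([::] : word) = 0. Proof. exact: big_nil. Qed.
Definition degE := (@deg_red K m C, @deg_dif K m C, @deg_mul K m C, @deg_one K m C,
  @bdeg_cat K m C, @bdeg_cons K m C, @bdeg_rcons K m C, bdeg_nil).

(* The word functional F composed with the derivation
   a |-> - s da + t (sum of a' a'') of the cobar construction. *)
Fixpoint Dop W (F : word -> W) (p : word) : W :=
  if p is a :: q then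
    - (s *: F (dif_l a :: q))
    + t *: csum (fun x y => (-1) ^ (deg x - 1) *: F (red_l x :: red_l y :: q)) a
    + (-1) ^ (deg a - 1) *: Dop (fun r => F (a :: r)) q
  else 0.

(* The functional H on words c[p] composed with s bint + t bcop. *)
Definition wdiff W (H : letter C -> word -> W) (c : letter C) (p : word) : W :=
  s *: H (dif_l c) p + (-1) ^ deg c *: Dop (H c) p
  + t *: csum (fun x y => (-1) ^ deg x *:
      (H x (red_l y :: p) - (-1) ^ ((deg y - 1) * bdeg p) *: H x (rcons p (red_l y)))) c.

Lemma eq_Dop W (F G : word -> W) p : F =1 G -> Dop F p = Dop G p.
Proof. by move=> /funext->. Qed.

Lemma DopD W (F G : word -> W) p : Dop (fun r => F r + G r) p = Dop F p + Dop G p.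
Proof.
elim: p F G => [|a p IHp] F G /=; first by rewrite addr0.
rewrite IHp (_ : csum _ a =
    csum (fun x y => (-1) ^ (deg x - 1) *: F (red_l x :: red_l y :: p)) a
    + csum (fun x y => (-1) ^ (deg x - 1) *: G (red_l x :: red_l y :: p)) a).
  koszul.
by rewrite -csumD; apply: eq_csum => x y _; koszul.
Qed.

Lemma Dop_linear W W' (g : W -> W') (F : word -> W) p : linear g ->
  Dop (fun r => g (F r)) p = g (Dop F p).
Proof.
move=> gl; pose g' : {linear W -> W'} := HB.pack g (GRing.isLinear.Build _ _ _ _ _ gl).
have gZ c x : g (c *: x) = c *: g x := linearZ_LR g' c x.
have gD x y : g (x + y) = g x + g y := linearD g' x y.
have gN x : g (- x) = - g x := linearN g' x.
have g0 : g 0 = 0 := linear0 g'.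
have gS (f : letter C -> letter C -> W) a :
  g (csum f a) = csum (fun x y => g (f x y)) a := csum_linear g' f a.
elim: p F => [|a p IHp] F /=; first by rewrite g0.
rewrite !gD gN !gZ gS IHp.
by congr (_ + _ *: _ + _); apply: eq_csum => x y _; rewrite gZ.
Qed.

Lemma DopZ W c (F : word -> W) p : Dop (fun r => c *: F r) p = c *: Dop F p.
Proof. by apply: Dop_linear => a x y; rewrite scalerDr !scalerA mulrC. Qed.

Lemma Dop0 W p : Dop (fun _ => 0 : W) p = 0.
Proof.
rewrite -[RHS](scale0r (Dop (fun _ => 0 : W) p)) -DopZ.
by apply: eq_Dop => r; rewrite scale0r.
Qed.

(** The derivation has degree -1, so a factor depending on the degree of the word comes out with its
    argument lowered by one. *)
Lemma Dop_sg W (f : int -> K) (F : word -> W) p :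
  Dop (fun r => f (bdeg r) *: F r) p = f (bdeg p - 1) *: Dop F p.
Proof.
elim: p f F => [|a p IHp] f F /=; first by rewrite scaler0.
have E := IHp (fun n => f (deg a - 1 + n)) (fun r => F (a :: r)).
rewrite (@eq_Dop _ _ (fun r => f (deg a - 1 + bdeg r) *: F (a :: r))) ?E; last first.
  by move=> r; rewrite degE.
rewrite (_ : csum _ a =
    f (bdeg (a :: p) - 1) *: csum (fun x y => (-1) ^ (deg x - 1) *: F (red_l x :: red_l y :: p)) a).
  rewrite !degE (_ : deg a - 1 - 1 + bdeg p = deg a - 1 + bdeg p - 1); last by lia.
  rewrite (_ : deg a - 1 + (bdeg p - 1) = deg a - 1 + bdeg p - 1); last by lia.
  by koszul.
rewrite -csumZ; apply: eq_csum => x y xy; rewrite !degE -xy.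
rewrite (_ : deg x - 1 + (deg y - 1 + bdeg p) = deg x + deg y - 1 + bdeg p - 1); last by lia.
by koszul.
Qed.

Lemma Dop_cat W (F : word -> W) p q :
  Dop F (p ++ q) = Dop (fun r => F (r ++ q)) p
    + (-1) ^ bdeg p *: Dop (fun r => F (p ++ r)) q.
Proof.
elim: p F => [|a p IHp] F /=; first by rewrite degE expr0z scale1r add0r.
by rewrite IHp degE; koszul.
Qed.

Lemma Dop_splits W (F : word -> W) p :
  Dop F p = splits (fun p1 a p2 => (-1) ^ bdeg p1 *: (- (s *: F (p1 ++ dif_l a :: p2))
    + t *: csum (fun x y => (-1) ^ (deg x - 1) *: F (p1 ++ red_l x :: red_l y :: p2)) a)) p.
Proof.
elim: p F => [|a p IHp] F; first by rewrite splits_nil.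
rewrite splits_cons /= IHp degE expr0z scale1r; congr (_ + _).
rewrite /splits scaler_sumr; apply: eq_bigr => i _; rewrite degE.
by koszul.
Qed.

(* With s and t arbitrary, one identity covers both components of b, of which
   bcop raises the length of a word by one and bint preserves it. *)
Definition sdiff (x : ccw C) : ccw C := s *: bint C x + t *: bcop C x.
Lemma bst_linear : linear sdiff.
Proof.
move=> c x y; rewrite /sdiff (linearP (bint C)) (linearP (bcop C)).
by rewrite !scalerDr !scalerA ![_ * c]mulrC addrACA.
Qed.
HB.instance Definition _ := GRing.isLinear.Build K (ccw C) (ccw C) _ sdiff bst_linear.

Lemma bstD x y : sdiff (x + y) = sdiff x + sdiff y. Proof. exact: (linearD sdiff). Qed.
Lemma bstZ c x : sdiff (c *: x) = c *: sdiff x. Proof. exact: (linearZ_LR sdiff). Qed.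

(** [wdiff] reduces the letters that it creates in the tail; this changes nothing, as the
    coaugmentation is 0 in these positions. *)
Lemma bst_wd c p : sdiff <[c :: p]> = wdiff (fun c p => <[c :: p]>) c p.
Proof.
rewrite /sdiff bint_wd bcop_wd bint_wordE bcop_wordE /wdiff Dop_splits.
rewrite (_ : csum _ c = \sw_(x, y <- cop_l c)
        ((-1) ^ deg x *:
          (<[x :: y :: p]> - (-1) ^ ((deg y - 1) * bdeg p) *: <[x :: rcons p y]>))).
  rewrite (_ : (-1) ^ deg c *: splits _ p =
      - (s *: splits (fun p1 a p2 => (-1) ^ (deg c + bdeg p1) *: <[c :: p1 ++ dif_l a :: p2]>) p)
      + t *: splits (fun p1 a p2 => \sw_(u, v <- cop_l a)
         ((-1) ^ (deg c + bdeg (rcons p1 u)) *: <[c :: p1 ++ u :: v :: p2]>)) p).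
    by koszul.
  rewrite /splits !scaler_sumr -sumrN -big_split /=; apply: eq_bigr => i _.
  set a := nth _ _ _; set p1 := take _ _; set p2 := drop _ _.
  rewrite sweedler_cops; last exact: bcopF_bilin.
  rewrite -/(csum (fun u v => (-1) ^ (deg c + bdeg (rcons p1 u)) *: <[c :: p1 ++ u :: v :: p2]>) a).
  rewrite [X in _ = _ + _ *: X](_ : _ = (-1) ^ (deg c + bdeg p1) *:
     csum (fun x y => (-1) ^ (deg x - 1) *: <[c :: p1 ++ red_l x :: red_l y :: p2]>) a).
    by koszul.
  rewrite -csumZ; apply: eq_csum => x y xy; rewrite degE wd_red.
  have := wd_red c (p1 ++ [:: x]) y p2; rewrite -!catA /= => ->.
  by koszul.
rewrite sweedler_cops; last exact: bcop0_bilin.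
apply: eq_bigr => -[x y] _ /=; rewrite -!cats1 (wd_red x [::]).
by rewrite (wd_red x p).
Qed.

(** * Cyclic rotations *)

(** The signed rotations of the circular word p q whose head lies in p. With q empty this is Connes'
    operator on the tail p, without its factor eps. *)
Fixpoint rot (p q : word) : ccw C :=
  if p is a :: r then
    <[a :: r ++ q]> + (-1) ^ ((deg a - 1) * (bdeg r + bdeg q)) *: rot r (rcons q a)
  else 0.

Lemma llin_wd pre post : llin (fun x => <[pre ++ x :: post]>).
Proof. by move=> c x y z; exact: wd_multilin. Qed.

Lemma llin_comp_red W (g : letter C -> W) : llin g -> llin (fun x => g (red_l x)).
Proof. by move=> gl c x y z /red_l_lcomb; exact: gl. Qed.

Lemma llin_signed W (g : letter C -> W) (e : int -> int) :
  llin g -> llin (fun x => (-1) ^ e (deg x) *: g x).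
Proof.
move=> gl c x y z h; have [dx dy _] := h; apply: sgn_lin; rewrite ?dx ?dy //.
exact: gl.
Qed.

Lemma wd_head_red a p : <[red_l a :: p]> = <[a :: p]> - eps (elt a) *: <[one_l :: p]>.
Proof. exact: (llin_red a (llin_wd [::] p)). Qed.

(** When a splits into x and y, the rotation with head y and x at the end matches, by
    cocommutativity, the term of b with head x and y at the end. Heads are reduced in [rot] but not
    in b; the difference, evaluated by the counit, gives the words headed by the coaugmentation. *)
Lemma rot_core_cop a p q (n := (deg a - 1) * (bdeg p + bdeg q)) :
  csum (fun x y => (-1) ^ deg x *: (<[x :: red_l y :: p ++ q]> -
     (-1) ^ ((deg y - 1) * bdeg (p ++ q)) *: <[x :: rcons (p ++ q) (red_l y)]>)) a
  + csum (fun x y => (-1) ^ (deg x - 1) *: rot (red_l x :: red_l y :: p) q) a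
  = (-1) ^ (n + bdeg p + bdeg q) *:
      csum (fun x y => (-1) ^ (deg x - 1) *: rot p (q ++ [:: red_l x; red_l y])) a
  + (<[one_l :: a :: p ++ q]> - (-1) ^ n *: <[one_l :: rcons (p ++ q) a]>).
Proof.
set P := csum (fun x y => (-1) ^ deg x *: <[red_l x :: red_l y :: p ++ q]>) a.
set Q := csum (fun x y => (-1) ^ (deg x + (deg y - 1) * (bdeg p + bdeg q)) *:
   <[red_l x :: rcons (p ++ q) (red_l y)]>) a.
have U1 : csum (fun x y => eps (elt x) *: <[one_l :: red_l y :: p ++ q]>) a =
    <[one_l :: a :: p ++ q]>.
  rewrite (csum_counitl a (llin_comp_red (llin_wd [:: one_l] (p ++ q)))).
  exact: (wd_red _ [::]).
have U2 : csum (fun x y => eps (elt x) *: ((-1) ^ ((deg y - 1) * (bdeg p + bdeg q)) *: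
    <[one_l :: rcons (p ++ q) (red_l y)]>)) a = (-1) ^ n *: <[one_l :: rcons (p ++ q) a]>.
  have h : llin (fun y => (-1) ^ ((deg y - 1) * (bdeg p + bdeg q)) *:
      <[one_l :: rcons (p ++ q) (red_l y)]>).
    apply: (llin_signed (fun d => (d - 1) * (bdeg p + bdeg q))).
    apply: (@llin_comp_red _ (fun y => <[one_l :: rcons (p ++ q) y]>)) => c x y z.
    by rewrite -!cats1; exact: (llin_wd (one_l :: p ++ q) [::]).
  by rewrite (csum_counitl a h) -!cats1 wd_red.
have -> : csum (fun x y => (-1) ^ deg x *: (<[x :: red_l y :: p ++ q]> -
     (-1) ^ ((deg y - 1) * bdeg (p ++ q)) *: <[x :: rcons (p ++ q) (red_l y)]>)) a =
    P - Q + (<[one_l :: a :: p ++ q]> - (-1) ^ n *: <[one_l :: rcons (p ++ q) a]>).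
  rewrite -U1 -U2 -!csumN -!csumD; apply: eq_csum => x y xy.
  rewrite !wd_head_red !degE; have [->|/eps_deg0->] := eqVneq (eps (elt x)) 0.
    by rewrite !scale0r !subr0; koszul.
  by koszul.
have -> : csum (fun x y => (-1) ^ (deg x - 1) *: rot (red_l x :: red_l y :: p) q) a =
    - P + Q + (-1) ^ (n + bdeg p + bdeg q) *:
      csum (fun x y => (-1) ^ (deg x - 1) *: rot p (q ++ [:: red_l x; red_l y])) a.
  rewrite [X in _ = _ + X + _]csum_comm; last first.
    apply: (bilin_signed (fun i j => i + (j - 1) * (bdeg p + bdeg q))).
    split=> b.
      apply: (@llin_comp_red _ (fun y => <[red_l b :: rcons (p ++ q) y]>)) => c x y z.
      by rewrite -!cats1; exact: (llin_wd (_ :: p ++ q) [::]).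
    exact: (@llin_comp_red _ (fun x => <[x :: rcons (p ++ q) (red_l b)]>) (llin_wd [::] _)).
  rewrite -csumZ -csumN -!csumD; apply: eq_csum => x y xy /=.
  by rewrite !degE -!cats1 -!catA /= /n -xy; koszul.
by koszul.
Qed.

Lemma rotE a p q :
  rot (a :: p) q = <[a :: p ++ q]> + (-1) ^ ((deg a - 1) * (bdeg p + bdeg q)) *: rot p (rcons q a).
Proof. by []. Qed.

Lemma DopE W (F : word -> W) a p : Dop F (a :: p) = - (s *: F (dif_l a :: p))
    + t *: csum (fun x y => (-1) ^ (deg x - 1) *: F (red_l x :: red_l y :: p)) a
    + (-1) ^ (deg a - 1) *: Dop (fun r => F (a :: r)) p.
Proof. by []. Qed.

Lemma Dop_rcons W (F : word -> W) p a :
  Dop F (rcons p a) = Dop (fun r => F (rcons r a)) p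
    + (-1) ^ bdeg p *: (- (s *: F (rcons p (dif_l a)))
       + t *: csum (fun x y => (-1) ^ (deg x - 1) *: F (p ++ [:: red_l x; red_l y])) a).
Proof.
rewrite -cats1 Dop_cat DopE /= scaler0 addr0 cats1; congr (_ + _).
by apply: eq_Dop => r; rewrite cats1.
Qed.

(** Rotation anticommutes with the differential except at the two places where the circular word is
    cut between p and q. For q empty the cuts coincide and the defect vanishes, which is the source
    of b B + B b = 0. *)
Lemma rot_core p q :
  sdiff (rot p q) + Dop (fun r => rot r q) p + (-1) ^ bdeg p *: Dop (rot p) q
  = t *: (<[one_l :: p ++ q]> - (-1) ^ (bdeg p * bdeg q) *: <[one_l :: q ++ p]>).
Proof.
elim: p q => [|a p IHp] q.
  by rewrite /= linear0 Dop0 !degE cats0 mul0r expr0z !scale1r subrr scaler0 !addr0.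
rewrite [rot (a :: p) q]rotE bstD bstZ bst_wd /wdiff Dop_cat DopE.
rewrite (@eq_Dop _ (fun r => rot (a :: r) q) _ p (fun r => rotE a r q)).
rewrite DopD (Dop_sg (fun n => (-1) ^ ((deg a - 1) * (n + bdeg q)))).
rewrite (@eq_Dop _ (rot (a :: p)) _ q (rotE a p)).
rewrite DopD (Dop_sg (fun n => (-1) ^ ((deg a - 1) * (bdeg p + n)))).
have := rot_core_cop a p q; have := IHp (rcons q a).
rewrite Dop_rcons rotE !degE -!cats1 -!catA /= => E1 E2.
apply: (eq_comb2 (c := (-1) ^ ((deg a - 1) * (bdeg p + bdeg q))) (c' := t) E1 E2).
by koszul.
Qed.
End Operators.

(** * Contraction of a word by another *)

Section Insertion.
Variables (K : fieldType) (m : int) (C : openFrobenius K m).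
Implicit Types (W : lmodType K).
Notation word := (seq (letter C)).
Notation "<[ w ]>" := (wd (unit_rel C) w) (format "<[ w ]>").
Variables s t : K.
Notation Dop := (Dop s t).
Notation bwd := (wdiff s t).

Lemma llin_multilin W (F : word -> W) pre post :
  multilin F -> llin (fun x => F (pre ++ x :: post)).
Proof. by move=> Fm c x y z; exact: Fm. Qed.

Lemma multilin_cons W (F : word -> W) a : multilin F -> multilin (fun r => F (a :: r)).
Proof. by move=> Fm pre post c x y z; exact: (Fm (a :: pre)). Qed.

Definition pair_eps (z a : letter C) : K := eps (elt (mul_l z a)).

Lemma pair_deg z a : pair_eps z a != 0 -> deg z + deg a = m.
Proof. by move=> /eps_deg0; rewrite deg_mul; lia. Qed.

(** The analogue of [eps_scale_eq]: signs under a factor eps(z a) may be computed with |z| + |a| =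
    m. *)
Lemma pair_scale_eq W z a (x y : W) :
  (deg z + deg a = m -> x = y) -> pair_eps z a *: x = pair_eps z a *: y.
Proof. by have [->|/pair_deg -> ->//] := eqVneq (pair_eps z a) 0; rewrite !scale0r. Qed.

Lemma pair_linl a c x y z : lcomb c x y z -> pair_eps z a = c * pair_eps x a + pair_eps y a.
Proof. by move=> /(mul_l_lcombl a)[_ _]; rewrite /pair_eps => ->; rewrite linearP. Qed.

Lemma pair_linr a c x y z : lcomb c x y z -> pair_eps a z = c * pair_eps a x + pair_eps a y.
Proof. by move=> /(mul_l_lcombr a)[_ _]; rewrite /pair_eps => ->; rewrite linearP. Qed.

Lemma pair_red z a : pair_eps z (red_l a) = pair_eps z a - eps (elt a) * pair_eps z one_l.
Proof.
have h : llin (fun x => pair_eps z x : K^o) by move=> c x y w; exact: pair_linr.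
exact: (llin_red a h).
Qed.

Lemma pair_comm z a : pair_eps z a = (-1) ^ (deg z * deg a + m) * pair_eps a z.
Proof.
rewrite /pair_eps !(mul_lP _ _).2 (mul_comm (letterP z) (letterP a)).
by rewrite linearZ.
Qed.

(** eps vanishes on d(z a), so the Leibniz rule makes d skew-adjoint for the pairing, up to a Koszul
    sign. *)
Lemma pair_dif z a : 
  pair_eps (dif_l z) a = - ((-1) ^ deg z * pair_eps z (dif_l a)).
Proof.
apply/eqP; rewrite -addr_eq0 /pair_eps !(mul_lP _ _).2 !(dif_lP _).2.
have := eps_dif (fmul (elt z) (elt a)); rewrite (dif_mul _ (letterP z)) linearZ /=.
rewrite linearD linearZ /= => /eqP; rewrite mulf_eq0 => /orP[|//].
by rewrite expfz_eq0 oppr_eq0 oner_eq0 andbF.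
Qed.

Lemma bilin_pair W (g : letter C -> W) z : llin g ->
  bilin (fun x y => pair_eps z x *: g y).
Proof.
move=> gl; split=> b c x y w h; first by rewrite (gl _ _ _ _ h); koszul.
by rewrite (pair_linr _ h) scalerDl scalerA.
Qed.

(** The Frobenius relation followed by the counit: contracting half of the coproduct of a with z
    leaves z a. [frob_right] contracts the coproduct of z with a instead. *)
Lemma frob_left W (g : letter C -> W) z a : llin g ->
  csum (fun x y => pair_eps z x *: g y) a = g (mul_l z a).
Proof.
move=> gl; rewrite -[RHS]csum_counitl // csum_mull //.
exact: counit_bilin.
Qed.

Lemma frob_left_swap W (g : letter C -> W) z a : llin g ->
  csum (fun x y => (-1) ^ (deg x * deg y) *: (pair_eps z y *: g x)) a = g (mul_l z a).
Proof.
move=> gl; rewrite -[RHS]frob_left // [RHS]csum_comm; last exact: bilin_pair.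
by [].
Qed.

Lemma frob_right W (g : letter C -> W) z a : llin g ->
  csum (fun x y => (-1) ^ (deg a * deg y) *: (pair_eps x a *: g y)) z = g (mul_l z a).
Proof.
move=> gl; rewrite -[RHS]csum_counitl // csum_mulr //.
exact: counit_bilin.
Qed.

(* Functionals composed with the derivation of the cobar construction that
   replaces one letter a by eps(z a) zs. *)
Definition icoef (z : letter C) (zs : word) (a : letter C) : K :=
  (-1) ^ (bdeg zs * (deg a - 1) + deg z) * pair_eps z a.

(** The degree of the derivation: it trades a letter a with |a| = m - |z|, which counts m - |z| - 1
    in the tail, for zs. *)
Definition ideg (z : letter C) (zs : word) : int := deg z + bdeg zs - m + 1.

Fixpoint ins W (z : letter C) (zs : word) (F : word -> W) (p : word) : W :=
  if p is a :: q then
    icoef z zs a *: F (zs ++ q)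
    + (-1) ^ (ideg z zs * (deg a - 1)) *: ins z zs (fun r => F (a :: r)) q
  else 0.

Lemma insE W z zs (F : word -> W) a p : ins z zs F (a :: p) =
  icoef z zs a *: F (zs ++ p)
    + (-1) ^ (ideg z zs * (deg a - 1)) *: ins z zs (fun r => F (a :: r)) p.
Proof. by []. Qed.

Lemma eq_ins W z zs (F G : word -> W) p : F =1 G -> ins z zs F p = ins z zs G p.
Proof. by move=> /funext->. Qed.

Lemma insD W z zs (F G : word -> W) p :
  ins z zs (fun r => F r + G r) p = ins z zs F p + ins z zs G p.
Proof. by elim: p F G => [|a p IHp] F G /=; rewrite ?addr0 // IHp; koszul. Qed.

Lemma ins_linear W W' (g : W -> W') z zs (F : word -> W) p : linear g ->
  ins z zs (fun r => g (F r)) p = g (ins z zs F p).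
Proof.
move=> gl; pose g' : {linear W -> W'} := HB.pack g (GRing.isLinear.Build _ _ _ _ _ gl).
have gZ c x : g (c *: x) = c *: g x := linearZ_LR g' c x.
have gD x y : g (x + y) = g x + g y := linearD g' x y.
have g0 : g 0 = 0 := linear0 g'.
by elim: p F => [|a p IHp] F /=; rewrite ?g0 // gD !gZ IHp.
Qed.

Lemma insZ W c z zs (F : word -> W) p : ins z zs (fun r => c *: F r) p = c *: ins z zs F p.
Proof. by apply: ins_linear => a x y; rewrite scalerDr !scalerA mulrC. Qed.

Lemma insN W z zs (F : word -> W) p : ins z zs (fun r => - F r) p = - ins z zs F p.
Proof. by apply: ins_linear => a x y; rewrite scalerN opprD. Qed.

Lemma ins_csum W z zs (G : letter C -> letter C -> word -> W) a p :
  ins z zs (fun r => csum (fun x y => G x y r) a) p = csum (fun x y => ins z zs (G x y) p) a.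
Proof.
elim: p G => [|b p IHp] G; first by rewrite /= /csum big1.
by rewrite insE IHp -!csumZ -csumD.
Qed.

(** Where the pairing is nonzero, replacing a by zs shifts the degree of the word by [ideg];
    elsewhere the term is 0. *)
Lemma ins_sg W z zs (f : int -> K) (F : word -> W) p :
  ins z zs (fun r => f (bdeg r) *: F r) p = f (bdeg p + ideg z zs) *: ins z zs F p.
Proof.
elim: p f F => [|a p IHp] f F; first by rewrite scaler0.
rewrite !insE (eq_ins z zs (G := fun r => f (deg a - 1 + bdeg r) *: F (a :: r))); last first.
  by move=> r; rewrite degE.
rewrite (IHp (fun n => f (deg a - 1 + n))) [bdeg (a :: p)]degE addrA scalerDr.
congr (_ + _); last first.
  by rewrite !scalerA mulrC.
rewrite /icoef -!scalerA; have -> : pair_eps z a *: (f (bdeg (zs ++ p)) *: F (zs ++ p)) =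
    pair_eps z a *: (f (deg a - 1 + bdeg p + ideg z zs) *: F (zs ++ p)).
  by apply: pair_scale_eq => za; rewrite degE /ideg; congr (f _ *: _); lia.
by koszul.
Qed.

Lemma ins_cat W z zs (F : word -> W) p q :
  ins z zs F (p ++ q) = ins z zs (fun r => F (r ++ q)) p
    + (-1) ^ (ideg z zs * bdeg p) *: ins z zs (fun r => F (p ++ r)) q.
Proof.
elim: p F => [|a p IHp] F; first by rewrite /= degE mulr0 expr0z scale1r add0r.
by rewrite cat_cons !insE IHp !degE catA; koszul.
Qed.

Lemma ins_Dop W z zs (G : word -> word -> W) p q :
  ins z zs (fun r => Dop (G r) q) p = Dop (fun r' => ins z zs (G^~ r') p) q.
Proof.
elim: p G => [|a p IHp] G; first by rewrite /= Dop0.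
rewrite insE IHp /=.
by rewrite DopD !DopZ.
Qed.

Lemma eq_bwd W (F G : letter C -> word -> W) c p : (forall c p, F c p = G c p) ->
  bwd F c p = bwd G c p.
Proof. by move=> h; congr (wdiff _ _ _ c p); apply/funext => x; apply/funext => y. Qed.

Lemma bwdD W (F G : letter C -> word -> W) c p :
  bwd (fun c p => F c p + G c p) c p = bwd F c p + bwd G c p.
Proof.
rewrite /wdiff DopD [X in _ + _ *: X](_ : _ =
  csum (fun x y => (-1) ^ deg x *:
      (F x (red_l y :: p) - (-1) ^ ((deg y - 1) * bdeg p) *: F x (rcons p (red_l y)))) c
  + csum (fun x y => (-1) ^ deg x *:
      (G x (red_l y :: p) - (-1) ^ ((deg y - 1) * bdeg p) *: G x (rcons p (red_l y)))) c).
  by koszul.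
by rewrite -csumD; apply: eq_csum => x y _; koszul.
Qed.

Lemma bwd_linear W W' (g : W -> W') (F : letter C -> word -> W) c p : linear g ->
  bwd (fun c p => g (F c p)) c p = g (bwd F c p).
Proof.
move=> gl; pose g' : {linear W -> W'} := HB.pack g (GRing.isLinear.Build _ _ _ _ _ gl).
have gZ b x : g (b *: x) = b *: g x := linearZ_LR g' b x.
have gD x y : g (x + y) = g x + g y := linearD g' x y.
have gN x : g (- x) = - g x := linearN g' x.
have gS (f : letter C -> letter C -> W) a :
  g (csum f a) = csum (fun x y => g (f x y)) a := csum_linear g' f a.
rewrite /wdiff !gD !gZ gS Dop_linear //; congr (_ + _ *: _).
by apply: eq_csum => x y _; rewrite gZ gD gN gZ.
Qed.

Lemma bwdZ W a (F : letter C -> word -> W) c p :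
  bwd (fun c p => a *: F c p) c p = a *: bwd F c p.
Proof. by apply: bwd_linear => b x y; rewrite scalerDr !scalerA mulrC. Qed.

Lemma bwd_sg W (f : int -> K) (F : letter C -> word -> W) c p :
  bwd (fun c p => f (deg c + bdeg p) *: F c p) c p = f (deg c + bdeg p - 1) *: bwd F c p.
Proof.
rewrite /wdiff (Dop_sg s t (fun n => f (deg c + n))) deg_dif.
rewrite (_ : deg c - 1 + bdeg p = deg c + bdeg p - 1); last by lia.
rewrite (_ : deg c + (bdeg p - 1) = deg c + bdeg p - 1); last by lia.
rewrite [X in _ + _ *: X = _](_ : _ = f (deg c + bdeg p - 1) *:
  csum (fun x y => (-1) ^ deg x *:
      (F x (red_l y :: p) - (-1) ^ ((deg y - 1) * bdeg p) *: F x (rcons p (red_l y)))) c).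
  by koszul.
rewrite -csumZ; apply: eq_csum => x y xy; rewrite !degE -xy.
rewrite (_ : deg x + (deg y - 1 + bdeg p) = deg x + deg y + bdeg p - 1); last by lia.
rewrite (_ : deg x + (bdeg p + (deg y - 1)) = deg x + deg y + bdeg p - 1); last by lia.
by koszul.
Qed.

Lemma icoef_eq W z zs a (x y : W) :
  (deg z + deg a = m -> x = y) -> icoef z zs a *: x = icoef z zs a *: y.
Proof. by move=> h; rewrite /icoef -!scalerA; congr (_ *: _); exact: pair_scale_eq. Qed.

(** Both sides insert the reduced product z a at one end or the other of zs: on the left by
    [frob_right] for the coproduct of z, on the right by [frob_left] for that of a. The terms with
    eps(z 1) come from the reduction of the halves of a. *)
Lemma ins_core_cop W z zs a p (F : word -> W) : multilin F ->
  csum (fun x y => (-1) ^ deg x *: 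
     (icoef x (red_l y :: zs) a *: F (red_l y :: zs ++ p)
     - (-1) ^ ((deg y - 1) * bdeg zs) *: (icoef x (rcons zs (red_l y)) a *: F (rcons zs (red_l y) ++ p)))) z
  = (-1) ^ (m + ideg z zs) *:
    csum (fun x y => (-1) ^ (deg x - 1) *:
     (icoef z zs (red_l x) *: F (zs ++ red_l y :: p)
     + (-1) ^ (ideg z zs * (deg x - 1)) *: (icoef z zs (red_l y) *: F (red_l x :: zs ++ p)))) a
  + pair_eps z one_l *: (F (zs ++ red_l a :: p)
      - (-1) ^ (bdeg zs * (deg a - 1)) *: F (red_l a :: zs ++ p)).
Proof.
move=> Fm.
have h1 : llin (fun y => F (zs ++ red_l y :: p)).
  exact: (@llin_comp_red _ _ _ _ (fun y => F (zs ++ y :: p)) (llin_multilin zs p Fm)).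
have h2 : llin (fun y => F (red_l y :: zs ++ p)).
  exact: (@llin_comp_red _ _ _ _ (fun y => F (y :: zs ++ p)) (llin_multilin [::] _ Fm)).
have E1 := frob_left z a h1; have E1' := frob_left_swap z a h2.
have E2 := frob_right z a h1; have E2' := frob_right z a h2.
have E3 := csum_counitl a h1; have E3' := csum_counitr a h2.
set L := csum _ z; set R := csum _ a.
have -> : L = (-1) ^ ((deg z - m + deg a - 1 + bdeg zs) * (deg a - 1) + deg a * (deg z - m + deg a)) *:
    (F (red_l (mul_l z a) :: zs ++ p)
    - (-1) ^ ((deg z - m + deg a - 1) * bdeg zs) *: F (zs ++ red_l (mul_l z a) :: p)).
  rewrite -E2 -E2' /L; set c := _ ^ _; set c' := _ ^ _.
  rewrite -(csumZ c') -csumN -csumD -csumZ /c /c' {c c'}.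
  apply: eq_csum => x y xy.
  rewrite /icoef cat_rcons !degE /=.
  set u := F _; set v := F _.
  transitivity (pair_eps x a *: ((-1) ^ deg x *: (
     (-1) ^ ((deg y - 1 + bdeg zs) * (deg a - 1) + deg x) *: u
     - (-1) ^ ((deg y - 1) * bdeg zs + ((deg y - 1 + bdeg zs) * (deg a - 1) + deg x)) *: v))).
    by koszul.
  transitivity (pair_eps x a *: ((-1) ^ ((deg z - m + deg a - 1 + bdeg zs) * (deg a - 1)
        + deg a * (deg z - m + deg a) + deg a * deg y) *:
     (u - (-1) ^ ((deg z - m + deg a - 1) * bdeg zs) *: v))); last by koszul.
  apply: pair_scale_eq => xa; rewrite (_ : deg x = m - deg a); last by lia.
  by rewrite (_ : deg y = deg z - m + deg a); [koszul | lia].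
have -> : R = (-1) ^ (m - deg z - 1) *: ((-1) ^ (bdeg zs * (m - deg z - 1) + deg z) *:
      F (zs ++ red_l (mul_l z a) :: p))
    + (-1) ^ ((ideg z zs + 1) * (deg a - m + deg z - 1) + bdeg zs * (m - deg z - 1) + deg z
        + (deg a - m + deg z) * (m - deg z)) *: F (red_l (mul_l z a) :: zs ++ p)
    - pair_eps z one_l *: ((-1) ^ (1 + bdeg zs + m) *: F (zs ++ red_l a :: p)
       + (-1) ^ ((ideg z zs + 1) * (deg a - 1) + bdeg zs + m) *: F (red_l a :: zs ++ p)).
  rewrite -E1 -E1' -E3 -E3' /R -!csumZ -!csumD -csumZ -csumN -csumD.
  apply: eq_csum => x y xy; rewrite /icoef !deg_red !pair_red.
  set u := F _; set v := F _.
  pose T1 := pair_eps z x *: ((-1) ^ (deg x - 1 + bdeg zs * (deg x - 1) + deg z) *: u).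
  pose T2 := pair_eps z y *: ((-1) ^ ((ideg z zs + 1) * (deg x - 1)
    + bdeg zs * (deg y - 1) + deg z) *: v).
  pose T3 := pair_eps z one_l *: (eps (elt x) *:
    ((-1) ^ (deg x - 1 + bdeg zs * (deg x - 1) + deg z) *: u)).
  pose T4 := pair_eps z one_l *: (eps (elt y) *: ((-1) ^ ((ideg z zs + 1) * (deg x - 1)
    + bdeg zs * (deg y - 1) + deg z) *: v)).
  transitivity (T1 + T2 - T3 - T4); first by rewrite !mulrBr !scalerBl /T1 /T2 /T3 /T4; koszul.
  have -> : T1 = pair_eps z x *: ((-1) ^ (m - deg z - 1 + bdeg zs * (m - deg z - 1) + deg z) *: u).
    by apply: pair_scale_eq => zx; rewrite (_ : deg x = m - deg z); [koszul | lia].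
  have -> : T2 = pair_eps z y *: ((-1) ^ ((ideg z zs + 1) * (deg a - m + deg z - 1)
      + bdeg zs * (m - deg z - 1) + deg z + (deg a - m + deg z) * (m - deg z)
      + deg x * deg y) *: v).
    apply: pair_scale_eq => zx; rewrite /ideg (_ : deg x = deg a - m + deg z); last by lia.
    by rewrite (_ : deg y = m - deg z); [koszul | lia].
  have -> : T3 = pair_eps z one_l *: (eps (elt x) *: ((-1) ^ (1 + bdeg zs + m) *: u)).
    apply: pair_scale_eq; rewrite deg_one addr0 => zm; apply: eps_scale_eq => x0.
    by rewrite x0 zm; koszul.
  have -> : T4 = pair_eps z one_l *: (eps (elt y) *:
      ((-1) ^ ((ideg z zs + 1) * (deg a - 1) + bdeg zs + m) *: v)).
    apply: pair_scale_eq; rewrite deg_one addr0 => zm; apply: eps_scale_eq => x0.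
    by rewrite /ideg zm (_ : deg x = deg a) ?x0; [koszul | lia].
  by koszul.
set A := F _; set B := F _; set A' := F _; set B' := F _.
have E : pair_eps z one_l *: ((-1) ^ (m + ideg z zs) *: ((-1) ^ (1 + bdeg zs + m) *: A'
      + (-1) ^ ((ideg z zs + 1) * (deg a - 1) + bdeg zs + m) *: B'))
   = pair_eps z one_l *: (A' - (-1) ^ (bdeg zs * (deg a - 1)) *: B').
  apply: pair_scale_eq; rewrite deg_one addr0 /ideg => zm.
  by rewrite (_ : deg z = m) //; koszul.
apply: (eq_comb (c := 1) E); rewrite /ideg.
by koszul.
Qed.

(** Commuting the insertion past the cobar derivation gives the insertion of b(z[zs]). The
    right-hand side is the inner derivation of zs, weighted by eps(z 1). *)
Lemma ins_core W z zs (F : word -> W) p : multilin F -> reduced p ->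
  ins z zs (Dop F) p - (-1) ^ ideg z zs *: Dop (ins z zs F) p
    + (-1) ^ m *: bwd (fun z zs => ins z zs F p) z zs
  = (t * pair_eps z one_l) *: ((-1) ^ m *: F (zs ++ p)
       - (-1) ^ (m + bdeg zs * bdeg p) *: F (p ++ zs)).
Proof.
elim: p F => [|a p IHp] F Fm.
  move=> _ /=; rewrite /wdiff Dop0 /= cats0 !degE.
  rewrite (_ : csum _ z = 0); first by koszul.
  by rewrite /csum big1 // => u _; koszul.
(* Since a is reduced, the letter red a left over by [ins_core_cop] is a itself. *)
case/andP=> /eqP/red_id ra rp; rewrite insE.
have := IHp _ (multilin_cons a Fm) rp.
set I := ins z zs (Dop _) p; set J := Dop (ins z zs _) p; set M := bwd _ z zs => IH.
pose S := csum (fun x y => (-1) ^ (deg x - 1) *: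
  ins z zs (fun r => F (red_l x :: red_l y :: r)) p) a.
have -> : ins z zs (fun r => Dop F (a :: r)) p = 
    - (s *: ins z zs (fun r => F (dif_l a :: r)) p) + t *: S + (-1) ^ (deg a - 1) *: I.
  rewrite (eq_ins z zs p (DopE s t F a)) !insD insN !insZ ins_csum /S.
  by congr (_ + _ *: _ + _); apply: eq_csum => x y _; rewrite insZ.
have -> : Dop (ins z zs F) (a :: p) =
    - (s *: (icoef z zs (dif_l a) *: F (zs ++ p)
        + (-1) ^ (ideg z zs * deg a) *: ins z zs (fun r => F (dif_l a :: r)) p))
    + t *: (csum (fun x y => (-1) ^ (deg x - 1) *:
     (icoef z zs (red_l x) *: F (zs ++ red_l y :: p)
     + (-1) ^ (ideg z zs * (deg x - 1)) *: (icoef z zs (red_l y) *: F (red_l x :: zs ++ p)))) a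
      + (-1) ^ (ideg z zs * deg a) *: S)
    + (-1) ^ (deg a - 1) *: (icoef z zs a *: Dop (fun r => F (zs ++ r)) p
        + (-1) ^ (ideg z zs * (deg a - 1)) *: J).
  rewrite DopE insE (eq_Dop s t p (insE z zs F a)).
  rewrite DopD !DopZ deg_dif; congr (- (_ *: _) + _ *: _ + _); first by koszul.
  rewrite /S -csumZ -csumD; apply: eq_csum => x y xy; rewrite !insE !deg_red -xy.
  by koszul.
have -> : bwd (fun z zs => ins z zs F (a :: p)) z zs =
   bwd (fun z zs => icoef z zs a *: F (zs ++ p)) z zs
   + (-1) ^ ((ideg z zs - 1) * (deg a - 1)) *: M.
  rewrite (eq_bwd (G := fun z zs => icoef z zs a *: F (zs ++ p) + (-1) ^ (ideg z zs * (deg a - 1))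
      *: ins z zs (fun r => F (a :: r)) p)); last by move=> x r; exact: insE.
  rewrite bwdD (bwd_sg (fun n => (-1) ^ ((n - m + 1) * (deg a - 1)))) -/M /ideg.
  by congr (_ + (-1) ^ (_ * _) *: _); lia.
rewrite /wdiff (ins_core_cop z zs a p Fm) ra Dop_cat degE.
rewrite (Dop_sg s t (fun n => (-1) ^ (n * (deg a - 1) + deg z) * pair_eps z a)).
set L := csum _ a; set X := Dop _ zs; set Y := Dop _ p.
(* [E1] to [E4] are sign identities that hold only where the pairing is nonzero, so they enter the
   final combination as hypotheses. *)
have E1 : (-1) ^ m *: ((-1) ^ deg z *:
    (((-1) ^ ((bdeg zs - 1) * (deg a - 1) + deg z) * pair_eps z a) *: X)) =
    - (icoef z zs a *: X).
  transitivity (pair_eps z a *: ((-1) ^ (m + (bdeg zs - 1) * (deg a - 1)) *: X)); first by koszul.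
  transitivity (pair_eps z a *: (- ((-1) ^ (bdeg zs * (deg a - 1) + deg z) *: X))).
    by apply: pair_scale_eq => za; rewrite (_ : deg z = m - deg a); [koszul | lia].
  by rewrite /icoef; koszul.
have E2 : (-1) ^ m *: (icoef (dif_l z) zs a *: F (zs ++ p)) =
    - ((-1) ^ ideg z zs *: (icoef z zs (dif_l a) *: F (zs ++ p))).
  rewrite /icoef pair_dif !deg_dif /ideg.
  transitivity (pair_eps z (dif_l a) *:
     (- (-1) ^ (m + deg z + bdeg zs * (deg a - 1) + deg z - 1) *: F (zs ++ p))); first by koszul.
  transitivity (pair_eps z (dif_l a) *:
     (- (-1) ^ (deg z + bdeg zs - m + 1 + bdeg zs * (deg a - 1 - 1) + deg z) *: F (zs ++ p))).
    by apply: pair_scale_eq; rewrite deg_dif => za; koszul.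
  by koszul.
have E3 : icoef z zs a *: ((-1) ^ bdeg zs *: Y) =
    icoef z zs a *: ((-1) ^ (ideg z zs + (deg a - 1)) *: Y).
  by apply: icoef_eq => za; rewrite /ideg (_ : deg z = m - deg a); [koszul | lia].
set P := F (a :: zs ++ p); set Q := F (a :: p ++ zs).
have E4 : pair_eps z one_l *: ((-1) ^ ((ideg z zs + 1) * (deg a - 1)) *:
    ((-1) ^ m *: P - (-1) ^ (m + bdeg zs * bdeg p) *: Q)) =
    pair_eps z one_l *: ((-1) ^ (bdeg zs * (deg a - 1)) *:
    ((-1) ^ m *: P - (-1) ^ (m + bdeg zs * bdeg p) *: Q)).
  apply: pair_scale_eq; rewrite deg_one addr0 /ideg => zm.
  by rewrite (_ : deg z = m) //; koszul.
apply: (eq_comb (c := (-1) ^ ((ideg z zs + 1) * (deg a - 1))) IH).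
apply: (eq_comb (c := 1) E1); apply: (eq_comb (c := s) E2).
apply: (eq_comb (c := 1) E3); apply: (eq_comb (c := t) E4).
rewrite /ideg -?catA /=.
by koszul.
Qed.

End Insertion.

(** * Contraction combined with rotation *)

Section RotIns.
Variables (K : fieldType) (m : int) (C : openFrobenius K m).
Implicit Types (W : lmodType K).
Notation word := (seq (letter C)).
Notation "<[ w ]>" := (wd (unit_rel C) w) (format "<[ w ]>").
Variables s t : K.
Notation Dop := (Dop s t).
Notation bwd := (wdiff s t).
Notation bst := (@sdiff K m C s t).

(** One term for each pair of letters of p: the earlier becomes the head of a rotation, the later is
    contracted with z and replaced by zs. Letters of q play neither part. *)
Fixpoint rotins (z : letter C) (zs p q : word) : ccw C :=
  if p is a :: r then
    (-1) ^ (ideg z zs * deg a) *: ins z zs (fun r' => <[a :: r' ++ q]>) r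
    + (-1) ^ ((deg a - 1) * (bdeg r + bdeg q)) *: rotins z zs r (rcons q a)
  else 0.

Lemma rotinsE z zs a p q : rotins z zs (a :: p) q =
  (-1) ^ (ideg z zs * deg a) *: ins z zs (fun r' => <[a :: r' ++ q]>) p
    + (-1) ^ ((deg a - 1) * (bdeg p + bdeg q)) *: rotins z zs p (rcons q a).
Proof. by []. Qed.

Lemma llin_ins W (G : letter C -> word -> W) z zs p :
  (forall r, llin (G^~ r)) -> llin (fun x => ins z zs (G x) p).
Proof.
move=> Gl c x y w h; rewrite -insZ -insD; apply: eq_ins => r; exact: Gl.
Qed.

(** Compared with [rot_core_cop] there is a new head z a: it arises when a splits into a half that
    becomes the head and a half that is contracted with z, by [frob_left_swap]. *)
Lemma rotins_core_cop z zs a p q (d := ideg z zs) : eps (elt a) = 0 ->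
  (-1) ^ (d * deg a) *: csum (fun x y => (-1) ^ deg x *:
      (ins z zs (fun r => <[x :: red_l y :: r ++ q]>) p
       - (-1) ^ ((deg y - 1) * (bdeg p + d + bdeg q)) *:
         ins z zs (fun r => <[x :: rcons (r ++ q) (red_l y)]>) p)) a
  + (-1) ^ d *: csum (fun x y => (-1) ^ (deg x - 1) *:
      rotins z zs (red_l x :: red_l y :: p) q) a
  = (-1) ^ (d + deg a * (bdeg p + bdeg q)) *:
      csum (fun x y => (-1) ^ (deg x - 1) *: rotins z zs p (q ++ [:: red_l x; red_l y])) a
  + (-1) ^ d *: (icoef z zs a *: <[one_l :: zs ++ p ++ q]>
       + (-1) ^ (d * (deg a - 1)) *: ins z zs (fun r => <[one_l :: a :: r ++ q]>) p)
  - (-1) ^ (d * deg a + (deg a - 1) * (bdeg p + d + bdeg q)) *: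
       ins z zs (fun r => <[one_l :: rcons (r ++ q) a]>) p
  + (-1) ^ (m + deg a * bdeg zs) *: <[mul_l z a :: zs ++ p ++ q]>
  - (-1) ^ (bdeg zs * deg a + m) *: (pair_eps z one_l *: <[a :: zs ++ p ++ q]>).
Proof.
move=> a0.
set P := csum (fun x y => (-1) ^ deg x *:
  ins z zs (fun r => <[red_l x :: red_l y :: r ++ q]>) p) a.
set Q := csum (fun x y => (-1) ^ (deg x + (deg y - 1) * (bdeg p + d + bdeg q)) *:
  ins z zs (fun r => <[red_l x :: rcons (r ++ q) (red_l y)]>) p) a.
have U1 : csum (fun x y => eps (elt x) *:
     ins z zs (fun r => <[one_l :: red_l y :: r ++ q]>) p) a =
    ins z zs (fun r => <[one_l :: a :: r ++ q]>) p.
  rewrite csum_counitl; last first.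
    apply: (@llin_comp_red _ _ _ _ (fun y => ins z zs (fun r => <[one_l :: y :: r ++ q]>) p)).
    by apply: llin_ins => r; exact: (llin_wd [:: one_l]).
  by apply: eq_ins => r; exact: (wd_red _ [::]).
have U2 : csum (fun x y => eps (elt x) *: ((-1) ^ ((deg y - 1) * (bdeg p + d + bdeg q)) *:
    ins z zs (fun r => <[one_l :: rcons (r ++ q) (red_l y)]>) p)) a =
  (-1) ^ ((deg a - 1) * (bdeg p + d + bdeg q)) *:
    ins z zs (fun r => <[one_l :: rcons (r ++ q) a]>) p.
  rewrite csum_counitl; last first.
    apply: (llin_signed (fun e => (e - 1) * (bdeg p + d + bdeg q))).
    apply: (@llin_comp_red _ _ _ _
      (fun y => ins z zs (fun r => <[one_l :: rcons (r ++ q) y]>) p)).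
    apply: llin_ins => r c x y w.
    by rewrite -!cats1; exact: (llin_wd (one_l :: r ++ q) [::]).
  by congr (_ *: _); apply: eq_ins => r; rewrite -!cats1 wd_red.
have -> : csum (fun x y => (-1) ^ deg x *:
      (ins z zs (fun r => <[x :: red_l y :: r ++ q]>) p
       - (-1) ^ ((deg y - 1) * (bdeg p + d + bdeg q)) *:
         ins z zs (fun r => <[x :: rcons (r ++ q) (red_l y)]>) p)) a =
    P - Q + (ins z zs (fun r => <[one_l :: a :: r ++ q]>) p
      - (-1) ^ ((deg a - 1) * (bdeg p + d + bdeg q)) *:
    ins z zs (fun r => <[one_l :: rcons (r ++ q) a]>) p).
  rewrite -U1 -U2 -!csumN -!csumD; apply: eq_csum => x y xy.
  have E w : <[x :: w]> = <[red_l x :: w]> + eps (elt x) *: <[one_l :: w]>.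
    by rewrite wd_head_red subrK.
  rewrite (eq_ins z zs p (fun r => E (red_l y :: r ++ q))).
  rewrite (eq_ins z zs p (fun r => E (rcons (r ++ q) (red_l y)))).
  rewrite !insD !insZ; have [->|/eps_deg0->] := eqVneq (eps (elt x)) 0.
    by rewrite !scale0r; koszul.
  by koszul.
have V1 := frob_left_swap z a (llin_comp_red (llin_wd [::] (zs ++ p ++ q))).
have V2 := csum_counitr a (llin_comp_red (llin_wd [::] (zs ++ p ++ q))).
rewrite /= (red_id a0) wd_head_red in V1 V2.
have -> : csum (fun x y => (-1) ^ (deg x - 1) *: rotins z zs (red_l x :: red_l y :: p) q) a =
    (-1) ^ (d * deg a) *: (- (-1) ^ d *: P + (-1) ^ d *: Q)
    + (-1) ^ (deg a * (bdeg p + bdeg q)) *: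
      csum (fun x y => (-1) ^ (deg x - 1) *: rotins z zs p (q ++ [:: red_l x; red_l y])) a
    + (-1) ^ (d + m + deg a * bdeg zs) *:
       (<[mul_l z a :: zs ++ p ++ q]> - pair_eps z a *: <[one_l :: zs ++ p ++ q]>)
    - pair_eps z one_l *: ((-1) ^ (d + bdeg zs * deg a + m) *: <[a :: zs ++ p ++ q]>).
  rewrite -V1 -V2 [Q]csum_comm; last first.
    apply: (bilin_signed (fun i j => i + (j - 1) * (bdeg p + d + bdeg q))); split=> b.
      apply: (@llin_comp_red _ _ _ _
        (fun y => ins z zs (fun r => <[red_l b :: rcons (r ++ q) y]>) p)).
      apply: llin_ins => r c x y w.
      by rewrite -!cats1; exact: (llin_wd (_ :: r ++ q) [::]).
    apply: (@llin_comp_red _ _ _ _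
      (fun x => ins z zs (fun r => <[x :: rcons (r ++ q) (red_l b)]>) p)).
    by apply: llin_ins => r; exact: (llin_wd [::]).
  rewrite /P -?csumN -?csumZ -?csumD -?csumZ -?csumD -?csumZ -?csumD -?csumZ -?csumD -?csumN -?csumD.
  apply: eq_csum => x y xy; rewrite !rotinsE insE.
  rewrite (_ : ins z zs (fun r => <[red_l y :: r ++ rcons q (red_l x)]>) p =
    ins z zs (fun r => <[red_l y :: rcons (r ++ q) (red_l x)]>) p); last first.
    by apply: eq_ins => r; rewrite rcons_cat.
  rewrite -[(zs ++ p) ++ q]catA.
  set A := ins _ _ _ _; set B := ins _ _ _ _; set u := <[_]>; rewrite /icoef pair_red.
  pose T2 := pair_eps z y *: ((-1) ^ (deg x - 1 + d * deg x + bdeg zs * (deg y - 1) + deg z) *: u).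
  pose T4 := pair_eps z one_l *: (eps (elt y) *:
    ((-1) ^ (deg x - 1 + d * deg x + bdeg zs * (deg y - 1) + deg z) *: u)).
  have E2 : T2 = pair_eps z y *: ((-1) ^ (d + m + deg a * bdeg zs + deg x * deg y) *: u).
    apply: pair_scale_eq => zx; rewrite /d /ideg -xy (_ : deg z = m - deg y); last by lia.
    by koszul.
  have E4 : T4 = pair_eps z one_l *: (eps (elt y) *:
      ((-1) ^ (d + bdeg zs * deg a + m) *: u)).
    apply: pair_scale_eq; rewrite deg_one addr0 => zm; apply: eps_scale_eq => y0.
    by rewrite /d /ideg zm (_ : deg x = deg a) ?y0; [koszul | lia].
  apply: (eq_comb (c := 1) E2); apply: (eq_comb (c := -1) E4).
  rewrite /T2 /T4 !degE !mulrBr !scalerBl -!cats1 -!catA /= -xy.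
  by koszul.
rewrite /icoef /d /ideg.
by koszul.
Qed.

(** [dot] is extended over its first argument with the second held fixed, so linearity in the second
    is read off an expansion of x into words. *)
Lemma dot_linear2 (x : ccw C) : linear (dot x).
Proof.
move=> c y y'; have [l ->] := words_spanned x.
have E u : dot (\sum_(p <- l) p.1 *: <[p.2]>) u =
    \sum_(p <- l) p.1 *: lin_ext (@dot_word K m C p.2) u.
  rewrite /dot linear_sum; apply: eq_bigr => p _; rewrite linearZ /=.
  by rewrite (lin_extE (dot_wordl_compat _)).
rewrite !E scaler_sumr -big_split /=; apply: eq_bigr => p _.
by rewrite linearP scalerDr !scalerA mulrC.
Qed.

Lemma dotDr x y y' : dot (C := C) x (y + y') = dot x y + dot x y'.
Proof. by have := dot_linear2 x 1 y y'; rewrite !scale1r. Qed.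

Lemma dotZr c x y : dot (C := C) x (c *: y) = c *: dot x y.
Proof.
have d0 : dot x 0 = 0 by have := dot_linear2 x (-1) 0 0; rewrite !scaleN1r oppr0 addr0 addNr.
by have := dot_linear2 x c y 0; rewrite d0 !addr0.
Qed.

Lemma dot0r x : dot (C := C) x 0 = 0.
Proof. by rewrite -[X in dot x X](scale0r (0 : ccw C)) dotZr scale0r. Qed.

(** For the head a, [rotins_core_cop] treats the splitting of a and [ins_core] the letters after it.
    The heads z a add up to the product of z[zs] with the rotations. Of the inner derivation only
    the half that places zs after p survives. *)
Lemma rotins_core z zs p q (d := ideg z zs) : reduced p ->
  bst (rotins z zs p q)
  + (-1) ^ d *: (Dop (fun r => rotins z zs r q) p
      + (-1) ^ bdeg p *: Dop (rotins z zs p) q)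
  + (-1) ^ m *: bwd (fun z zs => rotins z zs p q) z zs
  = t *: ((-1) ^ d *: ins z zs (fun r => <[one_l :: r ++ q]>) p
      + (-1) ^ m *: dot <[z :: zs]> (rot p q)
      + (-1) ^ (m + 1 + bdeg zs * (bdeg p + 1)) *: (pair_eps z one_l *: rot p (zs ++ q))).
Proof.
elim: p q => [|a p IHp] q.
  move=> _ /=; rewrite linear0 Dop0 dot0r /wdiff Dop0.
  rewrite (_ : csum _ z = 0); first by koszul.
  by rewrite /csum big1 // => u _; koszul.
case/andP=> /eqP a0 rp; have E1 := rotins_core_cop z zs p q a0.
have Fm : multilin (fun r => <[a :: r ++ q]>).
  by move=> pre post c x y w; rewrite -!catA; exact: (wd_multilin _ (a :: pre)).
have E2 := ins_core s t z zs Fm rp.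
have E3 := IHp (rcons q a) rp.
rewrite -/d in E1 E2 E3.
rewrite rotinsE -/d bstD !bstZ.
have -> : bst (ins z zs (fun r => <[a :: r ++ q]>) p) =
    s *: ins z zs (fun r => <[dif_l a :: r ++ q]>) p
    + (-1) ^ deg a *: (ins z zs (Dop (fun r => <[a :: r ++ q]>)) p
      + (-1) ^ (bdeg p + d) *: Dop (fun q' => ins z zs (fun r => <[a :: r ++ q']>) p) q)
    + t *: csum (fun x y => (-1) ^ deg x *:
      (ins z zs (fun r => <[x :: red_l y :: r ++ q]>) p
       - (-1) ^ ((deg y - 1) * (bdeg p + d + bdeg q)) *:
         ins z zs (fun r => <[x :: rcons (r ++ q) (red_l y)]>) p)) a.
  rewrite -(ins_linear _ _ _ _ (linearP bst)).
  rewrite (eq_ins z zs p (fun r => bst_wd s t a (r ++ q))) /wdiff !insD !insZ ins_csum.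
  congr (_ + _ *: _ + _ *: _).
    rewrite (eq_ins z zs p (fun r => Dop_cat s t (fun r' => <[a :: r']>) r q)) insD.
    by rewrite (ins_sg z zs (fun n => (-1) ^ n)) ins_Dop.
  apply: eq_csum => x y xy; rewrite insZ insD insN.
  rewrite (eq_ins z zs p (F := fun r => (-1) ^ ((deg y - 1) * bdeg (r ++ q)) *: _)
    (G := fun r => (-1) ^ ((deg y - 1) * (bdeg r + bdeg q)) *:
      <[x :: rcons (r ++ q) (red_l y)]>)); last by move=> r /=; rewrite bdeg_cat.
  rewrite (ins_sg z zs (fun n => (-1) ^ ((deg y - 1) * (n + bdeg q)))).
  by congr (_ *: (_ - (-1) ^ (_ * _) *: _)); rewrite -/d; lia.
rewrite DopE (eq_Dop s t p (fun r => rotinsE z zs a r q)).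
rewrite DopD DopZ (Dop_sg s t (fun n => (-1) ^ ((deg a - 1) * (n + bdeg q)))).
rewrite (eq_Dop s t q (rotinsE z zs a p)).
rewrite DopD DopZ (Dop_sg s t (fun n => (-1) ^ ((deg a - 1) * (bdeg p + n)))).
rewrite (eq_bwd s t _ _ (fun z zs => rotinsE z zs a p q)) bwdD bwdZ.
rewrite (bwd_sg s t (fun n => (-1) ^ ((n - m + 1) * deg a))).
rewrite [rot (a :: p) q]rotE dotDr dotZr dot_wd insE -/d.
rewrite [rot (a :: p) (zs ++ q)]rotE [rotins _ _ (dif_l a :: _) _]rotinsE -/d.
have E4 : ins z zs (fun r => <[one_l :: r ++ rcons q a]>) p =
    ins z zs (fun r => <[one_l :: rcons (r ++ q) a]>) p.
  by apply: eq_ins => r; rewrite rcons_cat.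
rewrite Dop_rcons {}E4 in E3; rewrite /= -!catA in E2; rewrite -!catA.
set P := <[a :: zs ++ p ++ q]>; set Q := <[a :: p ++ zs ++ q]>.
have E6 : pair_eps z one_l *: ((-1) ^ (d * deg a + deg a) *:
    ((-1) ^ m *: P - (-1) ^ (m + bdeg zs * bdeg p) *: Q)) =
  pair_eps z one_l *: ((-1) ^ (bdeg zs * deg a) *:
    ((-1) ^ m *: P - (-1) ^ (m + bdeg zs * bdeg p) *: Q)).
  apply: pair_scale_eq; rewrite deg_one addr0 /d /ideg => zm.
  by rewrite (_ : deg z = m) //; koszul.
apply: (eq_comb (c := t) E1).
apply: (eq_comb (c := (-1) ^ (d * deg a + deg a)) E2).
apply: (eq_comb (c := (-1) ^ ((deg a - 1) * (bdeg p + bdeg q))) E3).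
apply: (eq_comb (c := t) E6).
rewrite rcons_cat /dot_word !degE.
have dE : (-1) ^ ((deg z + bdeg zs - 1 - m + 1) * deg a) = (-1) ^ ((d - 1) * deg a) :> K.
  by congr (_ ^ (_ * _)); rewrite /d /ideg; lia.
rewrite dE.
by koszul.
Qed.

End RotIns.

(** * The differential of products of heads and of their traces *)

Section Products.
Variables (K : fieldType) (m : int) (C : openFrobenius K m).
Implicit Types (W : lmodType K).
Notation word := (seq (letter C)).
Notation "<[ w ]>" := (wd (unit_rel C) w) (format "<[ w ]>").
Variables s t : K.
Notation Dop := (Dop s t).
Notation bwd := (wdiff s t).

Lemma multilin_cons_llin W (F : word -> W) p : multilin F -> llin (fun x => F (red_l x :: p)).
Proof.
by move=> Fm; exact: (@llin_comp_red _ _ _ _ (fun x => F (x :: p)) (llin_multilin [::] p Fm)).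
Qed.

Lemma multilin_rcons_llin W (F : word -> W) p : multilin F -> llin (fun x => F (rcons p (red_l x))).
Proof.
move=> Fm; apply: (@llin_comp_red _ _ _ _ (fun x => F (rcons p x))) => c x y z.
by rewrite -!cats1; exact: (llin_multilin p [::] Fm).
Qed.

Lemma dif_mul_llin W (g : letter C -> W) c e : llin g ->
  g (dif_l (mul_l c e)) = (-1) ^ m *: (g (mul_l (dif_l c) e) + (-1) ^ deg c *: g (mul_l c (dif_l e))).
Proof.
move=> gl; rewrite (@llin_sum _ _ _ g [:: ((-1) ^ m, mul_l (dif_l c) e);
    ((-1) ^ m * (-1) ^ deg c, mul_l c (dif_l e))]) //.
- by rewrite big_cons big_seq1 /=; koszul.
- by move=> u; rewrite !inE => /orP[]/eqP-> /=; rewrite !degE; lia.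
rewrite big_cons big_seq1 /= !(dif_lP _).2 !(mul_lP _ _).2 !(dif_lP _).2.
by rewrite (dif_mul _ (letterP c)); koszul.
Qed.

Lemma bilin_sub W (f g : letter C -> letter C -> W) : bilin f -> bilin g ->
  bilin (fun x y => f x y - g x y).
Proof.
move=> [fr fl] [gr gl]; split=> b c x y z h; first by rewrite (fr _ _ _ _ _ h) (gr _ _ _ _ _ h); koszul.
by rewrite (fl _ _ _ _ _ h) (gl _ _ _ _ _ h); koszul.
Qed.

(** The Frobenius relation lets the coproduct of c e be taken on c or on e. It is taken on c in the
    terms that put the new letter next to p and on e in those that put it next to q. *)
Lemma prod_core W (H : letter C -> word -> word -> W) c p e q :
  (forall p q, llin (fun u => H u p q)) -> (forall u q, multilin (fun p => H u p q)) ->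
  (forall u p, multilin (H u p)) ->
  bwd (fun c p => (-1) ^ (deg e * bdeg p) *: H (mul_l c e) p q) c p
  + (-1) ^ (deg c + bdeg p) *:
    bwd (fun e q => (-1) ^ (deg e * bdeg p) *: H (mul_l c e) p q) e q
  = (-1) ^ (m + deg e * bdeg p) *: (s *: H (dif_l (mul_l c e)) p q
    + (-1) ^ (deg c + deg e - m) *: (Dop (fun r => H (mul_l c e) r q) p
       + (-1) ^ bdeg p *: Dop (H (mul_l c e) p) q)
    + t *: csum (fun u v => (-1) ^ deg u *:
        (H u (red_l v :: p) q - (-1) ^ ((deg v - 1) * bdeg p) *: H u (rcons p (red_l v)) q
         + (-1) ^ ((deg v - 1) * bdeg p) *:
           (H u p (red_l v :: q) - (-1) ^ ((deg v - 1) * bdeg q) *: H u p (rcons q (red_l v)))))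
        (mul_l c e)).
Proof.
move=> Hh Hp Hq; rewrite (dif_mul_llin _ _ (Hh p q)) /wdiff.
rewrite (Dop_sg s t (fun n => (-1) ^ (deg e * n))) DopZ !degE.
set A := csum _ c; set B := csum _ e; set M := csum _ (mul_l c e).
have -> : M = (-1) ^ (m + deg e * bdeg p) *: A
    + (-1) ^ (m + deg e * bdeg p + deg c + bdeg p) *: B; last by koszul.
have b1 : bilin (fun u v => (-1) ^ deg u *:
    (H u (red_l v :: p) q - (-1) ^ ((deg v - 1) * bdeg p) *: H u (rcons p (red_l v)) q)).
  apply: (bilin_signed (fun i _ => i)); apply: bilin_sub.
    by split=> b; [exact: (multilin_cons_llin p (Hp b q)) | exact: Hh].
  apply: (bilin_signed (fun _ j => (j - 1) * bdeg p)).
  by split=> b; [exact: (multilin_rcons_llin p (Hp b q)) | exact: Hh].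
have b2 : bilin (fun u v => (-1) ^ (deg u + (deg v - 1) * bdeg p) *:
           (H u p (red_l v :: q) - (-1) ^ ((deg v - 1) * bdeg q) *: H u p (rcons q (red_l v)))).
  apply: (bilin_signed (fun i j => i + (j - 1) * bdeg p)); apply: bilin_sub.
    by split=> b; [exact: (multilin_cons_llin q (Hq b p)) | exact: Hh].
  apply: (bilin_signed (fun _ j => (j - 1) * bdeg q)).
  by split=> b; [exact: (multilin_rcons_llin q (Hq b p)) | exact: Hh].
transitivity (csum (fun u v => (-1) ^ deg u *:
    (H u (red_l v :: p) q - (-1) ^ ((deg v - 1) * bdeg p) *: H u (rcons p (red_l v)) q))
    (mul_l c e) + csum (fun u v => (-1) ^ (deg u + (deg v - 1) * bdeg p) *:
           (H u p (red_l v :: q) - (-1) ^ ((deg v - 1) * bdeg q) *: H u p (rcons q (red_l v))))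
    (mul_l c e)).
  by rewrite -csumD; apply: eq_csum => u v _; koszul.
rewrite csum_mulr // csum_mull // /A /B -!csumZ; congr (_ + _).
  by apply: eq_csum => x y xy; rewrite !degE; koszul.
by apply: eq_csum => x y xy; rewrite !degE -xy; koszul.
Qed.

(** The counit removes one half of the split head; the other half, c again, ends up at the two ends
    of p. *)
Lemma eps_core W (G : word -> W) c p : multilin G ->
  bwd (fun c p => eps (elt c) *: G p) c p
  = eps (elt c) *: Dop G p
    + t *: (G (red_l c :: p) - (-1) ^ ((deg c - 1) * bdeg p) *: G (rcons p (red_l c))).
Proof.
move=> Gm; rewrite /wdiff eps_dif_l DopZ scale0r scaler0 add0r; congr (_ + _ *: _).
  by rewrite !scalerA mulrC -!scalerA; apply: eps_scale_eq => ->; koszul.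
have h1 := csum_counitl c (multilin_cons_llin p Gm).
have h2 := csum_counitl c (llin_signed (fun e => (e - 1) * bdeg p) (multilin_rcons_llin p Gm)).
rewrite -h1 -h2 -csumN -csumD; apply: eq_csum => x y _.
transitivity (eps (elt x) *: ((-1) ^ deg x *: (G (red_l y :: p)
   - (-1) ^ ((deg y - 1) * bdeg p) *: G (rcons p (red_l y))))); first by koszul.
by rewrite -scalerBr; apply: eps_scale_eq => ->; koszul.
Qed.

Lemma pair_core W (G : word -> word -> W) c p e q (n := deg c + deg e - m - 1)
    (a := red_l (mul_l c e)) :
  (forall q, multilin (G^~ q)) -> (forall p, multilin (G p)) ->
  bwd (fun c p => (-1) ^ (deg e * bdeg p) *: (pair_eps c e *: G p q)) c p
  + (-1) ^ (deg c + bdeg p) *: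
    bwd (fun e q => (-1) ^ (deg e * bdeg p) *: (pair_eps c e *: G p q)) e q
  = (-1) ^ (m + deg e * bdeg p) *:
    (pair_eps c e *: (Dop (G^~ q) p + (-1) ^ bdeg p *: Dop (G p) q)
     + t *: (G (a :: p) q - (-1) ^ (n * bdeg p) *: G (rcons p a) q
        + (-1) ^ (n * bdeg p) *: (G p (a :: q) - (-1) ^ (n * bdeg q) *: G p (rcons q a)))).
Proof.
move=> Gl Gr.
rewrite (prod_core (H := fun u p q => eps (elt u) *: G p q)) /=; first last.
- by move=> u p' pre post b x y z h; rewrite (Gr _ _ _ _ _ _ _ h); koszul.
- by move=> u q' pre post b x y z h; rewrite (Gl _ _ _ _ _ _ _ h); koszul.
- by move=> p' q' b x y z [_ _ ->]; rewrite linearP /= scalerDl scalerA.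
rewrite eps_dif_l !DopZ scale0r scaler0 add0r; congr (_ *: (_ + _ *: _)).
  rewrite -/(pair_eps c e); set D := Dop _ p; set E := Dop _ q.
  transitivity (pair_eps c e *: ((-1) ^ (deg c + deg e - m) *: (D + (-1) ^ bdeg p *: E))).
    by koszul.
  by apply: pair_scale_eq => ->; rewrite subrr expr0z scale1r.
have h1 := csum_counitl (mul_l c e) (multilin_cons_llin p (Gl q)).
have h2 := csum_counitl (mul_l c e)
  (llin_signed (fun e => (e - 1) * bdeg p) (multilin_rcons_llin p (Gl q))).
have h3 := csum_counitl (mul_l c e)
  (llin_signed (fun e => (e - 1) * bdeg p) (multilin_cons_llin q (Gr p))).
have h4 := csum_counitl (mul_l c e)
  (llin_signed (fun e => (e - 1) * bdeg p + (e - 1) * bdeg q) (multilin_rcons_llin q (Gr p))).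
rewrite !deg_mul -/n -/a in h2 h3 h4; rewrite -/a in h1.
transitivity (G (a :: p) q - (-1) ^ (n * bdeg p) *: G (rcons p a) q
  + (-1) ^ (n * bdeg p) *: G p (a :: q) - (-1) ^ (n * bdeg p + n * bdeg q) *: G p (rcons q a));
  last by koszul.
rewrite -h1 -h2 -h3 -h4 -!csumN -!csumD; apply: eq_csum => x y _.
set A := G _ _; set B := G _ _; set A' := G _ _; set B' := G _ _.
transitivity (eps (elt x) *: ((-1) ^ deg x *: 
  (A - (-1) ^ ((deg y - 1) * bdeg p) *: B
         + (-1) ^ ((deg y - 1) * bdeg p) *:
           (A' - (-1) ^ ((deg y - 1) * bdeg q) *: B')))); first by koszul.
transitivity (eps (elt x) *: 
  (A - (-1) ^ ((deg y - 1) * bdeg p) *: B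
         + (-1) ^ ((deg y - 1) * bdeg p) *:
           (A' - (-1) ^ ((deg y - 1) * bdeg q) *: B'))); last by koszul.
by apply: eps_scale_eq => ->; koszul.
Qed.

End Products.

(** * Homotopy identities on words *)

Section WordIdentities.
Variables (K : fieldType) (m : int) (C : openFrobenius K m).
Notation word := (seq (letter C)).
Notation "<[ w ]>" := (wd (unit_rel C) w) (format "<[ w ]>").
Variables s t : K.
Notation Dop := (Dop s t).
Notation bwd := (wdiff s t).
Notation bst := (@sdiff K m C s t).
Notation rot := (@rot K m C).
Notation rotins := (@rotins K m C).

(* Up to boundaries, iota makes the product commutative, circ x y is the part of
   B (x y) with head in x, theta z x y compares circ x (z y) with z (circ x y) and
   (iota z x) y, and theta1 z x compares circ x z with iota z x and z (B x). *)
Definition iotaw (z : letter C) (zs : word) (c : letter C) (p : word) : ccw C :=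
  (-1) ^ (ideg z zs * deg c) *: ins z zs (fun r => <[c :: r]>) p.
Definition circw (c : letter C) (p : word) (e : letter C) (q : word) : ccw C :=
  (-1) ^ (deg e * bdeg p) *: (pair_eps c e *: rot p q).
Definition thetaw (z : letter C) (zs : word) (c : letter C) (p : word)
    (e : letter C) (q : word) : ccw C :=
  (-1) ^ (deg e * bdeg p) *: (pair_eps c e *: rotins z zs p q).
Definition theta1w (z : letter C) (zs : word) (c : letter C) (p : word) : ccw C :=
  eps (elt c) *: rotins z zs p [::].
Definition connesw (c : letter C) (p : word) : ccw C := eps (elt c) *: rot p [::].

Lemma rot_multilinr p : multilin (rot p : word -> ccw C).
Proof.
elim: p => [|a p IHp] pre post c x y z h; first by rewrite /= scaler0 addr0.
rewrite !rotE.
have := wd_multilin (unit_rel C) (a :: p ++ pre) post h; rewrite /= -!catA => ->.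
have [dx dy _] := h.
by rewrite -!cats1 -!catA /= (IHp _ _ _ _ _ _ h) !degE dx dy; koszul.
Qed.

Lemma rot_multilinl q : multilin (rot^~ q).
Proof.
move=> pre; elim: pre q => [|a pre IHpre] q post c x y z h; have [dx dy _] := h.
  rewrite !cat0s !rotE (multilin_head _ (wd_multilin _) h) dx dy.
  rewrite -!cats1 (rot_multilinr post q [::] h); koszul.
rewrite !cat_cons !rotE (IHpre _ _ _ _ _ _ h) -!catA.
by rewrite (wd_multilin _ (a :: pre) _ h) !degE dx dy; koszul.
Qed.

Lemma rot_cat p q r : rot (p ++ q) r
  = rot p (q ++ r) + (-1) ^ (bdeg p * (bdeg q + bdeg r)) *: rot q (r ++ p) :> ccw C.
Proof.
elim: p r => [|a p IHp] r; first by rewrite /= degE mul0r expr0z scale1r add0r cats0.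
by rewrite cat_cons !rotE IHp !degE -!catA rcons_cat -cats1 -catA /=; koszul.
Qed.

Lemma rot_rcons p c q : rot (rcons p c) q
  = rot p (c :: q) + (-1) ^ (bdeg p * (deg c - 1 + bdeg q)) *: <[c :: q ++ p]> :> ccw C.
Proof. by rewrite -cats1 rot_cat rotE /= scaler0 addr0 degE bdeg_nil addr0. Qed.

(** [rot_core] with q empty treats the rotations. The two words that [eps_core] creates from the
    head are rotations of one another, so their images under [rot] cancel. *)
Lemma connes_core c p : bst (connesw c p) + bwd connesw c p = 0.
Proof.
rewrite /connesw bstZ eps_core; last exact: rot_multilinl.
have := rot_core s t p [::]; rewrite /= scaler0 addr0 !cats0 !degE mulr0 expr0z scale1r.
rewrite subrr scaler0 => E; apply: (eq_comb (c := eps (elt c)) E).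
rewrite /= rot_rcons /= !degE.
by koszul.
Qed.

Lemma circ_connes c p e q :
  (-1) ^ (deg e * bdeg p) *: connesw (mul_l c e) (p ++ q)
  = circw c p e q
    + (-1) ^ ((deg c + bdeg p) * (deg e + bdeg q) + m) *: circw e q c p.
Proof.
rewrite /connesw /circw rot_cat !cats0 [bdeg [::]]degE -/(pair_eps c e) (pair_comm e c).
by koszul.
Qed.

Lemma multilin_ins z zs (F : word -> ccw C) : multilin F -> multilin (ins z zs F).
Proof.
move=> Fm pre; elim: pre F Fm => [|a pre IHpre] F Fm post c x y w h; have [dx dy _] := h.
  rewrite !cat0s !insE /icoef (pair_linr z h) dx dy mulrDr scalerDl.
  by rewrite (eq_ins z zs post (fun r => multilin_head r Fm h)) insD insZ; koszul.
rewrite !cat_cons !insE (IHpre _ (multilin_cons a Fm) _ _ _ _ _ h).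
by rewrite !catA (Fm _ _ _ _ _ _ h); koszul.
Qed.

(** Moving the last letter c of p into q loses the terms in which c is contracted. Those with c as
    head are already 0, no letter of p following it. *)
Lemma rotins_rcons z zs p c q : 
  rotins z zs (rcons p c) q = rotins z zs p (c :: q)
  + (-1) ^ (ideg z zs * (bdeg p + 1)) *: (icoef z zs c *: rot p (zs ++ q)).
Proof.
elim: p q => [|a p IHp] q; first by rewrite /= !scaler0 !addr0.
rewrite rcons_cons !rotinsE IHp rotE -cats1 ins_cat /= scaler0 addr0.
have -> : ins z zs (fun r => <[a :: (r ++ [:: c]) ++ q]>) p = ins z zs (fun r => <[a :: r ++ c :: q]>) p.
  by apply: eq_ins => r; rewrite -catA.
rewrite !degE cats0 -!catA rcons_cat.
set u := <[_]>; set v := rot _ _; set I := ins _ _ _ _; set J := rotins _ _ _ _.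
have E : icoef z zs c *: ((-1) ^ (ideg z zs * (deg a + bdeg p)) *: u
   + (-1) ^ ((deg a - 1) * (bdeg p + (deg c - 1) + bdeg q) + ideg z zs * (bdeg p + 1)) *: v)
  = icoef z zs c *: ((-1) ^ (ideg z zs * (deg a + bdeg p)) *: 
     (u + (-1) ^ ((deg a - 1) * (bdeg p + (bdeg zs + bdeg q))) *: v)).
  by apply: icoef_eq => zc; rewrite /ideg (_ : deg z = m - deg c); [koszul | lia].
apply: (eq_comb (c := 1) E).
by koszul.
Qed.

Lemma multilin_cat_wd c q : multilin (fun r => <[c :: r ++ q]>).
Proof.
by move=> pre post b x y w h; rewrite -!catA; exact: (wd_multilin _ (c :: pre)).
Qed.

Lemma bst_ins z zs c p q (d := ideg z zs) :
  bst (ins z zs (fun r => <[c :: r ++ q]>) p) =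
    s *: ins z zs (fun r => <[dif_l c :: r ++ q]>) p
    + (-1) ^ deg c *: (ins z zs (Dop (fun r => <[c :: r ++ q]>)) p
      + (-1) ^ (bdeg p + d) *: Dop (fun q' => ins z zs (fun r => <[c :: r ++ q']>) p) q)
    + t *: csum (fun x y => (-1) ^ deg x *:
      (ins z zs (fun r => <[x :: red_l y :: r ++ q]>) p
       - (-1) ^ ((deg y - 1) * (bdeg p + d + bdeg q)) *:
         ins z zs (fun r => <[x :: rcons (r ++ q) (red_l y)]>) p)) c.
Proof.
rewrite -(ins_linear _ _ _ _ (linearP bst)).
rewrite (eq_ins z zs p (fun r => bst_wd s t c (r ++ q))) /wdiff !insD !insZ ins_csum.
congr (_ + _ *: _ + _ *: _).
  rewrite (eq_ins z zs p (fun r => Dop_cat s t (fun r' => <[c :: r']>) r q)) insD.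
  by rewrite (ins_sg z zs (fun n => (-1) ^ n)) ins_Dop.
apply: eq_csum => x y xy; rewrite insZ insD insN.
rewrite (eq_ins z zs p (F := fun r => (-1) ^ ((deg y - 1) * bdeg (r ++ q)) *: _)
    (G := fun r => (-1) ^ ((deg y - 1) * (bdeg r + bdeg q)) *:
      <[x :: rcons (r ++ q) (red_l y)]>)); last by move=> r /=; rewrite bdeg_cat.
rewrite (ins_sg z zs (fun n => (-1) ^ ((deg y - 1) * (n + bdeg q)))).
by congr (_ *: (_ - (-1) ^ (_ * _) *: _)); rewrite -/d; lia.
Qed.

(** Contracting one half of c with z leaves the head z c, and zs stands right after the head or at
    the end of the word: these are the words of the two products. *)
Lemma iota_core_cop z zs c p (d := ideg z zs) :
  csum (fun x y => (-1) ^ deg x *: (iotaw z zs x (red_l y :: p)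
     - (-1) ^ ((deg y - 1) * bdeg p) *: iotaw z zs x (rcons p (red_l y)))) c
  = (-1) ^ (d * deg c + d) *: csum (fun x y => (-1) ^ deg x *:
      (ins z zs (fun r => <[x :: red_l y :: r]>) p
       - (-1) ^ ((deg y - 1) * (bdeg p + d)) *:
         ins z zs (fun r => <[x :: rcons r (red_l y)]>) p)) c
  + (-1) ^ ((d + 1) * (deg c - m + deg z) + bdeg zs * (m - deg z - 1) + deg z
       + (deg c - m + deg z) * (m - deg z)) *:
     (<[mul_l z c :: zs ++ p]>
       - (-1) ^ ((m - deg z - 1 + d) * bdeg p) *: <[mul_l z c :: p ++ zs]>)
  - pair_eps z one_l *: ((-1) ^ ((d + 1) * deg c + bdeg zs + m) *: 
     (<[c :: zs ++ p]> - (-1) ^ ((d + 1) * bdeg p) *: <[c :: p ++ zs]>)).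
Proof.
have h1 := frob_left_swap z c (llin_wd [::] (zs ++ p)).
have h2 := frob_left_swap z c (llin_wd [::] (p ++ zs)).
have h3 := csum_counitr c (llin_wd [::] (zs ++ p)).
have h4 := csum_counitr c (llin_wd [::] (p ++ zs)).
rewrite /= in h1 h2 h3 h4; rewrite -h1 -h2 -h3 -h4.
rewrite -?csumN -?csumZ -?csumN -?csumD -?csumZ -?csumD -?csumZ -?csumN -?csumD.
apply: eq_csum => x y xy; rewrite /iotaw insE -cats1 ins_cat insE /= scaler0 !addr0.
have -> : ins z zs (fun r => <[x :: r ++ [:: red_l y]]>) p =
   ins z zs (fun r => <[x :: rcons r (red_l y)]>) p by apply: eq_ins => r; rewrite cats1.
rewrite cats0; set u := <[_]>; set A := ins _ _ _ _; set B := ins _ _ _ _; set v := <[_]>.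
pose w := (-1) ^ (deg x + d * deg x + bdeg zs * (deg y - 1) + deg z) *:
   (u - (-1) ^ ((deg y - 1) * bdeg p + d * bdeg p) *: v).
have E1 : pair_eps z y *: w = pair_eps z y *: ((-1) ^ (
   (d + 1) * (deg c - m + deg z) + bdeg zs * (m - deg z - 1) + deg z
       + (deg c - m + deg z) * (m - deg z) + deg x * deg y) *:
     (u - (-1) ^ ((m - deg z - 1 + d) * bdeg p) *: v)).
  apply: pair_scale_eq => zy; rewrite /w (_ : deg x = deg c - m + deg z); last by lia.
  by rewrite (_ : deg y = m - deg z); [koszul | lia].
have E2 : pair_eps z one_l *: (eps (elt y) *: w) = pair_eps z one_l *: (eps (elt y) *:
   ((-1) ^ ((d + 1) * deg c + bdeg zs + m) *: (u - (-1) ^ ((d + 1) * bdeg p) *: v))).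
  apply: pair_scale_eq; rewrite deg_one addr0 => zm; apply: eps_scale_eq => y0.
  by rewrite /w zm (_ : deg x = deg c) ?y0; [koszul | lia].
apply: (eq_comb (c := 1) E1); apply: (eq_comb (c := -1) E2).
rewrite /w /icoef pair_red !mulrBr !scalerBl !degE -xy.
by koszul.
Qed.

(** The inner derivation left by [ins_core] cancels against the terms with eps(z 1) of
    [iota_core_cop]; only the graded commutator remains. *)
Lemma iota_core z zs c p (d := ideg z zs) : reduced p ->
  bst (iotaw z zs c p) - (-1) ^ d *: bwd (iotaw z zs) c p
  + (-1) ^ m *: bwd (fun z zs => iotaw z zs c p) z zs
  = t *: ((-1) ^ m *: dot <[z :: zs]> <[c :: p]>
     - (-1) ^ ((deg z + bdeg zs) * (deg c + bdeg p)) *: dot <[c :: p]> <[z :: zs]>).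
Proof.
move=> rp; have /= E1 := iota_core_cop z zs c p; rewrite -/d in E1.
have E2 := ins_core s t z zs (multilin_cons c (wd_multilin (unit_rel C))) rp.
have cs x : (fun r => <[x :: r ++ [::]]>) = (fun r => <[x :: r]>).
  by apply/funext => r; rewrite cats0.
have E3 : bst (ins z zs (fun r => <[c :: r]>) p) =
    s *: ins z zs (fun r => <[dif_l c :: r]>) p
    + (-1) ^ deg c *: ins z zs (Dop (fun r => <[c :: r]>)) p
    + t *: csum (fun x y => (-1) ^ deg x *:
      (ins z zs (fun r => <[x :: red_l y :: r]>) p
       - (-1) ^ ((deg y - 1) * (bdeg p + d)) *:
         ins z zs (fun r => <[x :: rcons r (red_l y)]>) p)) c.
  rewrite -[in LHS](cs c) bst_ins !cs /= scaler0 addr0; congr (_ + _ + _ *: _).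
  apply: eq_csum => x y _; rewrite bdeg_nil addr0.
  congr (_ *: (_ - _ *: _)); apply: eq_ins => r; by rewrite cats0.
rewrite -/d in E2.
have -> : bwd (fun z0 zs0 => iotaw z0 zs0 c p) z zs =
    (-1) ^ ((d - 1) * deg c) *: bwd (fun z zs => ins z zs (fun r => <[c :: r]>) p) z zs.
  rewrite (bwd_sg s t (fun n => (-1) ^ ((n - m + 1) * deg c))).
  by congr ((-1) ^ (_ * _) *: _); rewrite /d /ideg; lia.
rewrite {1}/iotaw -/d bstZ E3 {1}/wdiff E1 {2}/iotaw DopZ -/d !dot_wd /=.
rewrite [iotaw _ _ (dif_l c) _]/iotaw -/d.
rewrite (@llin_mul_comm _ _ _ _ (fun x => <[x :: p ++ zs]>) c z (llin_wd [::] _)).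
have E6 : pair_eps z one_l *: ((-1) ^ (d + (d + 1) * deg c + bdeg zs + m + 1) *:
    (<[c :: zs ++ p]> - (-1) ^ ((d + 1) * bdeg p) *: <[c :: p ++ zs]>)) =
  pair_eps z one_l *: ((-1) ^ (d * deg c + deg c) *: ((-1) ^ m *: <[c :: zs ++ p]>
    - (-1) ^ (m + bdeg zs * bdeg p) *: <[c :: p ++ zs]>)).
  apply: pair_scale_eq; rewrite deg_one addr0 /d /ideg => zm.
  by rewrite (_ : deg z = m) //; koszul.
apply: (eq_comb (c := (-1) ^ (d * deg c + deg c)) E2).
apply: (eq_comb (c := - t) E6).
rewrite deg_dif /d /ideg; move: (bwd _ z zs) (Dop _ p) => M D.
by koszul.
Qed.

Lemma rotins_multilinr z zs p : multilin (rotins z zs p).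
Proof.
elim: p => [|a p IHp] pre post c x y w h; have [dx dy _] := h.
  by rewrite /= scaler0 addr0.
rewrite !rotinsE -!cats1 -!catA /= (IHp _ _ _ _ _ _ h) !degE dx dy.
have E r : <[a :: r ++ pre ++ w :: post]> =
    c *: <[a :: r ++ pre ++ x :: post]> + <[a :: r ++ pre ++ y :: post]>.
  by have := wd_multilin (unit_rel C) (a :: r ++ pre) post h; rewrite /= -!catA.
by rewrite (eq_ins z zs p E) insD insZ; koszul.
Qed.

Lemma rotins_multilinl z zs q : multilin (rotins z zs ^~ q).
Proof.
move=> pre; elim: pre q => [|a pre IHpre] q post c x y w h; have [dx dy _] := h.
  rewrite !cat0s !rotinsE dx dy -!cats1 (rotins_multilinr z zs post q [::] h).
  rewrite (eq_ins z zs post (fun r => multilin_head (r ++ q) (wd_multilin (unit_rel C)) h)).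
  by rewrite insD insZ; koszul.
rewrite !cat_cons !rotinsE (IHpre _ _ _ _ _ _ h) !degE dx dy.
by rewrite (multilin_ins z zs (multilin_cat_wd a q) _ _ h); koszul.
Qed.

Lemma ins_head_red z zs c p q : ins z zs (fun r => <[red_l c :: r ++ q]>) p =
  ins z zs (fun r => <[c :: r ++ q]>) p - eps (elt c) *: ins z zs (fun r => <[one_l :: r ++ q]>) p.
Proof.
rewrite -insZ -insN -insD; apply: eq_ins => r; exact: wd_head_red.
Qed.

(** [rotins_core] with q empty, under the counit. The letter c that [eps_core] puts at the front of
    p becomes the head and yields iota; at the end of p it is contracted with z, by [rotins_rcons],
    and yields circ. *)
Lemma theta1_core z zs c p (d := ideg z zs) : reduced p ->
  bst (theta1w z zs c p) + (-1) ^ d *: bwd (theta1w z zs) c p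
  + (-1) ^ m *: bwd (fun z zs => theta1w z zs c p) z zs
  = t *: ((-1) ^ d *: iotaw z zs c p + (-1) ^ m *: dot <[z :: zs]> (connesw c p)
     + (-1) ^ (m + 1 + (deg z + bdeg zs) * (deg c + bdeg p + 1)) *: circw c p z zs).
Proof.
move=> rp; rewrite /theta1w bstZ bwdZ eps_core; last exact: rotins_multilinl.
have := rotins_core s t z zs [::] rp; rewrite -/d /= scaler0 addr0 => E1.
rewrite /= rotins_rcons ins_head_red /iotaw /connesw /circw dotZr -/d.
have cs x : (fun r => <[x :: r ++ [::]]>) = (fun r => <[x :: r]>).
  by apply/funext => r; rewrite cats0.
rewrite !cs in E1 *; rewrite /icoef pair_red deg_red /= !cats0 in E1 *.
set u := rot p zs in E1 *; set I := ins _ _ _ _; set I1 := ins _ _ _ _ in E1 *.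
rewrite pair_comm.
have Ea : eps (elt c) *: ((-1) ^ (d * deg c) *: I1) = eps (elt c) *: I1.
  by apply: eps_scale_eq => ->; koszul.
have Eb : pair_eps z one_l *: (eps (elt c) *: ((-1) ^ (d + (deg c - 1) * bdeg p
      + d * (bdeg p + 1) + bdeg zs * (deg c - 1) + deg z) *: u)) =
    pair_eps z one_l *: (eps (elt c) *: ((-1) ^ (m + bdeg zs * (bdeg p + 1)) *: u)).
  apply: pair_scale_eq; rewrite deg_one addr0 /d /ideg => zm; apply: eps_scale_eq => ->.
  by rewrite zm; koszul.
have Ec : pair_eps c z *: ((-1) ^ (d + (deg c - 1) * bdeg p
      + d * (bdeg p + 1) + bdeg zs * (deg c - 1) + deg z + deg z * deg c) *: u) =
    pair_eps c z *: ((-1) ^ ((deg z + bdeg zs) * (deg c + bdeg p + 1) + deg z * bdeg p) *: u).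
  by apply: pair_scale_eq => cz; rewrite /d /ideg (_ : deg z = m - deg c); [koszul | lia].
apply: (eq_comb (c := eps (elt c)) E1); apply: (eq_comb (c := - t * (-1) ^ d) Ea).
apply: (eq_comb (c := t) Eb); apply: (eq_comb (c := - t * (-1) ^ m) Ec).
by rewrite /= bdeg_nil !mulrBr !scalerBl; koszul.
Qed.

End WordIdentities.

(** * The homotopy with three arguments *)

Section ThetaIdentity.
Variables (K : fieldType) (m : int) (C : openFrobenius K m).
Notation "<[ w ]>" := (wd (unit_rel C) w) (format "<[ w ]>").
Variables s t : K.
Notation bwd := (wdiff s t).
Notation bst := (@sdiff K m C s t).
Notation rot := (@rot K m C).

Lemma pair_mulA (x y w : letter C) :
  pair_eps (mul_l x y) w = (-1) ^ (m * deg x + m) * pair_eps x (mul_l y w) :> K.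
Proof.
rewrite /pair_eps !(mul_lP _ _).2 (mul_assoc _ _ (letterP x)).
by rewrite linearZ.
Qed.

(** Up to sign, eps of a triple product is symmetric. In [theta_core] this turns the contraction of
    z with c e into the pairing of c with z e that defines circ. *)
Lemma pair_mulCA (c z e : letter C) : pair_eps c (mul_l z e)
  = (-1) ^ (m * deg c + deg c * deg z + m * deg z + m) * pair_eps z (mul_l c e) :> K.
Proof.
have -> : pair_eps z (mul_l c e) = (-1) ^ (m * deg z + m) * pair_eps (mul_l z c) e.
  rewrite pair_mulA mulrA -[LHS]mul1r; congr (_ * _).
  by rewrite -expfzDr ?oppr_eq0 ?oner_neq0 // exprz_parity parityD addbb.
have -> : pair_eps (mul_l z c) e = (-1) ^ (deg z * deg c + m) * pair_eps (mul_l c z) e.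
  have h : llin (fun x => pair_eps x e : K^o) by move=> b x y w; exact: pair_linl.
  exact: (llin_mul_comm z c h).
rewrite pair_mulA -[LHS]mul1r !mulrA; congr (_ * _).
rewrite -!expfzDr ?oppr_eq0 ?oner_neq0 // exprz_parity !parityD !parityM.
by case: (parity m); case: (parity (deg c)); case: (parity (deg z)).
Qed.

Lemma dot_linear1 (y : ccw C) : linear (fun x => dot x y).
Proof. exact: dot_linl. Qed.

Lemma dot_iotal z zs c p e q :
  dot (iotaw z zs c p) <[e :: q]> = (-1) ^ (ideg z zs * deg c + deg e * (bdeg p + ideg z zs)) *:
    ins z zs (fun r => <[mul_l c e :: r ++ q]>) p.
Proof.
have := ins_linear z zs (fun r => (-1) ^ (ideg z zs * deg c) *: <[c :: r]>) p (dot_linear1 <[e :: q]>).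
rewrite insZ -/(iotaw z zs c p) => <-.
rewrite (eq_ins z zs p (G := fun r => (-1) ^ (deg e * bdeg r) *:
    ((-1) ^ (ideg z zs * deg c) *: <[mul_l c e :: r ++ q]>))).
  by rewrite (ins_sg z zs (fun n => (-1) ^ (deg e * n))) insZ; koszul.
move=> r; have /= := dot_linear1 <[e :: q]> ((-1) ^ (ideg z zs * deg c)) <[c :: r]> 0.
have -> : dot 0 <[e :: q]> = 0 :> ccw C by rewrite /dot linear0.
by rewrite !addr0 => ->; rewrite dot_wd /=; koszul.
Qed.

Lemma dot_iotar z zs c p e q :
  dot <[c :: p]> (iotaw z zs e q) = (-1) ^ (ideg z zs * deg e + deg e * bdeg p) *:
    ins z zs (fun r => <[mul_l c e :: p ++ r]>) q.
Proof.
rewrite /iotaw dotZr -(ins_linear _ _ _ _ (dot_linear2 <[c :: p]>)).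
rewrite (eq_ins z zs q (fun r => dot_wd (c :: p) (e :: r))) insZ.
by koszul.
Qed.

(** The argument of [theta1_core] with c e in place of c and eps(c e) in place of eps(c): at the
    front of p the letter c e gives the head of (iota z x) y, at the end of p it is contracted with
    z and gives circ x (z y). *)
Lemma theta_core z zs c p e q (d := ideg z zs) (Z := deg z + bdeg zs) (X := deg c + bdeg p) :
  reduced p ->
  bst (thetaw z zs c p e q)
  + (-1) ^ (d + m) *: (bwd (fun c p => thetaw z zs c p e q) c p
      + (-1) ^ X *: bwd (fun e q => thetaw z zs c p e q) e q)
  + (-1) ^ m *: bwd (fun z zs => thetaw z zs c p e q) z zs
  = t *: ((-1) ^ ((m + 1) * (Z + 1)) *: dot (iotaw z zs c p) <[e :: q]>
     + (-1) ^ m *: dot <[z :: zs]> (circw c p e q)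
     + (-1) ^ (m + 1 + (Z + m) * (X + m + 1) + deg e * bdeg zs) *:
         circw c p (mul_l z e) (zs ++ q)).
Proof.
move=> rp; rewrite /thetaw pair_core;
  [| exact: rotins_multilinl | exact: rotins_multilinr].
rewrite !bstZ !bwdZ.
have := rotins_core s t z zs q rp; rewrite -/d => E1.
rewrite /= rotins_rcons ins_head_red dot_iotal /circw !dotZr -/d.
rewrite /icoef pair_red deg_red deg_mul pair_mulCA.
set u := rot p (zs ++ q); set I := ins _ _ _ _; set I1 := ins _ _ _ _ in E1 *.
rewrite -/(pair_eps c e).
have Ea : pair_eps c e *: ((-1) ^ (d * (deg c + deg e - m)) *: I1) = pair_eps c e *: I1.
  by apply: pair_scale_eq => ->; koszul.
have Eb : pair_eps z one_l *: (pair_eps c e *: ((-1) ^ (d + (deg c + deg e - m - 1) * bdeg p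
      + d * (bdeg p + 1) + bdeg zs * (deg c + deg e - m - 1) + deg z) *: u)) =
    pair_eps z one_l *: (pair_eps c e *: ((-1) ^ (m + bdeg zs * (bdeg p + 1)) *: u)).
  apply: pair_scale_eq; rewrite deg_one addr0 /d /ideg => zm; apply: pair_scale_eq => ce.
  by rewrite zm (_ : deg c = m - deg e); [koszul | lia].
have Ec : pair_eps c (mul_l z e) *: ((-1) ^ (d + deg e * bdeg p
      + (deg c + deg e - m - 1) * bdeg p + d * (bdeg p + 1)
      + bdeg zs * (deg c + deg e - m - 1) + deg z + m * deg z + deg z * deg c + m * deg c + m) *: u) =
    pair_eps c (mul_l z e) *: ((-1) ^ ((Z + m) * (X + m + 1) + deg e * bdeg zs + m
      + (deg z + deg e - m) * bdeg p) *: u).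
  apply: pair_scale_eq; rewrite deg_mul => cze; rewrite /d /ideg /Z /X.
  by rewrite (_ : deg e = m + m - deg c - deg z); [koszul | lia].
apply: (eq_comb (c := (-1) ^ (deg e * bdeg p) * pair_eps c e) E1).
apply: (eq_comb (c := - t * (-1) ^ (d + deg e * bdeg p)) Ea).
apply: (eq_comb (c := t * (-1) ^ (deg e * bdeg p)) Eb); apply: (eq_comb (c := - t) Ec).
rewrite deg_mul /d /ideg /Z /X !mulrBr !scalerBl.
by koszul.
Qed.

End ThetaIdentity.

(** * Operations on Hochschild chains *)

Section Extension.
Variables (K : fieldType) (m : int) (C : openFrobenius K m).
Implicit Types (W : lmodType K).
Notation word := (seq (letter C)).
Notation "<[ w ]>" := (wd (unit_rel C) w) (format "<[ w ]>").
Variables s t : K.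
Notation Dop := (Dop s t).
Notation bwd := (wdiff s t).

Definition good W (f : letter C -> word -> W) : Prop :=
  (forall p, llin (f^~ p)) /\ (forall c, multilin (f c)).

(* Tail letters are reduced first, so that the extension only needs multilinearity. *)
Definition wfun W (f : letter C -> word -> W) (w : word) : W :=
  if w is c :: p then f c (map (@red_l K m C) p) else 0.

Definition lext W (f : letter C -> word -> W) : {linear ccw C -> W} := lin_ext (wfun f).

Lemma red_reduced p : reduced (map (@red_l K m C) p).
Proof. by elim: p => //= a p ->; rewrite eps_red eqxx. Qed.

Lemma map_red_id p : reduced p -> map (@red_l K m C) p = p.
Proof. by elim: p => //= a p IHp /andP[/eqP/red_id-> /IHp->]. Qed.

Lemma wd_map_red c p : <[c :: map (@red_l K m C) p]> = <[c :: p]>.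
Proof.
suff E pre : <[c :: pre ++ map (@red_l K m C) p]> = <[c :: pre ++ p]> by exact: (E [::]).
elim: p pre => // a p IHp pre /=.
rewrite wd_red -cat_rcons IHp cat_rcons //.
Qed.

Lemma lext_wd W (f : letter C -> word -> W) c p : good f ->
  lext f <[c :: p]> = f c (map (@red_l K m C) p).
Proof.
move=> [fh ft]; rewrite /lext lin_extE //; apply: compatible_unit.
  move=> [|b pre] post a x y z h /=; first exact: fh.
  by rewrite !map_cat /=; apply: ft; exact: red_l_lcomb.
move=> a pre post u u1 /=; rewrite map_cat /=.
apply: (llin0 (llin_multilin _ _ (ft a))).
by rewrite (red_lP u).2 u1 eps_one scale1r subrr.
Qed.

Lemma lext_red W (f : letter C -> word -> W) c p : good f -> reduced p ->
  lext f <[c :: p]> = f c p.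
Proof. by move=> fg rp; rewrite lext_wd // map_red_id. Qed.

Lemma eq_Dop_red W (F G : word -> W) p : (forall r, reduced r -> F r = G r) -> reduced p ->
  Dop F p = Dop G p.
Proof.
elim: p F G => //= a p IHp F G FG /andP[a0 rp].
rewrite FG /=; last by rewrite eps_dif_l eqxx rp.
rewrite (IHp _ (fun r => G (a :: r))) //; last by move=> r rr; apply: FG; rewrite /= a0.
congr (_ + _ *: _ + _); apply: eq_csum => x y _; rewrite FG //=.
by rewrite !eps_red eqxx.
Qed.

Lemma reduced_rcons p (a : letter C) : reduced (rcons p a) = reduced p && (eps (elt a) == 0).
Proof. by rewrite /reduced all_rcons andbC. Qed.

(** The differential of a reduced word involves reduced words only, so functionals have to be known
    on these alone. *)
Lemma eq_bwd_red W (f g : letter C -> word -> W) c p :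
  (forall c r, reduced r -> f c r = g c r) -> reduced p -> bwd f c p = bwd g c p.
Proof.
move=> fg rp; rewrite /wdiff fg // (eq_Dop_red (fg c)) //.
congr (_ + _ *: _); apply: eq_csum => x y _; rewrite !fg //.
  by rewrite reduced_rcons rp eps_red eqxx.
by rewrite /= eps_red eqxx.
Qed.

Lemma ccw_ext W (g h : ccw C -> W) : linear g -> linear h ->
  g 0 = 0 -> h 0 = 0 -> g <[[::]]> = h <[[::]]> ->
  (forall c p, reduced p -> g <[c :: p]> = h <[c :: p]>) -> g =1 h.
Proof.
move=> gl hl g0 h0 gnil gh x; have [l ->] := words_spanned x.
elim: l => [|[a w] l IHl]; first by rewrite big_nil g0 h0.
rewrite big_cons gl hl IHl; congr (_ *: _ + _); case: w => //= c p.
by rewrite -wd_map_red gh // red_reduced.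
Qed.

Lemma lext_nil W (f : letter C -> word -> W) : good f -> lext f <[[::]]> = 0.
Proof.
move=> [fh ft]; rewrite /lext lin_extE //; apply: compatible_unit.
  move=> [|b pre] post a x y z h /=; first exact: fh.
  by rewrite !map_cat /=; apply: ft; exact: red_l_lcomb.
move=> a pre post u u1 /=; rewrite map_cat /=.
apply: (llin0 (llin_multilin _ _ (ft a))).
by rewrite (red_lP u).2 u1 eps_one scale1r subrr.
Qed.

Lemma lext_comb W c (f1 f2 f3 : letter C -> word -> W) : good f1 -> good f2 -> good f3 ->
  (forall b p, f3 b p = c *: f1 b p + f2 b p) ->
  forall y, lext f3 y = c *: lext f1 y + lext f2 y.
Proof.
move=> g1 g2 g3 E; apply: ccw_ext.
- by move=> a x y; rewrite linearP.
- move=> a x y; rewrite (linearP (lext f1)) (linearP (lext f2)).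
  by rewrite !scalerDr !scalerA mulrC addrACA.
- by rewrite linear0.
- by rewrite !linear0 addr0.
- by rewrite !lext_nil // scaler0 addr0.
by move=> b p rp; rewrite !lext_red.
Qed.

Definition good2 W (f : letter C -> word -> letter C -> word -> W) : Prop :=
  (forall c p, good (f c p)) /\ (forall e q, good (fun c p => f c p e q)).

(** Currying: functions on [ccw C] form a module, so the extension over the first word takes values
    in extensions over the second. *)
Definition bext W (f : letter C -> word -> letter C -> word -> W) (x y : ccw C) : W :=
  lext (fun c p => lext (f c p) : ccw C -> W) x y.

Lemma good_lext W (f : letter C -> word -> letter C -> word -> W) : good2 f ->
  good (fun c p => lext (f c p) : ccw C -> W).
Proof.
move=> [f1 f2]; split=> [p|c] /=.
  by move=> b x y z h; apply/funext => u; apply: lext_comb => // e q; exact: (f2 e q).1.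
by move=> pre post b x y z h; apply/funext => u; apply: lext_comb => // e q; exact: (f2 e q).2.
Qed.

Lemma bext_red W (f : letter C -> word -> letter C -> word -> W) c p y : good2 f ->
  reduced p -> bext f <[c :: p]> y = lext (f c p) y.
Proof. by move=> fg rp; rewrite /bext lext_red //; exact: good_lext. Qed.

Lemma bext_linear1 W (f : letter C -> word -> letter C -> word -> W) y :
  linear (fun x => bext f x y).
Proof. by move=> a x x'; rewrite /bext linearP. Qed.

Lemma bext_linear2 W (f : letter C -> word -> letter C -> word -> W) x : good2 f ->
  linear (bext f x).
Proof.
move=> fg a y y'; have [l ->] := words_spanned x.
have B0 u : bext f 0 u = 0 by rewrite /bext linear0.
elim: l => [|[b w] l IHl]; first by rewrite big_nil !B0 scaler0 addr0.
rewrite big_cons !bext_linear1 {}IHl /=.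
have -> : bext f <[w]> (a *: y + y') = a *: bext f <[w]> y + bext f <[w]> y'.
  case: w => [|c p]; first by rewrite /bext !lext_nil ?scaler0 ?addr0 //; exact: good_lext.
  by rewrite -wd_map_red !bext_red ?red_reduced // linearP.
by rewrite !scalerDr !scalerA mulrC addrACA.
Qed.

Definition good3 W (f : letter C -> word -> letter C -> word -> letter C -> word -> W) : Prop :=
  (forall z zs, good2 (f z zs)) /\
  (forall c p e q, good (fun z zs => f z zs c p e q)).

Definition text W (f : letter C -> word -> letter C -> word -> letter C -> word -> W)
    (z x y : ccw C) : W :=
  lext (fun z zs => bext (f z zs) : ccw C -> ccw C -> W) z x y.

Lemma bext_comb W b (f1 f2 f3 : letter C -> word -> letter C -> word -> W) :
  good2 f1 -> good2 f2 -> good2 f3 ->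
  (forall c p e q, f3 c p e q = b *: f1 c p e q + f2 c p e q) ->
  forall x y, bext f3 x y = b *: bext f1 x y + bext f2 x y.
Proof.
move=> g1 g2 g3 E x y.
have /(congr1 (fun g => g y)) // : bext f3 x = b *: bext f1 x + bext f2 x.
apply: lext_comb; try exact: good_lext.
by move=> c p; apply/funext => u; apply: lext_comb; [exact: g1.1|exact: g2.1|exact: g3.1|].
Qed.

Lemma good_bext W (f : letter C -> word -> letter C -> word -> letter C -> word -> W) :
  good3 f -> good (fun z zs => bext (f z zs) : ccw C -> ccw C -> W).
Proof.
move=> [f1 f2]; split=> [p|c] /=.
  move=> b x y z h; apply/funext => u; apply/funext => v.
  by apply: bext_comb => // e q e' q'; exact: (f2 e q e' q').1.
move=> pre post b x y z h; apply/funext => u; apply/funext => v.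
by apply: bext_comb => // e q e' q'; exact: (f2 e q e' q').2.
Qed.

Lemma text_red W (f : letter C -> word -> letter C -> word -> letter C -> word -> W) z zs x y :
  good3 f -> reduced zs -> text f <[z :: zs]> x y = bext (f z zs) x y.
Proof. by move=> fg rp; rewrite /text lext_red //; exact: good_bext. Qed.

Lemma text_linear1 W (f : letter C -> word -> letter C -> word -> letter C -> word -> W) x y :
  linear (fun z => text f z x y).
Proof. by move=> a z z'; rewrite /text linearP. Qed.

(** With one expansion of z fixed for all x and y, linearity in the later arguments reduces to that
    of [bext]. *)
Lemma text_spanned W (f : letter C -> word -> letter C -> word -> letter C -> word -> W) z :
  good3 f -> exists l : seq (K * (letter C * word)),
  forall x y, text f z x y = \sum_(p <- l) p.1 *: bext (f p.2.1 p.2.2) x y.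
Proof.
move=> fg; have [l ->] := words_spanned z.
elim: l => [|[b w] l [l' IHl]].
  by exists [::] => x y; rewrite !big_nil /text linear0.
case: w => [|c p].
  exists l' => x y; rewrite big_cons text_linear1 IHl /text lext_nil ?scaler0 ?add0r //.
  exact: good_bext.
exists ((b, (c, map (@red_l K m C) p)) :: l') => x y.
by rewrite !big_cons text_linear1 IHl -wd_map_red text_red // red_reduced.
Qed.

Lemma text_linear2 W (f : letter C -> word -> letter C -> word -> letter C -> word -> W) z y :
  good3 f -> linear (fun x => text f z x y).
Proof.
move=> fg a x x'; have [l E] := text_spanned z fg; rewrite !E scaler_sumr -big_split.
by apply: eq_bigr => p _; rewrite bext_linear1 scalerDr !scalerA mulrC.
Qed.

Lemma text_linear3 W (f : letter C -> word -> letter C -> word -> letter C -> word -> W) z x :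
  good3 f -> linear (text f z x).
Proof.
move=> fg a y y'; have [l E] := text_spanned z fg; rewrite !E scaler_sumr -big_split.
apply: eq_bigr => p _; rewrite bext_linear2 ?scalerDr ?scalerA ?[_ * a]mulrC //.
exact: fg.1.
Qed.

End Extension.

(** * The operations as multilinear maps *)

Section Chains.
Variables (K : fieldType) (m : int) (C : openFrobenius K m).
Implicit Types (W : lmodType K).
Notation word := (seq (letter C)).
Notation "<[ w ]>" := (wd (unit_rel C) w) (format "<[ w ]>").
Variables s t : K.
Notation rot := (@rot K m C).
Notation rotins := (@rotins K m C).

Definition iota_op := bext (@iotaw K m C).
Definition circ_op := bext (@circw K m C).
Definition theta_op := text (@thetaw K m C).
Definition theta1_op := bext (@theta1w K m C).

Lemma llin_ins_insert W zs (F : word -> W) p : llin (fun z => ins z zs F p).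
Proof.
elim: p F => [|a p IHp] F c x y z h; first by rewrite scaler0 addr0.
have [dx dy _] := h; rewrite !insE (IHp _ _ _ _ _ h) /icoef (pair_linl a h) /ideg dx dy.
by rewrite mulrDr scalerDl; koszul.
Qed.

Lemma multilin_ins_insert W z (F : word -> W) p : multilin F -> multilin (fun zs => ins z zs F p).
Proof.
elim: p F => [|a p IHp] F Fm pre post c x y w h; first by rewrite scaler0 addr0.
have [dx dy _] := h; rewrite !insE (IHp _ (multilin_cons a Fm) _ _ _ _ _ _ h).
by rewrite -!catA /= (Fm _ _ _ _ _ _ h) /icoef /ideg !degE dx dy; koszul.
Qed.

Lemma llin_rotins zs p q : llin (fun z => rotins z zs p q).
Proof.
elim: p q => [|a p IHp] q c x y z h; first by rewrite scaler0 addr0.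
have [dx dy _] := h; rewrite !rotinsE (IHp _ _ _ _ _ h) (llin_ins_insert _ _ _ h) /ideg dx dy.
by koszul.
Qed.

Lemma multilin_rotins z p q : multilin (fun zs => rotins z zs p q).
Proof.
elim: p q => [|a p IHp] q pre post c x y w h; first by rewrite scaler0 addr0.
have [dx dy _] := h; rewrite !rotinsE (IHp _ _ _ _ _ _ _ h).
rewrite (multilin_ins_insert z p (multilin_cat_wd a q) _ _ h) /ideg !degE dx dy.
by koszul.
Qed.

Lemma good2_iotaw : good2 (@iotaw K m C).
Proof.
split=> [z zs|c p]; split=> [q|b].
- apply: (llin_signed (fun e => ideg z zs * e)); apply: llin_ins => r; exact: (llin_wd [::]).
- move=> pre post a x y w h; rewrite /iotaw.
  by rewrite (multilin_ins z zs (multilin_cons b (wd_multilin (unit_rel C))) _ _ h); koszul.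
- move=> a x y w h; have [dx dy _] := h.
  by rewrite /iotaw (llin_ins_insert _ _ _ h) /ideg dx dy; koszul.
move=> pre post a x y w h; have [dx dy _] := h; rewrite /iotaw.
rewrite (multilin_ins_insert b p (multilin_cons c (wd_multilin (unit_rel C))) _ _ h).
by rewrite /ideg !degE dx dy; koszul.
Qed.

Lemma good2_circw : good2 (@circw K m C).
Proof.
split=> [c p|e q]; split=> [r|b].
- move=> a x y w h; have [dx dy _] := h.
  by rewrite /circw (pair_linr _ h) dx dy scalerDl; koszul.
- move=> pre post a x y w h; rewrite /circw.
  by rewrite (rot_multilinr _ _ _ h); koszul.
- move=> a x y w h; have [dx dy _] := h.
  by rewrite /circw (pair_linl _ h) scalerDl; koszul.
move=> pre post a x y w h; have [dx dy _] := h; rewrite /circw.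
by rewrite (rot_multilinl _ _ _ h) !degE dx dy; koszul.
Qed.

Lemma good2_theta1w : good2 (@theta1w K m C).
Proof.
split=> [z zs|c p]; split=> [q|b].
- by move=> a x y w [_ _ E]; rewrite /theta1w E linearP scalerDl scalerA.
- move=> pre post a x y w h; rewrite /theta1w.
  by rewrite (rotins_multilinl _ _ _ _ _ h); koszul.
- by move=> a x y w h; rewrite /theta1w (llin_rotins _ _ _ h); koszul.
by move=> pre post a x y w h; rewrite /theta1w (multilin_rotins _ _ _ _ _ h); koszul.
Qed.

Lemma good3_thetaw : good3 (@thetaw K m C).
Proof.
split=> [z zs|c p e q]; last first.
  split=> [r|b].
    by move=> a x y w h; rewrite /thetaw (llin_rotins _ _ _ h); koszul.
  by move=> pre post a x y w h; rewrite /thetaw (multilin_rotins _ _ _ _ _ h); koszul.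
split=> [c p|e q]; split=> [r|b].
- move=> a x y w h; have [dx dy _] := h.
  by rewrite /thetaw (pair_linr _ h) dx dy scalerDl; koszul.
- move=> pre post a x y w h; rewrite /thetaw.
  by rewrite (rotins_multilinr _ _ _ _ _ h); koszul.
- move=> a x y w h; have [dx dy _] := h.
  by rewrite /thetaw (pair_linl _ h) scalerDl; koszul.
move=> pre post a x y w h; have [dx dy _] := h; rewrite /thetaw.
by rewrite (rotins_multilinl _ _ _ _ _ h) !degE dx dy; koszul.
Qed.

Lemma good_connesw : good (@connesw K m C).
Proof.
split=> [p|c]; first by move=> a x y w [_ _ E]; rewrite /connesw E linearP scalerDl scalerA.
move=> pre post a x y w h; rewrite /connesw.
by rewrite (rot_multilinl _ _ _ h); koszul.
Qed.

Lemma rot_splits p q : rot p q = splits (fun p1 a p2 =>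
  (-1) ^ (bdeg p1 * (deg a - 1 + bdeg p2 + bdeg q)) *: <[a :: p2 ++ q ++ p1]>) p.
Proof.
elim: p q => [|a p IHp] q; first by rewrite splits_nil.
rewrite splits_cons rotE IHp bdeg_nil mul0r expr0z scale1r cats0; congr (_ + _).
rewrite /splits scaler_sumr; apply: eq_bigr => i _.
set u := take i p; set b := nth _ _ _; set v := drop _ _.
have -> : bdeg p = bdeg u + (deg b - 1 + bdeg v).
  by rewrite -bdeg_cons -bdeg_cat -[p in LHS](cat_take_drop i) (drop_nth (letter0 C)).
rewrite cat_rcons !degE.
by koszul.
Qed.

(** On a reduced tail the reduction of heads in [B_word] has no effect, and its sum over positions
    is [rot] unrolled. *)
Lemma Bop_connesw c p : Bop C <[c :: p]> = lext (@connesw K m C) <[c :: p]>.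
Proof.
rewrite -wd_map_red lext_red ?red_reduced //; last exact: good_connesw.
have := red_reduced p; move: (map _ p) => {}p rp.
rewrite Bop_wd B_wordE /connesw rot_splits /splits scaler_sumr; apply: eq_bigr => i _.
rewrite red_id ?cat0s ?bdeg_cons; last first.
  by apply/eqP/(allP rp); exact: mem_nth.
by rewrite bdeg_nil; koszul.
Qed.

End Chains.

(** * Identities on homogeneous tensors *)

Section ChainIdentities.
Variables (K : fieldType) (m : int) (C : openFrobenius K m).
Implicit Types (W : lmodType K).
Notation word := (seq (letter C)).
Notation "<[ w ]>" := (wd (unit_rel C) w) (format "<[ w ]>").
Variables s t : K.
Notation bwd := (wdiff s t).
Notation bst := (@sdiff K m C s t).
Notation rot := (@rot K m C).

Notation dot := (@dot K m C).
Notation iota := (@iota_op K m C).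
Notation circ := (@circ_op K m C).
Notation theta := (@theta_op K m C).
Notation theta1 := (@theta1_op K m C).

Lemma lin_id W : linear (fun x : W => x). Proof. by []. Qed.
Lemma linD W W' (f g : W -> W') : linear f -> linear g -> linear (fun x => f x + g x).
Proof. by move=> fl gl a x y; rewrite fl gl scalerDr addrACA. Qed.
Lemma linZ W W' (f : W -> W') c : linear f -> linear (fun x => c *: f x).
Proof. by move=> fl a x y; rewrite fl scalerDr !scalerA mulrC. Qed.
Lemma linN W W' (f : W -> W') : linear f -> linear (fun x => - f x).
Proof. by move=> fl a x y; rewrite fl opprD scalerN. Qed.
Lemma linZ_of W W' (f : W -> W') c x : linear f -> f (c *: x) = c *: f x.
Proof.
move=> fl; have f0 : f 0 = 0 by have := fl (-1) 0 0; rewrite !scaleN1r oppr0 addr0 addNr.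
by have := fl c x 0; rewrite f0 !addr0.
Qed.
Lemma lin_bst W (f : W -> ccw C) : linear f -> linear (fun x => bst (f x)).
Proof. by move=> fl a x y; rewrite fl bstD bstZ. Qed.
Lemma lin_Bop W (f : W -> ccw C) : linear f -> linear (fun x => Bop C (f x)).
Proof. by move=> fl a x y; rewrite fl linearP. Qed.
Lemma lin_dot1 W (f : W -> ccw C) y : linear f -> linear (fun x => dot (f x) y).
Proof. by move=> fl a x x'; rewrite fl dot_linl. Qed.
Lemma lin_dot2 W (f : W -> ccw C) x : linear f -> linear (fun y => dot x (f y)).
Proof. by move=> fl a y y'; rewrite fl dot_linear2. Qed.
Lemma lin_iota1 W (f : W -> ccw C) y : linear f -> linear (fun x => iota (f x) y).
Proof. by move=> fl a x x'; rewrite fl [LHS]bext_linear1. Qed.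
Lemma lin_iota2 W (f : W -> ccw C) x : linear f -> linear (fun y => iota x (f y)).
Proof. by move=> fl a y y'; rewrite fl [LHS](bext_linear2 _ (@good2_iotaw _ _ _)). Qed.
Lemma lin_circ1 W (f : W -> ccw C) y : linear f -> linear (fun x => circ (f x) y).
Proof. by move=> fl a x x'; rewrite fl [LHS]bext_linear1. Qed.
Lemma lin_circ2 W (f : W -> ccw C) x : linear f -> linear (fun y => circ x (f y)).
Proof. by move=> fl a y y'; rewrite fl [LHS](bext_linear2 _ (@good2_circw _ _ _)). Qed.
Lemma lin_theta11 W (f : W -> ccw C) y : linear f -> linear (fun x => theta1 (f x) y).
Proof. by move=> fl a x x'; rewrite fl [LHS]bext_linear1. Qed.
Lemma lin_theta12 W (f : W -> ccw C) x : linear f -> linear (fun y => theta1 x (f y)).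
Proof. by move=> fl a y y'; rewrite fl [LHS](bext_linear2 _ (@good2_theta1w _ _ _)). Qed.
Lemma lin_theta_1 W (f : W -> ccw C) x y : linear f -> linear (fun z => theta (f z) x y).
Proof. by move=> fl a u u'; rewrite fl [LHS]text_linear1. Qed.
Lemma lin_theta_2 W (f : W -> ccw C) z y : linear f -> linear (fun x => theta z (f x) y).
Proof. by move=> fl a u u'; rewrite fl [LHS](text_linear2 _ _ (@good3_thetaw _ _ _)). Qed.
Lemma lin_theta_3 W (f : W -> ccw C) z x : linear f -> linear (fun y => theta z x (f y)).
Proof. by move=> fl a u u'; rewrite fl [LHS](text_linear3 _ _ (@good3_thetaw _ _ _)). Qed.

(** Syntax-directed proof that a composite of the operations is linear in a single argument. *)
Ltac lin := repeat (cbv beta; lazymatch goal with |- _ ?F =>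
  match F with
  | (fun x => x) => exact: lin_id
  | (fun x => (_ + _)%R) => apply: linD
  | (fun x => (- _)%R) => apply: linN
  | (fun x => sdiff _ _ (@?f x)) => apply: (lin_bst (f := f))
  | (fun x => Defs.dot (@?f x) ?y) => apply: (lin_dot1 y (f := f))
  | (fun x => Defs.dot ?y (@?f x)) => apply: (lin_dot2 y (f := f))
  | (fun x => iota_op (@?f x) ?y) => apply: (lin_iota1 y (f := f))
  | (fun x => iota_op ?y (@?f x)) => apply: (lin_iota2 y (f := f))
  | (fun x => circ_op (@?f x) ?y) => apply: (lin_circ1 y (f := f))
  | (fun x => circ_op ?y (@?f x)) => apply: (lin_circ2 y (f := f))
  | (fun x => theta1_op (@?f x) ?y) => apply: (lin_theta11 y (f := f))
  | (fun x => theta1_op ?y (@?f x)) => apply: (lin_theta12 y (f := f))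
  | (fun x => theta_op (@?f x) ?y ?z) => apply: (lin_theta_1 y z (f := f))
  | (fun x => theta_op ?y (@?f x) ?z) => apply: (lin_theta_2 y z (f := f))
  | (fun x => theta_op ?y ?z (@?f x)) => apply: (lin_theta_3 y z (f := f))
  | Defs.dot ?y => exact: (lin_dot2 y (@lin_id _))
  | iota_op ?y => exact: (lin_iota2 y (@lin_id _))
  | circ_op ?y => exact: (lin_circ2 y (@lin_id _))
  | theta1_op ?y => exact: (lin_theta12 y (@lin_id _))
  | theta_op ?y ?z => exact: (lin_theta_3 y z (@lin_id _))
  | (fun x => (?c *: @?f x)%R) => apply: (linZ c (f := f))
  | (fun x => GRing.Linear.sort (Bop C) (@?f x)) => apply: (lin_Bop (f := f))
  | _ => first [apply: linZ | apply: lin_Bop]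
  end end).

(* n is the number of letters after the head. *)
Definition hom (n : nat) (k : int) : set (ccw C) :=
  lspan [set x | exists w, [/\ size w = n.+1, wdeg w = k & x = <[w]>]]%classic.

Lemma hom_eq W (g h : ccw C -> W) n k : linear g -> linear h ->
  (forall c p, size p = n -> deg c + bdeg p = k -> reduced p ->
     g <[c :: p]> = h <[c :: p]>) ->
  forall x, hom n k x -> g x = h x.
Proof.
move=> gl hl gh x [l [lP ->]].
have [g0 h0] : g 0 = 0 /\ h 0 = 0.
  have := gl (-1) 0 0; have := hl (-1) 0 0.
  by rewrite !scaleN1r oppr0 addr0 !addNr.
elim: l lP => [|[a u] l IHl] lP; first by rewrite big_nil g0 h0.
rewrite big_cons gl hl IHl => [|p pl]; last by apply: lP; rewrite inE pl orbT.
congr (_ *: _ + _); have /= := lP (a, u) (mem_head _ _).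
move=> [[|c p] [sp dp ->]] //; rewrite -wd_map_red.
have d (r : word) : bdeg (map (@red_l K m C) r) = bdeg r.
  by elim: r => //= b r IHr; rewrite !bdeg_cons deg_red IHr.
by apply: gh; rewrite ?size_map ?d ?red_reduced //; case: sp.
Qed.

Lemma iota_red z zs c p : reduced zs -> reduced p ->
  iota <[z :: zs]> <[c :: p]> = iotaw z zs c p.
Proof.
move=> rz rp; rewrite /iota_op bext_red ?lext_red //; last exact: good2_iotaw.
exact: (@good2_iotaw K m C).1.
Qed.

Lemma circ_red z zs c p : reduced zs -> reduced p ->
  circ <[z :: zs]> <[c :: p]> = circw z zs c p.
Proof.
move=> rz rp; rewrite /circ_op bext_red ?lext_red //; last exact: good2_circw.
exact: (@good2_circw K m C).1.
Qed.

Lemma theta1_red z zs c p : reduced zs -> reduced p ->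
  theta1 <[z :: zs]> <[c :: p]> = theta1w z zs c p.
Proof.
move=> rz rp; rewrite /theta1_op bext_red ?lext_red //; last exact: good2_theta1w.
exact: (@good2_theta1w K m C).1.
Qed.

Lemma theta_red z zs c p e q : reduced zs -> reduced p -> reduced q ->
  theta <[z :: zs]> <[c :: p]> <[e :: q]> = thetaw z zs c p e q.
Proof.
move=> rz rp rq; have g3 := @good3_thetaw K m C.
rewrite /theta_op text_red // bext_red ?lext_red //; last exact: g3.1.
exact: (g3.1 _ _).1.
Qed.

Lemma connes_red c p : reduced p -> Bop C <[c :: p]> = connesw c p.
Proof. by move=> rp; rewrite Bop_connesw lext_red //; exact: good_connesw. Qed.

Lemma bst_red W (g : ccw C -> W) (f : letter C -> word -> W) c p : linear g ->
  (forall c r, reduced r -> g <[c :: r]> = f c r) -> reduced p ->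
  g (bst <[c :: p]>) = bwd f c p.
Proof.
move=> gl gf rp; rewrite bst_wd -(bwd_linear _ _ _ _ _ gl).
exact: eq_bwd_red.
Qed.

Lemma dot_assoc n1 k1 n2 k2 n3 k3 x y z : hom n1 k1 x -> hom n2 k2 y -> hom n3 k3 z ->
  dot (dot x y) z = (-1) ^ (m * k1 + m) *: dot x (dot y z).
Proof.
move=> hx hy; move: z; apply: hom_eq; [lin|lin|] => f r _ _ _.
move: y hy; apply: hom_eq; [lin|lin|] => e q _ _ _.
move: x hx; apply: hom_eq; [lin|lin|] => c p _ <- _.
rewrite !dot_wd /= dotZr dot_wd /=.
rewrite (_ : dot ((-1) ^ (deg e * bdeg p) *: <[mul_l c e :: p ++ q]>) <[f :: r]> =
  (-1) ^ (deg e * bdeg p) *: dot <[mul_l c e :: p ++ q]> <[f :: r]>); last first.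
  have := @dot_linl K m C <[f :: r]> ((-1) ^ (deg e * bdeg p)) <[mul_l c e :: p ++ q]> 0.
  by rewrite [dot 0 _]linear0 !addr0.
rewrite dot_wd /= (@llinZ _ _ _ (fun u => <[u :: (p ++ q) ++ r]>) ((-1) ^ (m * deg c + m))
  (mul_l c (mul_l e f))); first last.
- by rewrite !(mul_lP _ _).2 (mul_assoc _ _ (letterP c)).
- by rewrite !deg_mul; lia.
- exact: (llin_wd [::]).
by rewrite !degE -catA; koszul.
Qed.

Lemma dot_bst n k n' k' x y : hom n k x -> hom n' k' y ->
  bst (dot x y) = (-1) ^ m *: (dot (bst x) y + (-1) ^ k *: dot x (bst y)).
Proof.
move=> hx; move: y; apply: hom_eq; [lin|lin|] => e q _ _ rq.
move: x hx; apply: hom_eq; [lin|lin|] => c p _ <- rp.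
rewrite (bst_red (g := fun x => dot x _) (f := fun c p => (-1) ^ (deg e * bdeg p) *: <[mul_l c e :: p ++ q]>)) //;
  [|by lin|by move=> c' r _; rewrite dot_wd].
rewrite (bst_red (g := dot <[c :: p]>) 
   (f := fun e q => (-1) ^ (deg e * bdeg p) *: <[mul_l c e :: p ++ q]>)) //;
  [|exact: dot_linear2|by move=> c' r _; rewrite dot_wd].
rewrite (@prod_core K m C s t _ (fun u p q => <[u :: p ++ q]>)); first last.
- by move=> u p' pre post b v w y h; rewrite !catA; exact: (wd_multilin _ (u :: p' ++ pre) _ h).
- by move=> u q'; exact: multilin_cat_wd.
- by move=> p' q'; exact: (llin_wd [::]).
rewrite dot_wd /= bstZ bst_wd /wdiff Dop_cat deg_mul.
set A := csum _ _; set B := csum _ _.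
(* Here the functional depends only on the concatenation of p and q, so the two middle terms of
   [prod_core], with the new letter between p and q, cancel. *)
suff -> : B = A by koszul.
apply: eq_csum => u v _; rewrite degE cat_rcons rcons_cat.
by koszul.
Qed.

Lemma iota_bst n k n' k' z x (d := k - m + 1) : hom n k z -> hom n' k' x ->
  bst (iota z x) - (-1) ^ d *: iota z (bst x) + (-1) ^ m *: iota (bst z) x
  = t *: ((-1) ^ m *: dot z x - (-1) ^ (k * k') *: dot x z).
Proof.
move=> hz; move: x; apply: hom_eq; [lin|lin|] => c p _ <- rp; rewrite {}/d.
move: z hz; apply: hom_eq; [lin|lin|] => z zs _ <- rz.
rewrite (bst_red (g := fun z => iota z _) (f := fun z zs => iotaw z zs c p)) //; [|by lin|by move=> *; exact: iota_red].
rewrite (bst_red (g := iota _) (f := iotaw z zs)) //;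
  [|by apply: lin_iota2|by move=> *; exact: iota_red].
rewrite iota_red //; exact: iota_core.
Qed.

Lemma theta1_bst n k n' k' z x (d := k - m + 1) : hom n k z -> hom n' k' x ->
  bst (theta1 z x) + (-1) ^ d *: theta1 z (bst x) + (-1) ^ m *: theta1 (bst z) x
  = t *: ((-1) ^ d *: iota z x + (-1) ^ m *: dot z (Bop C x)
      + (-1) ^ (m + 1 + k * (k' + 1)) *: circ x z).
Proof.
move=> hz; move: x; apply: hom_eq; [lin|lin|] => c p _ <- rp; rewrite {}/d.
move: z hz; apply: hom_eq; [lin|lin|] => z zs _ <- rz.
rewrite (bst_red (g := fun z => theta1 z _) (f := fun z zs => theta1w z zs c p)) //; [|by lin|by move=> *; exact: theta1_red].
rewrite (bst_red (g := theta1 _) (f := theta1w z zs)) //;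
  [|by apply: lin_theta12|by move=> *; exact: theta1_red].
rewrite theta1_red // iota_red // circ_red // connes_red //; exact: theta1_core.
Qed.

Lemma theta_bst n k n' k' n'' k'' z x y (d := k - m + 1) :
  hom n k z -> hom n' k' x -> hom n'' k'' y ->
  bst (theta z x y) + (-1) ^ (d + m) *: (theta z (bst x) y + (-1) ^ k' *: theta z x (bst y))
    + (-1) ^ m *: theta (bst z) x y
  = t *: ((-1) ^ ((m + 1) * (k + 1)) *: dot (iota z x) y + (-1) ^ m *: dot z (circ x y)
      + (-1) ^ (m + 1 + (k + m) * (k' + m + 1)) *: circ x (dot z y)).
Proof.
move=> hz hx; move: y; apply: hom_eq; [lin|lin|] => e q _ _ rq; rewrite {}/d.
move: x hx; apply: hom_eq; [lin|lin|] => c p _ <- rp.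
move: z hz; apply: hom_eq; [lin|lin|] => z zs _ <- rz.
rewrite (bst_red (g := fun z => theta z _ _) (f := fun z zs => thetaw z zs c p e q)) //; [|by lin|by move=> *; exact: theta_red].
rewrite (bst_red (g := fun x => theta _ x _) (f := fun c p => thetaw z zs c p e q)) //;
  [|by lin|by move=> *; exact: theta_red].
rewrite (bst_red (g := theta _ _) (f := thetaw z zs c p)) //;
  [|by apply: lin_theta_3|by move=> *; exact: theta_red].
have E := theta_core s t z zs c e q rp; rewrite /ideg in E.
rewrite theta_red // iota_red // circ_red // dot_wd /=.
have -> : circ <[c :: p]> ((-1) ^ (deg e * bdeg zs) *: <[mul_l z e :: zs ++ q]>) =
    (-1) ^ (deg e * bdeg zs) *: circw c p (mul_l z e) (zs ++ q).
  have := lin_circ2 <[c :: p]> (@lin_id _) ((-1) ^ (deg e * bdeg zs)) <[mul_l z e :: zs ++ q]> 0.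
  rewrite !addr0 circ_red //; last by rewrite /reduced all_cat; apply/andP.
  move=> ->; rewrite -[RHS]addr0; congr (_ + _).
  have := lin_circ2 <[c :: p]> (@lin_id _) (-1) 0 0.
  by rewrite !scaleN1r oppr0 addr0 addNr.
by apply: (eq_comb (c := 1) E); koszul.
Qed.

Lemma connes_bst n k x : hom n k x -> bst (Bop C x) + Bop C (bst x) = 0.
Proof.
move: x; apply: (hom_eq (h := fun=> 0)); [lin| |].
  by move=> a u v; rewrite scaler0 addr0.
move=> c p _ _ rp.
rewrite (bst_red (g := Bop C) (f := @connesw K m C)) //; last exact: connes_red.
  by rewrite connes_red // connes_core.
exact: (lin_Bop (@lin_id _)).
Qed.

Lemma connes_dot n k n' k' x y : hom n k x -> hom n' k' y ->
  Bop C (dot x y) = circ x y + (-1) ^ (k * k' + m) *: circ y x.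
Proof.
move=> hx; move: y; apply: hom_eq; [lin|lin|] => e q _ <- rq.
move: x hx; apply: hom_eq; [lin|lin|] => c p _ <- rp.
rewrite !circ_red // -circ_connes dot_wd /= linearZ /= connes_red //.
by rewrite /reduced all_cat; apply/andP.
Qed.

(** Insertion is a derivation for concatenation, and it does not touch heads; hence this identity is
    strict and needs no homotopy. *)
Lemma iota_dot n k n' k' n'' k'' z x y (d := k - m + 1) :
  hom n k z -> hom n' k' x -> hom n'' k'' y ->
  iota z (dot x y) = (-1) ^ (d * m) *: (dot (iota z x) y + (-1) ^ (d * k') *: dot x (iota z y)).
Proof.
move=> hz hx; move: y; apply: hom_eq; [lin|lin|] => e q _ _ rq; rewrite {}/d.
move: x hx; apply: hom_eq; [lin|lin|] => c p _ <- rp.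
move: z hz; apply: hom_eq; [lin|lin|] => z zs _ <- rz.
rewrite dot_wd /= iota_red // iota_red //.
rewrite (linZ_of _ _ (lin_iota2 <[z :: zs]> (@lin_id _))) iota_red //; last first.
  by rewrite /reduced all_cat; apply/andP.
rewrite dot_iotal dot_iotar /iotaw ins_cat deg_mul /ideg.
by koszul.
Qed.

(** Every head of a rotation is a former tail letter, where eps vanishes once the word is
    reduced. *)
Lemma connes_connes n k x : hom n k x -> Bop C (Bop C x) = 0.
Proof.
move: x; apply: (hom_eq (h := fun=> 0)).
- exact: (lin_Bop (lin_Bop (@lin_id _))).
- by move=> a u v; rewrite scaler0 addr0.
move=> c p _ _ rp; rewrite connes_red // /connesw linearZ /=.
suff -> : Bop C (rot p [::]) = 0 by rewrite scaler0.
suff E q : reduced q -> Bop C (rot p q) = 0 by exact: E.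
elim: p q rp => [|a p IHp] q /= => [_ _|/andP[/eqP a0 rp] rq]; first by rewrite linear0.
rewrite linearD linearZ /= connes_red; last by rewrite /reduced all_cat; apply/andP.
rewrite /connesw a0 scale0r add0r IHp ?scaler0 //.
by rewrite reduced_rcons rq a0 eqxx.
Qed.

End ChainIdentities.

(** * Degrees and lengths of the operations *)

Section Degrees.
Variables (K : fieldType) (m : int) (C : openFrobenius K m).
Notation word := (seq (letter C)).
Notation "<[ w ]>" := (wd (unit_rel C) w) (format "<[ w ]>").
Notation rot := (@rot K m C).
Notation rotins := (@rotins K m C).

Notation dot := (@dot K m C).
Notation iota := (@iota_op K m C).
Notation theta := (@theta_op K m C).
Notation theta1 := (@theta1_op K m C).
Notation hom := (@hom K m C).

Lemma hom_wd n k c p : size p = n -> deg c + bdeg p = k -> hom n k <[c :: p]>.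
Proof. by move=> sp dp; apply: span_gen; exists (c :: p); rewrite /= sp dp. Qed.

Lemma hom0 n k : hom n k 0. Proof. exact: span0. Qed.
Lemma homD n k x y : hom n k x -> hom n k y -> hom n k (x + y). Proof. exact: spanD. Qed.
Lemma homZ n k a x : hom n k x -> hom n k (a *: x). Proof. exact: spanZ. Qed.
Lemma homN n k x : hom n k x -> hom n k (- x). Proof. exact: spanN. Qed.

Lemma hom_sum n k (I : Type) (r : seq I) (P : pred I) (F : I -> ccw C) :
  (forall i, P i -> hom n k (F i)) -> hom n k (\sum_(i <- r | P i) F i).
Proof. by move=> h; apply: (big_ind (hom n k)) => //; [exact: hom0|exact: homD]. Qed.

Lemma hom_lin n k n' k' (g : ccw C -> ccw C) : linear g ->
  (forall c p, size p = n -> deg c + bdeg p = k -> reduced p -> hom n' k' (g <[c :: p]>)) ->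
  forall x, hom n k x -> hom n' k' (g x).
Proof.
move=> gl gh x [l [lP ->]].
have g0 : g 0 = 0 by have := gl (-1) 0 0; rewrite !scaleN1r oppr0 addr0 addNr.
elim: l lP => [|[a u] l IHl] lP; first by rewrite big_nil g0; exact: hom0.
rewrite big_cons gl; apply: homD; last by apply: IHl => p pl; apply: lP; rewrite inE pl orbT.
apply: homZ; have /= := lP (a, u) (mem_head _ _).
move=> [[|c p] [sp dp ->]] //; rewrite -wd_map_red.
have d (r : word) : bdeg (map (@red_l K m C) r) = bdeg r.
  by elim: r => //= b r IHr; rewrite !bdeg_cons deg_red IHr.
by apply: gh; rewrite ?size_map ?d ?red_reduced //; case: sp.
Qed.

Lemma split_at (p : word) (i : 'I_(size p)) (u := take i p) (v := drop i.+1 p) :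
  size p = (size u + (size v).+1)%N /\
  bdeg p = bdeg u + (deg (nth (letter0 C) p i) - 1 + bdeg v).
Proof.
have e : take i p ++ nth (letter0 C) p i :: drop i.+1 p = p.
  by rewrite -drop_nth // cat_take_drop.
by split; [rewrite -{1}e size_cat | rewrite -{1}e bdeg_cat bdeg_cons].
Qed.

Lemma hom_bint n k x : hom n k x -> hom n (k - 1) (bint C x).
Proof.
move: x; apply: hom_lin => [a u v|c p sp dp _]; first by rewrite linearP.
rewrite bint_wd /=; apply: homD.
  by apply: hom_wd => //; rewrite deg_dif -dp; lia.
apply/homN/hom_sum => i _; apply: homZ; have [se de] := split_at i.
apply: hom_wd; first by rewrite size_cat -[RHS]sp [RHS]se.
by rewrite -dp !degE de; lia.
Qed.

Lemma hom_bcop n k x : hom n k x -> hom n.+1 (k - 1) (bcop C x).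
Proof.
move: x; apply: hom_lin => [a u v|c p sp dp _]; first by rewrite linearP.
rewrite bcop_wd bcop_wordE; apply: homD.
  apply: hom_sum => i _; rewrite sweedler_cops; last exact: bcopF_bilin.
  rewrite big_seq; apply: hom_sum => -[x y] /cops_deg /= xy; apply: homZ.
  have [se de] := split_at i.
  apply: hom_wd; first by rewrite size_cat -[in RHS]sp [in RHS]se /= !addnS.
  by rewrite -dp !degE de -xy; lia.
rewrite sweedler_cops; last exact: bcop0_bilin.
rewrite big_seq; apply: hom_sum => -[x y] /cops_deg /= xy; apply/homZ/homD.
  by apply: hom_wd; rewrite /= ?sp // !degE -dp -xy; lia.
apply/homN/homZ/hom_wd; first by rewrite size_rcons sp.
by rewrite !degE -dp -xy; lia.
Qed.

(** The predecessor accounts for the letter that becomes the head. It is truncated only when p is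
    empty, and then the value is 0. *)
Lemma hom_rot p q : hom (size p + size q).-1 (bdeg p + bdeg q + 1) (rot p q).
Proof.
elim: p q => [|a p IHp] q; first exact: hom0.
rewrite rotE; apply: homD.
  by apply: hom_wd; rewrite ?size_cat // !degE; lia.
apply: homZ; have := IHp (rcons q a).
by rewrite size_rcons !degE addnS; congr (hom _ _ _); lia.
Qed.

Lemma hom_ins n k z zs (F : word -> ccw C) p :
  (forall r, (size r).+1 = (size p + size zs)%N -> bdeg r = bdeg p + ideg z zs -> hom n k (F r)) ->
  hom n k (ins z zs F p).
Proof.
elim: p F => [|a p IHp] F FP; first exact: hom0.
rewrite insE; apply: homD.
  rewrite /icoef; have [->|/pair_deg za] := eqVneq (pair_eps z a) 0.
    by rewrite mulr0 scale0r; exact: hom0.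
  apply/homZ/FP; first by rewrite size_cat /= addnC addSn.
  by rewrite !degE /ideg; lia.
apply/homZ/IHp => r sr dr; apply: FP; first by rewrite /= sr addSn.
by rewrite !bdeg_cons dr; lia.
Qed.

Lemma hom_rotins z zs p q :
  hom (size p + size q + size zs).-2 (bdeg p + bdeg q + ideg z zs + 1) (rotins z zs p q).
Proof.
elim: p q => [|a p IHp] q; first exact: hom0.
rewrite rotinsE; apply: homD.
  apply/homZ/hom_ins => r sr dr; apply: hom_wd; last by rewrite !degE dr; lia.
  by rewrite size_cat /=; lia.
apply: homZ; have := IHp (rcons q a).
by rewrite size_rcons !degE addnS; congr (hom _ _ _); lia.
Qed.

Lemma hom_connes n k x : hom n k x -> hom n.-1 (k + 1) (Bop C x).
Proof.
move: x; apply: hom_lin => [a u v|c p sp dp rp]; first by rewrite linearP.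
rewrite connes_red // /connesw; have [->|/eps_deg0 c0] := eqVneq (eps (elt c)) 0.
  by rewrite scale0r; exact: hom0.
apply: homZ; have := hom_rot p [::]; rewrite addn0 sp bdeg_nil.
by congr (hom _ _ _); lia.
Qed.

Lemma connes_hom0 k x : hom 0 k x -> Bop C x = 0.
Proof.
move: x; apply: (hom_eq (h := fun=> 0)).
- exact: (lin_Bop (@lin_id _ _)).
- by move=> a u v; rewrite scaler0 addr0.
by move=> c [|//] p _ _; rewrite connes_red // /connesw scaler0.
Qed.

Lemma hom_dot n k n' k' x y : hom n k x -> hom n' k' y ->
  hom (n + n') (k + k' - m) (dot x y).
Proof.
move=> hx; move: y; apply: hom_lin => [a u v|e q sq dq _]; first exact: dot_linear2.
move: x hx; apply: hom_lin => [a u v|c p sp dp _]; first exact: dot_linl.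
rewrite dot_wd; apply/homZ/hom_wd; first by rewrite size_cat sp sq.
by rewrite !degE -dp -dq; lia.
Qed.

Lemma hom_iota n k n' k' z x : hom n k z -> hom n' k' x ->
  hom (n + n').-1 (k + k' - m + 1) (iota z x).
Proof.
move=> hz; move: x; apply: hom_lin; first exact: (lin_iota2 z (@lin_id _ _)).
move=> c p sp dp rp; move: z hz; apply: hom_lin; first exact: (lin_iota1 _ (@lin_id _ _)).
move=> z zs sz dz rz; rewrite iota_red //; apply/homZ/hom_ins => r sr dr; apply: hom_wd.
  by move: sr; rewrite sp sz; lia.
by rewrite dr -dp -dz /ideg; lia.
Qed.

Lemma hom_theta1 n k n' k' z x : hom n k z -> hom n' k' x ->
  hom (n + n').-2 (k + k' - m + 2) (theta1 z x).
Proof.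
move=> hz; move: x; apply: hom_lin; first exact: (lin_theta12 z (@lin_id _ _)).
move=> c p sp dp rp; move: z hz; apply: hom_lin; first exact: (lin_theta11 _ (@lin_id _ _)).
move=> z zs sz dz rz; rewrite theta1_red // /theta1w.
have [->|/eps_deg0 c0] := eqVneq (eps (elt c)) 0; first by rewrite scale0r; exact: hom0.
apply: homZ; have := hom_rotins z zs p [::]; rewrite addn0 sp sz addnC bdeg_nil.
by congr (hom _ _ _); rewrite /ideg; lia.
Qed.

Lemma hom_theta n k n' k' n'' k'' z x y : hom n k z -> hom n' k' x -> hom n'' k'' y ->
  hom (n + n' + n'').-2 (k + k' + k'' - m - m + 2) (theta z x y).
Proof.
move=> hz hx; move: y; apply: hom_lin; first exact: (lin_theta_3 z x (@lin_id _ _)).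
move=> e q sq dq rq; move: x hx; apply: hom_lin; first exact: (lin_theta_2 z _ (@lin_id _ _)).
move=> c p sp dp rp; move: z hz; apply: hom_lin; first exact: (lin_theta_1 _ _ (@lin_id _ _)).
move=> z zs sz dz rz; rewrite theta_red // /thetaw; apply: homZ.
have [->|/pair_deg ce] := eqVneq (pair_eps c e) 0; first by rewrite scale0r; exact: hom0.
apply: homZ; have := hom_rotins z zs p q; rewrite sp sq sz addnC addnA.
by congr (hom _ _ _); rewrite /ideg; lia.
Qed.

Lemma iota_hom0 k k' z x : hom 0 k z -> hom 0 k' x -> iota z x = 0.
Proof.
move=> hz; move: x; apply: (hom_eq (h := fun=> 0)).
- exact: (lin_iota2 z (@lin_id _ _)).
- by move=> a u v; rewrite scaler0 addr0.
move=> c [|//] p _ rp; move: z hz; apply: (hom_eq (h := fun=> 0)).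
- exact: (lin_iota1 _ (@lin_id _ _)).
- by move=> a u v; rewrite scaler0 addr0.
by move=> z [|//] zs _ rz; rewrite iota_red // /iotaw scaler0.
Qed.

End Degrees.

(** * Families of tensors *)

Section FamilyTheory.
Variables (K : fieldType) (m : int) (C : openFrobenius K m).
Implicit Types (U V W : lmodType K).
Notation "<[ w ]>" := (wd (unit_rel C) w) (format "<[ w ]>").

Notation hom := (@hom K m C).
Notation fam := (nat -> ccw C).

Definition sh W (X : nat -> W) : nat -> W := fun n => if n is p.+1 then X p else 0.

(** A sum over index pairs with fixed total in which G may itself be a convolution; iterating it
    gives convolutions of two and three families. *)
Definition tot V W (G : V -> nat -> W) (Z : nat -> V) : nat -> W :=
  fun n => \sum_(i < n.+1) G (Z i) (n - i)%N.

Lemma tot_shl V W (G : V -> nat -> W) Z : (forall n, G 0 n = 0) -> tot G (sh Z) = sh (tot G Z).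
Proof.
move=> G0; apply/funext => -[|n]; rewrite /tot /=; first by rewrite big_ord1 G0.
by rewrite big_ord_recl G0 add0r.
Qed.

Lemma tot_shr V W (G : V -> nat -> W) Z : tot (fun z => sh (G z)) Z = sh (tot G Z).
Proof.
apply/funext => -[|n]; rewrite /tot /=; first by rewrite big_ord1.
rewrite big_ord_recr /= subnn addr0; apply: eq_bigr => i _.
by rewrite subSn // -ltnS.
Qed.

Lemma eq_tot V W (G H : V -> nat -> W) Z : (forall i, G (Z i) = H (Z i)) -> tot G Z = tot H Z.
Proof. by move=> GH; apply/funext => n; apply: eq_bigr => i _; rewrite GH. Qed.

Lemma totD V W (G H : V -> nat -> W) Z :
  tot (fun z n => G z n + H z n) Z = tot G Z + tot H Z.
Proof. by apply/funext => n; rewrite /tot big_split. Qed.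

Lemma totZ V W c (G : V -> nat -> W) Z : tot (fun z n => c *: G z n) Z = c *: tot G Z.
Proof. by apply/funext => n; rewrite /tot -scaler_sumr. Qed.

Lemma tot_linear V W (G : V -> nat -> W) c X Y :
  (forall n, linear (fun x => G x n)) -> tot G (c *: X + Y) = c *: tot G X + tot G Y.
Proof.
move=> Gl; apply/funext => n; rewrite /tot.
rewrite -[RHS]/(c *: _ + _) scaler_sumr -big_split; apply: eq_bigr => i _.
exact: Gl.
Qed.

Lemma tot_map V W W' (g : W -> W') (G : V -> nat -> W) Z n : linear g ->
  g (tot G Z n) = tot (fun z j => g (G z j)) Z n.
Proof.
move=> gl; pose g' : {linear W -> W'} := HB.pack g (GRing.isLinear.Build _ _ _ _ _ gl).
exact: (linear_sum g').
Qed.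

Lemma tot_exchange U V W (G : U -> V -> nat -> W) X Y :
  tot (fun x => tot (G x) Y) X = tot (fun y => tot (G^~ y) X) Y.
Proof.
apply/funext => n; rewrite /tot.
have E (A : nat -> nat -> nat -> W) : \sum_(i < n.+1) \sum_(j < (n - i).+1) A i j (n - i - j)%N =
    \sum_(i < n.+1) \sum_(j < n.+1 | (i + j <= n)%N) A i j (n - i - j)%N.
  apply: eq_bigr => i _; rewrite -(big_mkord xpredT (fun j => A i j (n - i - j)%N)).
  rewrite (big_nat_widen _ _ n.+1) ?ltnS ?leq_subr // big_mkord; apply: eq_bigl => j /=.
  by rewrite ltnS; have := ltn_ord i; lia.
rewrite (E (fun i j l => G (X i) (Y j) l)) (E (fun j i l => G (X i) (Y j) l)).
rewrite (exchange_big_dep xpredT) //=; apply: eq_bigr => j _.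
by apply: eq_big => [i|i _]; [rewrite addnC | rewrite subnAC].
Qed.

(** Associativity of convolution: both sides run over the triples of indices with sum n. *)
Lemma tot_tot U V W (G : V -> nat -> W) (H : U -> nat -> V) X :
  (forall n, linear (fun x => G x n)) -> tot G (tot H X) = tot (fun x => tot G (H x)) X.
Proof.
move=> Gl; apply/funext => n; rewrite /tot.
have Gs k N (F : 'I_N -> V) : G (\sum_(j < N) F j) k = \sum_(j < N) G (F j) k.
  pose g : {linear V -> W} := HB.pack (fun v => G v k) (GRing.isLinear.Build _ _ _ _ _ (Gl k)).
  exact: (linear_sum g).
under eq_bigr => i _ do rewrite Gs.
transitivity (\sum_(i < n.+1) \sum_(j < n.+1 | (j <= i)%N) G (H (X j) (i - j)%N) (n - i)%N).
  apply: eq_bigr => i _; rewrite -(big_mkord xpredT (fun j => G (H (X j) (i - j)%N) (n - i)%N)).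
  by rewrite (big_nat_widen _ _ n.+1) ?(ltn_ord i) // big_mkord; apply: eq_bigl => j.
rewrite (exchange_big_dep xpredT) //=; apply: eq_bigr => j _.
have jn : (j <= n)%N by rewrite -ltnS.
rewrite -(big_mkord (fun i => (j <= i)%N) (fun i => G (H (X j) (i - j)%N) (n - i)%N)).
rewrite (big_cat_nat (n := j)) //=; last by apply: ltnW; rewrite ltnS.
rewrite big_nat_cond big1 ?add0r => [|i]; last by case/andP=> /andP[_ ij]; lia.
rewrite -{1}[j : nat]add0n big_addn big_mkord subSn //.
by apply: eq_big => [i|i _]; [rewrite leq_addl | rewrite addnK addnC subnDA].
Qed.

Lemma tot_rev (W : lmodType K) (F : nat -> nat -> W) n :
  \sum_(i < n.+1) F i (n - i)%N = \sum_(i < n.+1) F (n - i)%N i.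
Proof.
rewrite (reindex_inj rev_ord_inj) /=; apply: eq_bigr => i _.
by rewrite subSS subKn // -ltnS.
Qed.

Definition conv (f : ccw C -> ccw C -> ccw C) (X Y : fam) : fam := tot (fun x j => f x (Y j)) X.
Definition conv3 (f : ccw C -> ccw C -> ccw C -> ccw C) (Z X Y : fam) : fam :=
  tot (fun z => conv (f z) X Y) Z.

Lemma conv_swap f X Y : conv (fun x y => f y x) X Y = conv f Y X.
Proof. by apply/funext => n; rewrite /conv /tot (tot_rev (fun i j => f (Y j) (X i))). Qed.

Definition lin1 (f : ccw C -> ccw C -> ccw C) := forall y, linear (f^~ y).
Definition lin2 (f : ccw C -> ccw C -> ccw C) := forall x, linear (f x).

Lemma lin0 (V W : lmodType K) (f : V -> W) : linear f -> f 0 = 0.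
Proof. by move=> fl; have := fl (-1) 0 0; rewrite !scaleN1r oppr0 addr0 addNr. Qed.

Lemma conv_shl f X Y : lin1 f -> conv f (sh X) Y = sh (conv f X Y).
Proof. by move=> fl; apply: tot_shl => n; exact: (lin0 (fl (Y n))). Qed.

Lemma conv_shr f X Y : lin2 f -> conv f X (sh Y) = sh (conv f X Y).
Proof.
move=> fl; rewrite -[RHS]tot_shr; apply: eq_tot => i; apply/funext => -[|n] //=.
exact: (lin0 (fl (X i))).
Qed.

Lemma convDl f X X' Y : lin1 f -> conv f (X + X') Y = conv f X Y + conv f X' Y.
Proof. by move=> fl; have := tot_linear 1 X X' (G := fun x j => f x (Y j)) (fun n => fl (Y n)); rewrite !scale1r. Qed.

Lemma convDr f X Y Y' : lin2 f -> conv f X (Y + Y') = conv f X Y + conv f X Y'.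
Proof.
move=> fl; rewrite -totD; apply: eq_tot => i; apply/funext => n.
by have := fl (X i) 1 (Y n) (Y' n); rewrite !scale1r.
Qed.

Lemma bCCE X : bCC X = (fun n => bint C (X n)) + sh (fun n => bcop C (X n)) :> fam.
Proof. by apply/funext => -[|n]. Qed.

Lemma bCC_sh X : bCC (sh X) = sh (bCC X) :> fam.
Proof.
apply/funext => -[|n]; rewrite /bCC /=; first by rewrite linear0 addr0.
by case: n => [|n]; rewrite ?linear0.
Qed.

Lemma sh_inj W : injective (@sh W).
Proof. by move=> X Y e; apply/funext => n; exact: (congr1 (fun f => f n.+1) e). Qed.

Lemma shD W (X Y : nat -> W) : sh (X + Y) = sh X + sh Y.
Proof. by apply/funext => -[|n] //; rewrite -[RHS]/(0 + 0) addr0. Qed.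

Lemma shZ W c (X : nat -> W) : sh (c *: X) = c *: sh X.
Proof. by apply/funext => -[|n] //; rewrite -[RHS]/(c *: 0) scaler0. Qed.

Lemma sh_tail W (X : nat -> W) : X 0%N = 0 -> X = sh (fun n => X n.+1).
Proof. by move=> X0; apply/funext => -[|n]. Qed.

Lemma bst10 x : sdiff 1 0 x = bint C x.
Proof. by rewrite /sdiff scale1r scale0r addr0. Qed.

Lemma bst01 x : sdiff 0 1 x = bcop C x.
Proof. by rewrite /sdiff scale1r scale0r add0r. Qed.

(* The identities for b on the two components of the differential give the one on families;
   the cobar component raises the length. *)
Lemma conv_bCC f g k k' a b X Y : lin1 f -> lin2 f -> CC k X -> CC k' Y ->
  (forall s t n n' x y, hom n k x -> hom n' k' y ->
     sdiff s t (f x y) + a *: f (sdiff s t x) y + b *: f x (sdiff s t y) = t *: g x y) ->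
  bCC (conv f X Y) + a *: conv f (bCC X) Y + b *: conv f X (bCC Y) = sh (conv g X Y).
Proof.
move=> f1 f2 hX hY H; rewrite !bCCE convDl // convDr // conv_shl // conv_shr //.
have -> : sh (conv g X Y) = sh ((fun n => bcop C (conv f X Y n))
   + a *: conv f (fun n => bcop C (X n)) Y + b *: conv f X (fun n => bcop C (Y n))).
  congr sh; apply/funext => n.
  rewrite -[RHS]/(bcop C (conv f X Y n) + a *: conv f (fun n => bcop C (X n)) Y n
    + b *: conv f X (fun n => bcop C (Y n)) n).
  rewrite (tot_map _ _ _ (linearP (bcop C))) /conv /tot !scaler_sumr -!big_split.
  apply: eq_bigr => i _; have := H 0 1 _ _ _ _ (hX i) (hY (n - i)%N).
  by rewrite !bst01 scale1r => <-.
have Z : (fun n => bint C (conv f X Y n))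
   + a *: conv f (fun n => bint C (X n)) Y + b *: conv f X (fun n => bint C (Y n)) = 0.
  apply/funext => n.
  rewrite -[LHS]/(bint C (conv f X Y n) + a *: conv f (fun n => bint C (X n)) Y n
    + b *: conv f X (fun n => bint C (Y n)) n).
  rewrite (tot_map _ _ _ (linearP (bint C))) /conv /tot !scaler_sumr -!big_split.
  rewrite -[RHS]/0 big1 // => i _; have := H 1 0 _ _ _ _ (hX i) (hY (n - i)%N).
  by rewrite !bst10 scale0r.
by rewrite !shD !shZ !scalerDr [X in X + _ = _]addrACA [LHS]addrACA Z add0r.
Qed.

End FamilyTheory.

(** * Convolutions and the operations on chains *)

Section FamilyOperations.
Variables (K : fieldType) (m : int) (C : openFrobenius K m).

Notation dot := (@dot K m C).
Notation iota := (@iota_op K m C).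
Notation circ := (@circ_op K m C).
Notation theta := (@theta_op K m C).
Notation theta1 := (@theta1_op K m C).
Notation hom := (@hom K m C).
Notation fam := (nat -> ccw C).
Notation conv := (@conv K m C).
Notation conv3 := (@conv3 K m C).
Notation lin1 := (@lin1 K m C).
Notation lin2 := (@lin2 K m C).
Implicit Types (X Y Z W : fam).

Lemma eq_conv f g X Y : (forall i j, f (X i) (Y j) = g (X i) (Y j)) -> conv f X Y = conv g X Y.
Proof. by move=> fg; apply: eq_tot => i; apply/funext => j. Qed.

Lemma eq_conv3 f g Z X Y : (forall i j l, f (Z i) (X j) (Y l) = g (Z i) (X j) (Y l)) ->
  conv3 f Z X Y = conv3 g Z X Y.
Proof. by move=> fg; apply: eq_tot => i; apply: eq_conv => j l. Qed.

Lemma conv_comb f g a b X Y :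
  conv (fun x y => a *: f x y + b *: g x y) X Y = a *: conv f X Y + b *: conv g X Y.
Proof. by rewrite /conv -!totZ -totD. Qed.

Lemma conv3_comb f g a b Z X Y :
  conv3 (fun z x y => a *: f z x y + b *: g z x y) Z X Y = a *: conv3 f Z X Y + b *: conv3 g Z X Y.
Proof. by rewrite /conv3 -!totZ -totD; apply: eq_tot => i; rewrite conv_comb. Qed.

Lemma conv_convl f g X Y W : lin1 f ->
  conv f (conv g X Y) W = conv3 (fun x y w => f (g x y) w) X Y W.
Proof. by move=> fl; apply: tot_tot => n; exact: fl. Qed.

Lemma conv_convr f g X Y W : lin2 f ->
  conv f X (conv g Y W) = conv3 (fun x y w => f x (g y w)) X Y W.
Proof. by move=> fl; apply: eq_tot => i; apply/funext => j; apply: tot_map; exact: fl. Qed.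

Lemma conv3_swap f X Y W : conv3 f X Y W = conv3 (fun y x w => f x y w) Y X W.
Proof. exact: tot_exchange. Qed.

Definition lin31 (f : ccw C -> ccw C -> ccw C -> ccw C) := forall x y, linear (fun z => f z x y).
Definition lin32 (f : ccw C -> ccw C -> ccw C -> ccw C) := forall z, lin1 (f z).
Definition lin33 (f : ccw C -> ccw C -> ccw C -> ccw C) := forall z, lin2 (f z).

Lemma conv_linear1 f X Y n : lin31 f -> linear (fun z => conv (f z) X Y n).
Proof.
move=> fl a z z'; rewrite /conv /tot scaler_sumr -big_split; apply: eq_bigr => i _.
exact: fl.
Qed.

Lemma conv3_sh1 f Z X Y : lin31 f -> conv3 f (sh Z) X Y = sh (conv3 f Z X Y).
Proof. by move=> fl; apply: tot_shl => n; exact: (lin0 (conv_linear1 X Y n fl)). Qed.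

Lemma conv3_sh2 f Z X Y : lin32 f -> conv3 f Z (sh X) Y = sh (conv3 f Z X Y).
Proof. by move=> fl; rewrite /conv3 -tot_shr; apply: eq_tot => i; exact: conv_shl. Qed.

Lemma conv3_sh3 f Z X Y : lin33 f -> conv3 f Z X (sh Y) = sh (conv3 f Z X Y).
Proof. by move=> fl; rewrite /conv3 -tot_shr; apply: eq_tot => i; exact: conv_shr. Qed.

Lemma conv3D1 f Z Z' X Y : lin31 f -> conv3 f (Z + Z') X Y = conv3 f Z X Y + conv3 f Z' X Y.
Proof.
move=> fl; have := tot_linear 1 Z Z' (G := fun z => conv (f z) X Y)
  (fun n => conv_linear1 X Y n fl).
by rewrite !scale1r.
Qed.

Lemma conv3D2 f Z X X' Y : lin32 f -> conv3 f Z (X + X') Y = conv3 f Z X Y + conv3 f Z X' Y.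
Proof. by move=> fl; rewrite /conv3 -totD; apply: eq_tot => i; exact: convDl. Qed.

Lemma conv3D3 f Z X Y Y' : lin33 f -> conv3 f Z X (Y + Y') = conv3 f Z X Y + conv3 f Z X Y'.
Proof. by move=> fl; rewrite /conv3 -totD; apply: eq_tot => i; exact: convDr. Qed.

Lemma conv3_bCC f g k k' k'' a b c Z X Y : lin31 f -> lin32 f -> lin33 f ->
  CC k Z -> CC k' X -> CC k'' Y ->
  (forall s t n n' n'' z x y, hom n k z -> hom n' k' x -> hom n'' k'' y ->
     sdiff s t (f z x y) + a *: f (sdiff s t z) x y + b *: f z (sdiff s t x) y
       + c *: f z x (sdiff s t y) = t *: g z x y) ->
  bCC (conv3 f Z X Y) + a *: conv3 f (bCC Z) X Y + b *: conv3 f Z (bCC X) Y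
    + c *: conv3 f Z X (bCC Y) = sh (conv3 g Z X Y).
Proof.
move=> f1 f2 f3 hZ hX hY H; rewrite !bCCE conv3D1 // conv3D2 // conv3D3 //.
rewrite conv3_sh1 // conv3_sh2 // conv3_sh3 //.
pose T (D : ccw C -> ccw C) n := D (conv3 f Z X Y n) + a *: conv3 f (fun n => D (Z n)) X Y n
    + b *: conv3 f Z (fun n => D (X n)) Y n + c *: conv3 f Z X (fun n => D (Y n)) n.
have TE (D : {linear ccw C -> ccw C}) s t :
  (forall x, sdiff s t x = D x) -> forall n, T D n = t *: conv3 g Z X Y n.
  move=> DE n; rewrite /T (tot_map _ _ _ (linearP D)) /conv3 /tot !scaler_sumr -!big_split.
  apply: eq_bigr => i _ /=; rewrite (tot_map _ _ _ (linearP D)) /conv /tot.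
  rewrite !scaler_sumr -!big_split; apply: eq_bigr => j _ /=.
  by have := H s t _ _ _ _ _ _ (hZ i) (hX j) (hY (n - i - j)%N); rewrite !DE.
have -> : sh (conv3 g Z X Y) = sh ((fun n => bcop C (conv3 f Z X Y n))
   + a *: conv3 f (fun n => bcop C (Z n)) X Y + b *: conv3 f Z (fun n => bcop C (X n)) Y
   + c *: conv3 f Z X (fun n => bcop C (Y n))).
  by congr sh; apply/funext => n; have := TE _ _ _ (@bst01 K m C) n; rewrite scale1r => <-.
have E : (fun n => bint C (conv3 f Z X Y n))
   + a *: conv3 f (fun n => bint C (Z n)) X Y + b *: conv3 f Z (fun n => bint C (X n)) Y
   + c *: conv3 f Z X (fun n => bint C (Y n)) = 0.
  by apply/funext => n; have := TE _ _ _ (@bst10 K m C) n; rewrite scale0r.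
rewrite !shD !shZ !scalerDr [X in X + _ + _ = _]addrACA [X in X + _ = _]addrACA [LHS]addrACA.
by rewrite E add0r.
Qed.

(** On cycles the terms with b X and b Y vanish whatever their coefficients, so these are only
    required to exist. *)
Lemma conv_cycle f g k k' X Y : lin1 f -> lin2 f -> CC k X -> CC k' Y ->
  bCC X = 0 -> bCC Y = 0 ->
  (exists a b, forall s t n n' x y, hom n k x -> hom n' k' y ->
     sdiff s t (f x y) + a *: f (sdiff s t x) y + b *: f x (sdiff s t y) = t *: g x y) ->
  bCC (conv f X Y) = sh (conv g X Y).
Proof.
move=> f1 f2 hX hY bX bY [a [b H]].
have := conv_bCC f1 f2 hX hY H; rewrite bX bY.
have -> : conv f 0 Y = 0 by have := convDl 0 0 Y f1; rewrite addr0 => /eqP;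
  rewrite -[X in X == _]addr0 => /eqP/addrI.
have -> : conv f X 0 = 0 by have := convDr X 0 0 f2; rewrite addr0 => /eqP;
  rewrite -[X in X == _]addr0 => /eqP/addrI.
by rewrite !scaler0 !addr0.
Qed.

Lemma conv3_cycle f g k k' k'' Z X Y : lin31 f -> lin32 f -> lin33 f ->
  CC k Z -> CC k' X -> CC k'' Y -> bCC Z = 0 -> bCC X = 0 -> bCC Y = 0 ->
  (exists a b c, forall s t n n' n'' z x y, hom n k z -> hom n' k' x -> hom n'' k'' y ->
     sdiff s t (f z x y) + a *: f (sdiff s t z) x y + b *: f z (sdiff s t x) y
       + c *: f z x (sdiff s t y) = t *: g z x y) ->
  bCC (conv3 f Z X Y) = sh (conv3 g Z X Y).
Proof.
move=> f1 f2 f3 hZ hX hY bZ bX bY [a [b [c H]]].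
have := conv3_bCC f1 f2 f3 hZ hX hY H; rewrite bZ bX bY.
have -> : conv3 f 0 X Y = 0 by have := conv3D1 0 0 X Y f1; rewrite addr0 => /eqP;
  rewrite -[X in X == _]addr0 => /eqP/addrI.
have -> : conv3 f Z 0 Y = 0 by have := conv3D2 Z 0 0 Y f2; rewrite addr0 => /eqP;
  rewrite -[X in X == _]addr0 => /eqP/addrI.
have -> : conv3 f Z X 0 = 0 by have := conv3D3 Z X 0 0 f3; rewrite addr0 => /eqP;
  rewrite -[X in X == _]addr0 => /eqP/addrI.
by rewrite !scaler0 !addr0.
Qed.

Lemma CC0 k : @CC K m C k 0. Proof. by move=> n; exact: hom0. Qed.
Lemma CC_lin k a X Y : CC k X -> CC k Y -> CC k (a *: X + Y).
Proof. by move=> hX hY n; exact: (span_lin a (hX n) (hY n)). Qed.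

Lemma CC_conv f d k k' X Y :
  (forall n n' x y, hom n k x -> hom n' k' y -> hom (n + n') d (f x y)) ->
  CC k X -> CC k' Y -> CC d (conv f X Y).
Proof.
move=> fd hX hY n; apply: hom_sum => i _.
by have := fd _ _ _ _ (hX i) (hY (n - i)%N); rewrite subnKC // -ltnS.
Qed.

Lemma CC_dot k k' X Y : CC k X -> CC k' Y -> CC (k + k' - m) (dotCC X Y).
Proof. by apply: CC_conv => *; exact: hom_dot. Qed.

Lemma CC_bCC k X : CC k X -> CC (k - 1) (bCC X).
Proof.
move=> hX n; apply: homD; first exact: (hom_bint (hX n)).
by case: n => [|n]; [exact: hom0 | exact: (hom_bcop (hX n))].
Qed.

Lemma CC_BCC k X : CC k X -> CC (k + 1) (BCC X).
Proof. by move=> hX n; exact: (hom_connes (hX n.+1)). Qed.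

(** iota and circ lose one tail letter, theta1 and theta two, so a component of length n comes from
    lengths adding up to n + 1 or n + 2. *)
Definition iotaCC Z X : fam := fun n => conv iota Z X n.+1.
Definition circCC X Y : fam := fun n => conv circ X Y n.+1.
Definition theta1CC Z X : fam := fun n => conv theta1 Z X n.+2.
Definition thetaCC Z X Y : fam := fun n => conv3 theta Z X Y n.+2.

Lemma lin1_dot : lin1 dot. Proof. by move=> y; exact: (lin_dot1 y (@lin_id _ _)). Qed.
Lemma lin2_dot : lin2 dot. Proof. by move=> y; exact: (lin_dot2 y (@lin_id _ _)). Qed.
Lemma lin1_iota : lin1 iota. Proof. by move=> y; exact: (lin_iota1 y (@lin_id _ _)). Qed.
Lemma lin2_iota : lin2 iota. Proof. by move=> y; exact: (lin_iota2 y (@lin_id _ _)). Qed.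
Lemma lin1_circ : lin1 circ. Proof. by move=> y; exact: (lin_circ1 y (@lin_id _ _)). Qed.
Lemma lin2_circ : lin2 circ. Proof. by move=> y; exact: (lin_circ2 y (@lin_id _ _)). Qed.
Lemma lin1_theta1 : lin1 theta1. Proof. by move=> y; exact: (lin_theta11 y (@lin_id _ _)). Qed.
Lemma lin2_theta1 : lin2 theta1. Proof. by move=> y; exact: (lin_theta12 y (@lin_id _ _)). Qed.
Lemma lin31_theta : lin31 theta. Proof. by move=> x y; exact: (lin_theta_1 x y (@lin_id _ _)). Qed.
Lemma lin32_theta : lin32 theta. Proof. by move=> x y; exact: (lin_theta_2 x y (@lin_id _ _)). Qed.
Lemma lin33_theta : lin33 theta. Proof. by move=> x y; exact: (lin_theta_3 x y (@lin_id _ _)). Qed.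

Lemma circ_hom0 k n' k' x y : hom 0 k x -> hom n' k' y -> circ x y = 0.
Proof.
move=> hx; move: y; apply: (hom_eq (h := fun=> 0)).
- exact: lin2_circ.
- by move=> a u v; rewrite scaler0 addr0.
move=> e q _ _ rq; move: x hx; apply: (hom_eq (h := fun=> 0)).
- exact: lin1_circ.
- by move=> a u v; rewrite scaler0 addr0.
by move=> c [|//] p _ rp; rewrite circ_red // /circw !scaler0.
Qed.

Lemma theta1_hom_le1 n k n' k' z x : (n' <= 1)%N -> hom n k z -> hom n' k' x -> theta1 z x = 0.
Proof.
move=> n'1 hz; move: x; apply: (hom_eq (h := fun=> 0)).
- exact: lin2_theta1.
- by move=> a u v; rewrite scaler0 addr0.
move=> e q sq _ rq; move: z hz; apply: (hom_eq (h := fun=> 0)).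
- exact: lin1_theta1.
- by move=> a u v; rewrite scaler0 addr0.
move=> c p _ rp rp'; rewrite theta1_red // /theta1w.
by case: q sq rq n'1 => [|a [|? ?]] /= <- _ //= _; rewrite !(scaler0, addr0).
Qed.

Lemma theta_hom_le1 n k n' k' n'' k'' z x y : (n' <= 1)%N ->
  hom n k z -> hom n' k' x -> hom n'' k'' y -> theta z x y = 0.
Proof.
move=> n'1 hz hx; move: y; apply: (hom_eq (h := fun=> 0)).
- exact: lin33_theta.
- by move=> a u v; rewrite scaler0 addr0.
move=> d r _ _ rr; move: x hx; apply: (hom_eq (h := fun=> 0)).
- exact: lin32_theta.
- by move=> a u v; rewrite scaler0 addr0.
move=> e q sq _ rq; move: z hz; apply: (hom_eq (h := fun=> 0)).
- exact: lin31_theta.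
- by move=> a u v; rewrite scaler0 addr0.
move=> c p _ rp rp'; rewrite theta_red // /thetaw.
by case: q sq rq n'1 => [|a [|? ?]] /= <- _ //= _; rewrite !(scaler0, addr0).
Qed.

(** The component dropped by the index shift vanishes, as there is no letter to contract. Identities
    of chains are then proved under the injective [sh], which avoids subtraction on lengths. *)
Lemma iota_sh k k' Z X : CC k Z -> CC k' X -> conv iota Z X = sh (iotaCC Z X).
Proof. by move=> hZ hX; apply: sh_tail; rewrite /conv /tot big_ord1 (iota_hom0 (hZ _) (hX _)). Qed.

Lemma circ_sh k k' X Y : CC k X -> CC k' Y -> conv circ X Y = sh (circCC X Y).
Proof. by move=> hX hY; apply: sh_tail; rewrite /conv /tot big_ord1 (circ_hom0 (hX _) (hY _)). Qed.

Lemma sh2_tail (V : lmodType K) (X : nat -> V) : X 0%N = 0 -> X 1%N = 0 -> X = sh (sh (fun n => X n.+2)).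
Proof. by move=> X0 X1; rewrite {1}(sh_tail X0) {1}(sh_tail (X := fun n => X n.+1)). Qed.

Lemma theta1_sh k k' Z X : CC k Z -> CC k' X -> conv theta1 Z X = sh (sh (theta1CC Z X)).
Proof.
move=> hZ hX; apply: sh2_tail; rewrite /conv /tot !big_ord_recl big_ord0.
  by rewrite (theta1_hom_le1 _ (hZ _) (hX _)) // addr0.
by rewrite !(theta1_hom_le1 _ (hZ _) (hX _)) // !addr0.
Qed.

Lemma theta_sh k k' k'' Z X Y : CC k Z -> CC k' X -> CC k'' Y ->
  conv3 theta Z X Y = sh (sh (thetaCC Z X Y)).
Proof.
move=> hZ hX hY; apply: sh2_tail; rewrite /conv3 /conv /tot big1 // => i _; rewrite big1 // => j _;
  rewrite (theta_hom_le1 _ (hZ _) (hX _) (hY _)) // -ltnS;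
  by have := ltn_ord i; have := ltn_ord j; lia.
Qed.

End FamilyOperations.

(** * Homotopy identities on Hochschild chains *)

Section CyclicComplex.
Variables (K : fieldType) (m : int) (C : openFrobenius K m).
Notation dot := (@dot K m C).
Notation iota := (@iota_op K m C).
Notation circ := (@circ_op K m C).
Notation fam := (nat -> ccw C).
Notation conv := (@conv K m C).
Notation conv3 := (@conv3 K m C).
Implicit Types (X Y Z W : fam).

Lemma dotCC_linear1 Y : linear (fun X => dotCC X Y).
Proof. by move=> a X X'; apply: (tot_linear a X X' (G := fun x j => dot x (Y j))) => n; exact: lin1_dot. Qed.

Lemma dotCC_linear2 X : linear (dotCC X).
Proof.
move=> a Y Y'; rewrite [LHS](_ : _ = conv (fun x y => dot x y) X (a *: Y + Y')) //.
rewrite convDr; last exact: lin2_dot.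
congr (_ + _); rewrite [RHS](_ : _ = a *: conv dot X Y) // -totZ; apply: eq_tot => i.
by apply/funext => n; have := lin2_dot (X i) a (Y n) 0; rewrite !addr0 (lin0 (@lin2_dot _ _ _ _)) addr0.
Qed.

Lemma dotCC_sh1 X Y : dotCC (sh X) Y = sh (dotCC X Y).
Proof. exact: (conv_shl X Y (@lin1_dot K m C)). Qed.

Lemma dotCC_sh2 X Y : dotCC X (sh Y) = sh (dotCC X Y).
Proof. exact: (conv_shr X Y (@lin2_dot K m C)). Qed.

Lemma dotCC_assoc x y z X Y Z : CC x X -> CC y Y -> CC z Z ->
  dotCC (dotCC X Y) Z = (-1) ^ (m * x + m) *: dotCC X (dotCC Y Z).
Proof.
move=> hX hY hZ; rewrite -[LHS]/(conv dot (conv dot X Y) Z).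
rewrite (conv_convl dot X Y Z (@lin1_dot K m C)).
rewrite -[dotCC X _]/(conv dot X (conv dot Y Z)) (conv_convr dot X Y Z (@lin2_dot K m C)).
rewrite -[RHS]addr0 -(scale0r (conv3 (fun x y z => dot x (dot y z)) X Y Z)) -conv3_comb.
by apply: eq_conv3 => i j l; rewrite scale0r addr0; exact: (dot_assoc (hX i) (hY j) (hZ l)).
Qed.

Lemma bCC_dot x y X Y : CC x X -> CC y Y ->
  bCC (dotCC X Y) = (-1) ^ m *: (dotCC (bCC X) Y + (-1) ^ x *: dotCC X (bCC Y)).
Proof.
move=> hX hY; apply/eqP; rewrite -subr_eq0 scalerDr opprD addrA -!scaleNr scalerA; apply/eqP.
have := conv_bCC (f := dot) (g := fun _ _ => 0) (@lin1_dot K m C) (@lin2_dot K m C) hX hY.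
move=> ->; first by apply/funext => -[|n] //; rewrite /sh /conv /tot big1.
move=> s t n n' u v hu hv; rewrite (dot_bst s t hu hv) scaler0.
by koszul.
Qed.

Lemma BCC_dot x y X Y : CC x X -> CC y Y ->
  BCC (dotCC X Y) = circCC X Y + (-1) ^ (x * y + m) *: circCC Y X.
Proof.
move=> hX hY; apply: sh_inj; rewrite shD shZ -(circ_sh hX hY) -(circ_sh hY hX).
rewrite -(scale1r (conv circ X Y)) -[conv circ Y X]conv_swap -conv_comb.
have -> : sh (BCC (dotCC X Y)) = fun n => Bop C (conv dot X Y n).
  apply/funext => -[|n] //=; rewrite /conv /tot big_ord1 /=.
  by have := connes_hom0 (hom_dot (hX 0%N) (hY 0%N)) => ->.
apply/funext => n; rewrite (tot_map _ _ _ (linearP (Bop C))); congr (_ n).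
apply: eq_tot => i; apply/funext => j; rewrite scale1r.
exact: (connes_dot (hX i) (hY j)).
Qed.

Lemma iotaCC_dot z x y Z X Y (d := z - m + 1) : CC z Z -> CC x X -> CC y Y ->
  iotaCC Z (dotCC X Y) =
  (-1) ^ (d * m) *: (dotCC (iotaCC Z X) Y + (-1) ^ (d * x) *: dotCC X (iotaCC Z Y)).
Proof.
move=> hZ hX hY; apply: sh_inj; rewrite shZ shD shZ -dotCC_sh1 -dotCC_sh2.
rewrite -(iota_sh hZ hX) -(iota_sh hZ hY) -(iota_sh hZ (CC_dot hX hY)).
rewrite -[LHS]/(conv iota Z (conv dot X Y)).
rewrite (conv_convr dot Z X Y (@lin2_iota K m C)).
rewrite -[dotCC X _]/(conv dot X (conv iota Z Y)) (conv_convr iota X Z Y (@lin2_dot K m C)).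
rewrite -[dotCC _ Y]/(conv dot (conv iota Z X) Y) (conv_convl iota Z X Y (@lin1_dot K m C)).
rewrite [conv3 _ X Z Y]conv3_swap scalerDr scalerA -conv3_comb.
apply: eq_conv3 => i j l; rewrite (iota_dot (hZ i) (hX j) (hY l)) scalerDr scalerA.
by [].
Qed.

Lemma bCC_iota z x Z X : CC z Z -> CC x X -> bCC Z = 0 -> bCC X = 0 ->
  bCC (iotaCC Z X) = (-1) ^ m *: dotCC Z X - (-1) ^ (z * x) *: dotCC X Z.
Proof.
move=> hZ hX bZ bX; apply: sh_inj; rewrite -bCC_sh -(iota_sh hZ hX).
rewrite (@conv_cycle _ _ _ _ (fun z' x' => (-1) ^ m *: dot z' x' + - (-1) ^ (z * x) *: dot x' z')
   _ _ _ _ (@lin1_iota K m C) (@lin2_iota K m C) hZ hX) //.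
  by rewrite conv_comb (conv_swap dot Z X) scaleNr.
exists ((-1) ^ m), (- (-1) ^ (z - m + 1)) => s t n n' u v hu hv.
by rewrite !scaleNr -(iota_bst s t hu hv) addrAC.
Qed.

Lemma bCC_theta1 z x Z X : CC z Z -> CC x X -> bCC Z = 0 -> bCC X = 0 ->
  bCC (theta1CC Z X) = (-1) ^ (z - m + 1) *: iotaCC Z X + (-1) ^ m *: dotCC Z (BCC X)
    + (-1) ^ (m + 1 + z * (x + 1)) *: circCC X Z.
Proof.
(* theta1 lowers lengths by two, hence two shifts. [conv_cycle] accounts for one of them, since b
   raises lengths; the other matches the letter lost by iota, circ and B. *)
move=> hZ hX bZ bX; apply: sh_inj; apply: sh_inj; rewrite -!bCC_sh -(theta1_sh hZ hX).
rewrite (@conv_cycle _ _ _ _ (fun z' x' => (-1) ^ (z - m + 1) *: iota z' x'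
     + 1 *: ((-1) ^ m *: dot z' (Bop C x') + (-1) ^ (m + 1 + z * (x + 1)) *: circ x' z'))
   _ _ _ _ (@lin1_theta1 K m C) (@lin2_theta1 K m C) hZ hX) //; last first.
  exists ((-1) ^ m), ((-1) ^ (z - m + 1)) => s t n n' u v hu hv.
  by rewrite scale1r addrA -(theta1_bst s t hu hv) addrAC.
congr sh; rewrite !conv_comb !shD !shZ scale1r addrA.
rewrite -(iota_sh hZ hX) (conv_swap circ Z X) (circ_sh hX hZ); congr (_ + _ *: _ + _).
rewrite -dotCC_sh2; apply: (eq_tot (H := fun z' j => dot z' (sh (BCC X) j))) => i.
by apply/funext => -[|j] //=; rewrite (connes_hom0 (hX 0%N)).
Qed.

Lemma bCC_theta z x y Z X Y : CC z Z -> CC x X -> CC y Y -> bCC Z = 0 -> bCC X = 0 -> bCC Y = 0 ->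
  bCC (thetaCC Z X Y) = (-1) ^ ((m + 1) * (z + 1)) *: dotCC (iotaCC Z X) Y
    + (-1) ^ m *: dotCC Z (circCC X Y)
    + (-1) ^ (m + 1 + (z + m) * (x + m + 1)) *: circCC X (dotCC Z Y).
Proof.
move=> hZ hX hY bZ bX bY; apply: sh_inj; apply: sh_inj; rewrite -!bCC_sh -(theta_sh hZ hX hY).
rewrite (@conv3_cycle _ _ _ _ (fun z' x' y' => (-1) ^ ((m + 1) * (z + 1)) *: dot (iota z' x') y'
    + 1 *: ((-1) ^ m *: dot z' (circ x' y')
    + (-1) ^ (m + 1 + (z + m) * (x + m + 1)) *: circ x' (dot z' y')))
   _ _ _ _ _ _ (@lin31_theta K m C) (@lin32_theta K m C) (@lin33_theta K m C) hZ hX hY) //; last first.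
  exists ((-1) ^ m), ((-1) ^ (z - m + 1 + m)), ((-1) ^ (z - m + 1 + m + x)) => s t n n' n'' u v w hu hv hw.
  by rewrite scale1r addrA -(theta_bst s t hu hv hw) addrAC; koszul.
congr sh; rewrite !conv3_comb !shD !shZ scale1r addrA.
rewrite -dotCC_sh1 -dotCC_sh2 -(iota_sh hZ hX) -(circ_sh hX hY) -(circ_sh hX (CC_dot hZ hY)).
congr (_ *: _ + _ *: _ + _ *: _).
- by rewrite -[RHS]/(conv dot (conv iota Z X) Y) (conv_convl iota Z X Y (@lin1_dot K m C)).
- by rewrite -[RHS]/(conv dot Z (conv circ X Y)) (conv_convr circ Z X Y (@lin2_dot K m C)).
by rewrite (conv_convr dot X Z Y (@lin2_circ K m C)) -conv3_swap.
Qed.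

Lemma bCC_BCC x X : CC x X -> bCC (BCC X) + BCC (bCC X) = 0.
Proof.
move=> hX; apply/funext => n; rewrite -[LHS]/(bCC (BCC X) n + BCC (bCC X) n) /bCC /BCC.
rewrite linearD addrACA -!bst10 (connes_bst 1 0 (hX n.+1)) add0r -bst01.
case: n => [|n]; last by rewrite -!bst01 (connes_bst 0 1 (hX n.+1)).
by have := connes_bst 0 1 (hX 0%N); rewrite (connes_hom0 (hX 0%N)) bst01 linear0.
Qed.

Lemma BCC_BCC x X : CC x X -> BCC (BCC X) = 0.
Proof. by move=> hX; apply/funext => n; exact: (connes_connes (hX n.+2)). Qed.

End CyclicComplex.

(** * The second-order relation *)

Section BV.
Variables (K : fieldType) (m : int) (C : openFrobenius K m).
Notation fam := (nat -> ccw C).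
Implicit Types (X Y Z W : fam).

Lemma dotCCDl X X' Y : dotCC (X + X') Y = dotCC X Y + dotCC X' Y.
Proof. by have := dotCC_linear1 Y 1 X X'; rewrite !scale1r. Qed.
Lemma dotCCDr X Y Y' : dotCC X (Y + Y') = dotCC X Y + dotCC X Y'.
Proof. by have := dotCC_linear2 X 1 Y Y'; rewrite !scale1r. Qed.
Lemma dotCCZl a X Y : dotCC (a *: X) Y = a *: dotCC X Y.
Proof. by rewrite (linZ_of a X (dotCC_linear1 Y)). Qed.
Lemma dotCCZr a X Y : dotCC X (a *: Y) = a *: dotCC X Y.
Proof. by rewrite (linZ_of a Y (dotCC_linear2 X)). Qed.

Lemma dotCC0l Y : dotCC 0 Y = 0. Proof. exact: (lin0 (dotCC_linear1 Y)). Qed.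
Lemma dotCC0r X : dotCC X 0 = 0. Proof. exact: (lin0 (dotCC_linear2 X)). Qed.
Lemma bCCD X Y : bCC (X + Y) = bCC X + bCC Y. Proof. exact: linearD. Qed.
Lemma bCCZ a X : bCC (a *: X) = a *: bCC X. Proof. exact: linearZ. Qed.

Lemma CC_theta1 z x Z X : CC z Z -> CC x X -> CC (z + x - m + 2) (theta1CC Z X).
Proof.
move=> hZ hX n; apply: hom_sum => i _.
have := hom_theta1 (hZ i) (hX (n.+2 - i)%N).
by rewrite subnKC // -ltnS.
Qed.

Lemma CC_theta z x y Z X Y : CC z Z -> CC x X -> CC y Y ->
  CC (z + x + y - m - m + 2) (thetaCC Z X Y).
Proof.
move=> hZ hX hY n; apply: hom_sum => i _; apply: hom_sum => j _.
have := hom_theta (hZ i) (hX j) (hY (n.+2 - i - j)%N).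
have := ltn_ord i; have := ltn_ord j => h1 h2.
by rewrite (_ : (i + j + _).-2 = n) //; lia.
Qed.

Lemma bv_chain z x y Z X Y : CC z Z -> CC x X -> CC y Y ->
  bCC Z = 0 -> bCC X = 0 -> bCC Y = 0 -> BCC Z = 0 -> BCC X = 0 ->
  exists2 W, CC (z + x + y - m - m + 2) W &
    bCC W = BCC (dotCC Z (dotCC X Y)) -
      ((-1) ^ (m * z) *: dotCC (BCC (dotCC Z X)) Y
       + (-1) ^ ((x + m) * (z + m + 1)) *: dotCC X (BCC (dotCC Z Y))
       + (-1) ^ (z + m) *: dotCC Z (BCC (dotCC X Y))
       + (-1) ^ (z + m + 1 + (z + m + 1) * (x + m)) *: dotCC X (dotCC Z (BCC Y))).
Proof.
move=> hZ hX hY bZ bX bY BZ BX.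
have hXY := CC_dot hX hY; have hZY := CC_dot hZ hY.
have bXY : bCC (dotCC X Y) = 0.
  by rewrite (bCC_dot hX hY) bX bY dotCC0l dotCC0r scaler0 addr0 scaler0.
(* B(Z X Y) is circ Z (X Y) plus circ (X Y) Z up to signs. The boundary of theta X Z Y contains the
   former, together with X circ(Z, Y) and (iota X Z) Y; that of theta1 Z (X Y) contains the latter,
   together with Z B(X Y) and iota Z (X Y), which [iotaCC_dot] expands into two terms. The last
   three summands cancel these three iota terms; their circ terms complete B(Z X) Y and X B(Z Y),
   and the last one also gives X Z B(Y). The signs are forced by these cancellations. *)
exists ((-1) ^ (m + 1 + (x + m) * (z + m + 1)) *: thetaCC X Z Y
  + (-1) ^ (z + 1) *: theta1CC Z (dotCC X Y)
  + (-1) ^ (1 + m + 1 + (x + m) * (z + m + 1) + (m + 1) * (x + 1) + m + x - m + 1)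
      *: dotCC (theta1CC X Z) Y
  + (-1) ^ (1 + z + 1 + (z - m + 1) * m + m) *: dotCC (theta1CC Z X) Y
  + (-1) ^ (1 + z + 1 + (z - m + 1) * m + (z - m + 1) * x + m + x) *: dotCC X (theta1CC Z Y)).
  have h1 := CC_theta hX hZ hY; have h2 := CC_theta1 hZ hXY.
  have h3 := CC_dot (CC_theta1 hX hZ) hY; have h4 := CC_dot (CC_theta1 hZ hX) hY.
  have h5 := CC_dot hX (CC_theta1 hZ hY).
  have cast k k' (U : fam) : CC k U -> k = k' -> CC k' U by move=> hU <-.
  have cc0 := CC0 C (z + x + y - m - m + 2).
  have addC k (U U' : fam) : CC k U -> CC k U' -> CC k (U + U').
    by move=> hU hU'; have := CC_lin 1 hU hU'; rewrite scale1r.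
  have sclC k a (U : fam) : CC k U -> CC k (a *: U).
    by move=> hU; have := CC_lin a hU (CC0 C k); rewrite addr0.
  apply: (addC _ _ _ (addC _ _ _ (addC _ _ _ (addC _ _ _ _ _) _) _) _); apply: (sclC);
    [apply: cast h1 _|apply: cast h2 _|apply: cast h3 _|apply: cast h4 _|apply: cast h5 _]; lia.
rewrite !bCCD !bCCZ.
rewrite (bCC_theta hX hZ hY bX bZ bY) (bCC_theta1 hZ hXY bZ bXY).
rewrite (bCC_dot (CC_theta1 hX hZ) hY) (bCC_dot (CC_theta1 hZ hX) hY).
rewrite (bCC_dot hX (CC_theta1 hZ hY)) bX bY.
rewrite !dotCC0l !dotCC0r !scaler0 !addr0 !add0r.
rewrite (bCC_theta1 hX hZ bX bZ) (bCC_theta1 hZ hX bZ bX) (bCC_theta1 hZ hY bZ bY).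
(* The boundaries of theta1 X Z and theta1 Z X would otherwise contribute X (B Z) Y and Z (B X)
   Y. *)
rewrite BZ BX !dotCC0r !scaler0 !addr0.
rewrite (iotaCC_dot hZ hX hY) (BCC_dot hZ hXY) (BCC_dot hZ hX) (BCC_dot hZ hY).
rewrite !(dotCCDl, dotCCDr, dotCCZl, dotCCZr).
by koszul.
Qed.

End BV.

(** * Homology *)

Section HomologyTheory.
Variables (K : pzRingType) (V : lmodType K) (H : int -> set V).
Variable D : {linear V -> V}.
Notation cyc := (cyclep H D).
Notation cls := (hclass H D).

Lemma cycP x : reflect (chains H x /\ D x = 0) (cyc x).
Proof. exact: asboolP. Qed.

Lemma chains_gen k x : H k x -> chains H x.
Proof. by move=> hx; apply: span_gen; exists k. Qed.

Lemma cyc_hom k x : H k x -> D x = 0 -> cyc x.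
Proof. by move=> hx Dx; apply/cycP; split => //; exact: chains_gen hx. Qed.

Lemma val_insub_cyc x : cyc x -> val (insubd (0 : cycles H D) x) = x.
Proof. by move=> cx; rewrite val_insubd cx. Qed.

Lemma cyc_lin a x y : cyc x -> cyc y -> cyc (a *: x + y).
Proof. exact: (cyclep_submod H D).2. Qed.

Lemma hclass_lin a x y : cyc x -> cyc y -> cls (a *: x + y) = a *: cls x + cls y.
Proof.
move=> cx cy; rewrite /hclass -linearP; congr (qpi _ _); apply: val_inj.
transitivity (a *: x + y); first by rewrite val_insub_cyc //; exact: cyc_lin.
by rewrite -{1}(val_insub_cyc cx) -{1}(val_insub_cyc cy).
Qed.

Lemma cyc_hrepr (t : homology H D) : cyc (hrepr t). Proof. exact: valP. Qed.

Lemma hreprK (t : homology H D) : cls (hrepr t) = t.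
Proof. by rewrite /hclass /hrepr -[RHS]qreprK; congr (qpi _ _); exact: valKd. Qed.

(** The boundaries already form a subspace, so the span in the definition of the quotient adds
    nothing. *)
Lemma hclass_eq x y : cyc x -> cyc y ->
  cls x = cls y <-> exists2 w, chains H w & D w = x - y.
Proof.
move=> cx cy; split.
  move=> /qpiP[s [sP E]].
  have {E} : x - y = val (\sum_(p <- s) p.1 *: p.2) by rewrite -E raddfB /= !val_insub_cyc.
  move=> ->; elim: s sP => [|p s IHs] sP.
    by exists 0; [exact: span0 | rewrite linear0 big_nil].
  have [u Cu Du] := IHs (fun q qs => sP q (@mem_behead _ (p :: s) q qs)).
  have [v Cv Dv] := sP p (mem_head _ _).
  exists (p.1 *: v + u); first exact: span_lin.
  rewrite linearP Du Dv big_cons.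
  have vl (b : K) (u1 u2 : cycles H D) : val (b *: u1 + u2) = b *: val u1 + val u2 by [].
  by rewrite vl.
move=> [w Cw Dw]; apply/qpiP/span_gen; exists w => //.
by rewrite raddfB /= !val_insub_cyc.
Qed.

Lemma hclass0 : cls 0 = 0.
Proof.
have c0 : cyc 0 := (cyclep_submod H D).1.
by have := hclass_lin (-1) c0 c0; rewrite !scaleN1r oppr0 addr0 addNr.
Qed.

Lemma hclassD x y : cyc x -> cyc y -> cls (x + y) = cls x + cls y.
Proof. by move=> cx cy; rewrite -[x]scale1r hclass_lin // !scale1r. Qed.

Lemma hclassZ a x : cyc x -> cls (a *: x) = a *: cls x.
Proof.
move=> cx; have := hclass_lin a cx (cyclep_submod H D).1.
by rewrite addr0 hclass0 addr0.
Qed.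

Lemma hclass_eq0 x : cyc x -> (exists2 w, chains H w & D w = x) -> cls x = 0.
Proof.
move=> cx [w Cw Dw]; rewrite -hclass0; apply/(hclass_eq cx (cyclep_submod H D).1).
by exists w => //; rewrite subr0.
Qed.

Lemma hrepr_hclass x : cyc x -> exists2 w, chains H w & D w = hrepr (cls x) - x.
Proof. by move=> cx; apply/(hclass_eq (cyc_hrepr _) cx); rewrite hreprK. Qed.

Hypothesis H_lin : forall k a x y, H k x -> H k y -> H k (a *: x + y).
Hypothesis H_0 : forall k, H k 0.
Hypothesis H_D : forall k x, H k x -> H (k - 1) (D x).
(** The sum of the [H k] need not exhaust V, which for chains is a product over lengths; the
    projections are therefore specified on the [H k] only. *)
Variable p : int -> V -> V.
Hypothesis p_lin : forall k, linear (p k).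
Hypothesis p_id : forall k x, H k x -> p k x = x.
Hypothesis p_0 : forall k j x, j != k -> H j x -> p k x = 0.

(** Quantifying over all duplicate-free lists that contain s lets the induction add a degree whether
    or not it has occurred before. *)
Lemma chains_proj x : chains H x ->
  (exists s : seq int, forall r, uniq r -> {subset s <= r} -> x = \sum_(k <- r) p k x) /\
  forall k, H k (p k x).
Proof.
move=> [l [lH ->]]; elim: l lH => [|[a v] l IHl] lH.
  have p0 k : p k 0 = 0 by have := p_lin k (-1) 0 0; rewrite !scaleN1r oppr0 addr0 addNr.
  rewrite big_nil; split; last by move=> k; rewrite p0.
  by exists [::] => r _ _; rewrite big1.
have [[s sP] HP] := IHl (fun q ql => lH q (@mem_behead _ ((a, v) :: l) q ql)); rewrite big_cons /=.
have [j vj] : exists j, H j v := lH (a, v) (mem_head _ _).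
have Hv k : H k (p k v).
  by have [e|/p_0/(_ vj)->] := eqVneq j k; rewrite // -e p_id.
split; last by move=> k; rewrite p_lin; exact: H_lin.
exists (j :: s) => r ur sr; under [RHS]eq_bigr => k _ do rewrite p_lin.
rewrite [RHS]big_split -scaler_sumr -(sP r ur) => [|k ks]; last by apply: sr; rewrite inE ks orbT.
congr (_ *: _ + _); rewrite (bigD1_seq j) ?sr ?mem_head //= big1 => [|k kj].
  by rewrite p_id // addr0.
by apply: p_0 vj; rewrite eq_sym.
Qed.

Lemma proj_D k x : chains H x -> p (k - 1) (D x) = D (p k x).
Proof.
have p0 i : p i 0 = 0 by have := p_lin i (-1) 0 0; rewrite !scaleN1r oppr0 addr0 addNr.
move=> [l [lH ->]]; elim: l lH => [|[a v] l IHl] lH; first by rewrite big_nil !(p0, linear0).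
rewrite big_cons p_lin !linearP p_lin IHl => [|q ql]; last exact: lH (@mem_behead _ ((a, v) :: l) q ql).
congr (_ *: _ + _); have [j vj] : exists j, H j v := lH (a, v) (mem_head _ _).
have [e|jk] := eqVneq j k; first by rewrite -e !p_id //; exact: H_D.
by rewrite (p_0 jk vj) linear0 (p_0 _ (H_D vj)) // (inj_eq (addIr _)).
Qed.

Lemma cyc_sum (s : seq int) (F : int -> V) : (forall k, cyc (F k)) ->
  cyc (\sum_(k <- s) F k) /\ cls (\sum_(k <- s) F k) = \sum_(k <- s) cls (F k).
Proof.
move=> cF; elim: s => [|k s [IH1 IH2]].
  by rewrite !big_nil hclass0; split=> //; exact: (cyclep_submod H D).1.
rewrite !big_cons hclassD // IH2; split=> //.
by rewrite -[F k]scale1r; exact: cyc_lin.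
Qed.

Lemma hdeg_grading : is_grading (hdeg (H := H) (D := D)).
Proof.
split=> [k|t|s f us fH sf0].
- split=> [|a _ _ [z [Hz Dz ->]] [z' [Hz' Dz' ->]]].
    by exists 0; split=> //; rewrite ?linear0 ?hclass0.
  exists (a *: z + z'); split; first exact: H_lin.
    by rewrite linearP /= Dz Dz' scaler0 addr0.
  by rewrite hclass_lin //; apply: cyc_hom; eassumption.
- have /cycP[Cx Dx] := cyc_hrepr t; have [[s sP] HP] := chains_proj Cx.
  have Dp k : D (p k (hrepr t)) = 0.
    by rewrite -proj_D // Dx; have := p_lin (k - 1) (-1) 0 0; rewrite !scaleN1r oppr0 addr0 addNr.
  exists (undup s), (fun k => cls (p k (hrepr t))); split; first exact: undup_uniq.
    by move=> k; exists (p k (hrepr t)); split.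
  rewrite -(cyc_sum _ _).2 => [|k]; last exact: cyc_hom (HP k) (Dp k).
  by rewrite -sP ?undup_uniq ?hreprK // => k; rewrite mem_undup.
have /choice[z zP] : forall k, exists z, [/\ H k z, D z = 0 & f k = cls z] by move=> k; exact: fH.
have cz k : cyc (z k) by have [Hz Dz _] := zP k; exact: cyc_hom Hz Dz.
have E : cls (\sum_(k <- s) z k) = 0.
  by rewrite (cyc_sum s cz).2 -[RHS]sf0; apply: eq_bigr => k _; have [_ _ ->] := zP k.
rewrite -hclass0 in E; have [w Cw] := (hclass_eq (cyc_sum s cz).1 (cyclep_submod H D).1).1 E.
rewrite subr0 => Dw k ks; have [Hz Dz ->] := zP k; apply: hclass_eq0 => //.
(* If the sum of the z k bounds w, then z k bounds the component of w in degree k + 1, as D lowers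
   degrees by one. *)
exists (p (k + 1) w); first exact: chains_gen ((chains_proj Cw).2 _).
rewrite -proj_D // addrK Dw.
have pE (r : seq int) : p k (\sum_(j <- r) z j) = \sum_(j <- r) p k (z j).
  elim: r => [|j r IHr]; first by rewrite !big_nil; have := p_lin k (-1) 0 0; rewrite !scaleN1r oppr0 addr0 addNr.
  by rewrite !big_cons -[z j]scale1r p_lin IHr !scale1r.
rewrite pE (bigD1_seq k) //= p_id // big1 ?addr0 // => j jk.
by apply: p_0 jk _; have [] := zP j.
Qed.

End HomologyTheory.

Lemma gshift_grading (K : pzRingType) (V : lmodType K) (H : int -> set V) r :
  is_grading H -> is_grading (gshift H r).
Proof.
move=> [Hl Hd Hi]; split=> [k|x|s f us fH sf0]; first exact: Hl.
  have [s [f [us fH ->]]] := Hd x.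
  exists [seq k - r | k <- s], (fun k => f (k + r)); split.
  - by rewrite map_inj_uniq //; exact: addIr.
  - by move=> k; exact: fH.
  - by rewrite big_map; apply: eq_bigr => k _; rewrite subrK.
move=> k ks; have := Hi [seq j + r | j <- s] (fun j => f (j - r)) _ _ _ (k + r).
rewrite addrK; apply.
- by rewrite map_inj_uniq //; exact: addIr.
- by move=> j; have := fH (j - r); rewrite /gshift subrK.
- by rewrite big_map -[RHS]sf0; apply: eq_bigr => j _; rewrite addrK.
- exact: map_f.
Qed.

(** * Gravity operations of an operator of second order *)

Lemma take_split (T : Type) (d : T) l i j : (i < j)%N -> (j < size l)%N ->
  take j l = take i l ++ nth d l i :: drop i.+1 (take j l).
Proof.
move=> ij jl; have il : (i < size (take j l))%N by rewrite size_take jl.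
by rewrite -{1}(cat_take_drop i (take j l)) (drop_nth d il) nth_take // take_takel // ltnW.
Qed.

Lemma split_nth (T : Type) (d : T) l j : (j < size l)%N ->
  l = take j l ++ nth d l j :: drop j.+1 l.
Proof. by move=> jl; rewrite -drop_nth // cat_take_drop. Qed.

Section BVAlgebra.
Variables (K : fieldType) (m : int) (V : lmodType K).
Variables (deg : int -> set V) (ker : int -> V -> Prop).
Variables (dot : V -> V -> V) (D : V -> V).

(* dot carries the signs of the product of HH, which star removes; bv_dot3 says
   that D is of second order, on elements killed by D. *)
Record is_bv : Prop := {
  bv_deg0 : forall k, deg k 0;
  bv_deg_lin : forall k a s t, deg k s -> deg k t -> deg k (a *: s + t);
  bv_deg_dot : forall i j s t, deg i s -> deg j t -> deg (i + j - m) (dot s t);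
  bv_dot_linr : forall i s a t u, deg i s -> dot s (a *: t + u) = a *: dot s t + dot s u;
  bv_dot_linl : forall i a s t u, deg i s -> deg i t ->
    dot (a *: s + t) u = a *: dot s u + dot t u;
  bv_dotA : forall i j s t u, deg i s -> deg j t -> (exists k, deg k u) ->
    dot (dot s t) u = (-1) ^ (m * i + m) *: dot s (dot t u);
  bv_dotC : forall i j s t, deg i s -> deg j t ->
    dot s t = (-1) ^ (m + i * j) *: dot t s;
  bv_lin : forall a s t, D (a *: s + t) = a *: D s + D t;
  bv_degD : forall k t, deg k t -> deg (k + 1) (D t);
  bv_ker_deg : forall k t, ker k t -> deg k t;
  bv_ker0 : forall k t, ker k t -> D t = 0;
  bv_dot3 : forall z x y s t u, ker z s -> ker x t -> deg y u ->
    D (dot s (dot t u)) =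
      (-1) ^ (m * z) *: dot (D (dot s t)) u
      + (-1) ^ ((x + m) * (z + m + 1)) *: dot t (D (dot s u))
      + (-1) ^ (z + m) *: dot s (D (dot t u))
      + (-1) ^ (z + m + 1 + (z + m + 1) * (x + m)) *: dot t (dot s (D u))
}.

(** The form of [HHstar]: with elements of degree i counted in degree i - m, this product is
    associative and graded commutative. *)
Definition star (i : int) (s t : V) : V := (-1) ^ (m * i) *: dot s t.

(** Follows the recursion of [HHprod]. The empty product is the default 0 and not a unit, whence the
    nonemptiness conditions below. *)
Fixpoint sprod (s : seq (int * V)) : V :=
  match s with
  | [::] => 0
  | [:: x] => x.2
  | x :: s' => star x.1 x.2 (sprod s')
  end.

Hypothesis A : is_bv.
Notation item := (int * V)%type.
Implicit Types (s t u : V) (p q : item) (l : seq item).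
Notation ith l i := (nth (0, 0) l i).

Lemma degZ k a s : deg k s -> deg k (a *: s).
Proof. by move=> hs; rewrite -[_ *: _]addr0; apply: (bv_deg_lin A) => //; exact: (bv_deg0 A). Qed.

Lemma deg_star i j s t : deg i s -> deg j t -> deg (i + j - m) (star i s t).
Proof. by move=> hs ht; apply/degZ/(bv_deg_dot A). Qed.

Lemma bv_dotZr i s a t : deg i s -> dot s (a *: t) = a *: dot s t.
Proof. by move=> hs; apply: linZ_of => b v v'; exact: (bv_dot_linr A) hs. Qed.

Lemma star_linr i s a t t' : deg i s ->
  star i s (a *: t + t') = a *: star i s t + star i s t'.
Proof. by move=> hs; rewrite /star (bv_dot_linr A _ _ _ hs); koszul. Qed.

Lemma star_linl i a s s' t : deg i s -> deg i s' ->
  star i (a *: s + s') t = a *: star i s t + star i s' t.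
Proof. by move=> hs hs'; rewrite /star (bv_dot_linl A _ _ hs hs'); koszul. Qed.

Lemma star0r i s : deg i s -> star i s 0 = 0.
Proof. by move=> hs; apply: (lin0 (f := star i s)) => a t t'; exact: star_linr. Qed.

Lemma starZr i s a t : deg i s -> star i s (a *: t) = a *: star i s t.
Proof. by move=> hs; rewrite -[a *: t]addr0 star_linr // star0r // addr0. Qed.

Lemma starBr i s a t t' : deg i s ->
  star i s (t - a *: t') = star i s t - a *: star i s t'.
Proof. by move=> hs; rewrite addrC -scaleNr star_linr // addrC scaleNr. Qed.

Lemma star0l i t : star i 0 t = 0.
Proof.
have := star_linl (-1) t (bv_deg0 A i) (bv_deg0 A i).
by rewrite !scaleN1r oppr0 addr0 addNr.
Qed.

Lemma starZl i s a t : deg i s -> star i (a *: s) t = a *: star i s t.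
Proof.
by move=> hs; rewrite -[a *: s]addr0 star_linl ?star0l ?addr0 //; exact: (bv_deg0 A).
Qed.

Lemma star_assoc i j s t u : deg i s -> deg j t -> (exists k, deg k u) ->
  star (i + j - m) (star i s t) u = star i s (star j t u).
Proof.
move=> hs ht hu; rewrite [RHS]/star [star j t u]/star starZl //; last exact: (bv_deg_dot A).
rewrite /star (bv_dotA A hs ht hu).
by rewrite (bv_dotZr _ _ hs); koszul.
Qed.

Lemma star_comm i j s t : deg i s -> deg j t ->
  star i s t = (-1) ^ ((i - m) * (j - m)) *: star j t s.
Proof. by move=> hs ht; rewrite /star (bv_dotC A hs ht); koszul. Qed.

Lemma star_CA i j s t u : deg i s -> deg j t -> (exists k, deg k u) ->
  star i s (star j t u) = (-1) ^ ((i - m) * (j - m)) *: star j t (star i s u).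
Proof.
move=> hs ht hu; rewrite -star_assoc // (star_comm hs ht) (_ : i + j - m = j + i - m); last by lia.
by rewrite starZl ?star_assoc //; exact: deg_star.
Qed.

Lemma star_bv z x y s t u : ker z s -> ker x t -> deg y u ->
  D (star z s (star x t u)) =
    star (z + x - m + 1) (D (star z s t)) u
    + (-1) ^ ((z - m + 1) * (x - m)) *: star x t (D (star z s u))
    + (-1) ^ (z - m) *: star z s (D (star x t u))
    - (-1) ^ (z - m + (z - m + 1) * (x - m)) *: star x t (star z s (D u)).
Proof.
move=> ks kt hu; have [hs ht] := (bv_ker_deg A ks, bv_ker_deg A kt).
have bvZ a v : D (a *: v) = a *: D v := linZ_of a v (fun b => bv_lin A b).
have hst := bv_degD A (bv_deg_dot A hs ht).
rewrite {1 2}/star [star z s t]/star [star z s u]/star [star x t u]/star.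
rewrite [star z s (D u)]/star !bvZ.
rewrite (starZl _ _ hst) !starZr // /star.
by rewrite (bv_dotZr _ _ hs) bvZ (bv_dot3 A ks kt hu); koszul.
Qed.

Definition bvder z s t := D (star z s t) - (-1) ^ (z - m) *: star z s (D t).

Lemma bvder_star z x y s t u : ker z s -> ker x t -> deg y u ->
  bvder z s (star x t u) = star (z + x - m + 1) (D (star z s t)) u
    + (-1) ^ ((z - m + 1) * (x - m)) *: star x t (bvder z s u).
Proof.
move=> ks kt hu; have [hs ht] := (bv_ker_deg A ks, bv_ker_deg A kt).
by rewrite /bvder (star_bv ks kt hu) (starBr _ _ _ ht); koszul.
Qed.

Definition sdeg l : int := \sum_(p <- l) (p.1 - m).
Definition homs l := {in l, forall p, deg p.1 p.2}.
Definition kers l := {in l, forall p, ker p.1 p.2}.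

Lemma sdeg_cons p l : sdeg (p :: l) = p.1 - m + sdeg l. Proof. exact: big_cons. Qed.
Lemma sdeg_cat l l' : sdeg (l ++ l') = sdeg l + sdeg l'. Proof. exact: big_cat. Qed.
Lemma kers_homs l : kers l -> homs l.
Proof. by move=> kl p pl; apply: (bv_ker_deg A); exact: kl. Qed.
Lemma homs_cons p l : homs (p :: l) <-> deg p.1 p.2 /\ homs l.
Proof.
split=> [h|[hp hl] q]; last by rewrite inE => /orP[/eqP->|/hl].
by split=> [|q ql]; apply: h; rewrite inE ?eqxx ?ql ?orbT.
Qed.
Lemma homs_cat l l' : homs (l ++ l') <-> homs l /\ homs l'.
Proof.
split=> [h|[hl hl'] q]; last by rewrite mem_cat => /orP[/hl|/hl'].
by split=> q ql; apply: h; rewrite mem_cat ql ?orbT.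
Qed.

Lemma sprod_cons p l : l != [::] -> sprod (p :: l) = star p.1 p.2 (sprod l).
Proof. by case: l. Qed.

Lemma deg_sprod l : homs l -> deg (sdeg l + m) (sprod l).
Proof.
elim: l => [_|p l IHl /homs_cons[hp /IHl hl]]; first exact: (bv_deg0 A).
have [->|l0] := eqVneq l [::].
  by rewrite /= sdeg_cons /sdeg big_nil addr0 subrK.
rewrite sprod_cons // sdeg_cons.
by have := deg_star hp hl; congr (deg _ _); lia.
Qed.

Lemma sprod_cat l l' : l != [::] -> l' != [::] -> homs l -> homs l' ->
  sprod (l ++ l') = star (sdeg l + m) (sprod l) (sprod l').
Proof.
move=> l0 l'0 hl hl'; elim: l l0 hl => // p l IHl _ /homs_cons[hp hl]; rewrite cat_cons.
have [->|l1] := eqVneq l [::].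
  by rewrite sprod_cons // sdeg_cons /sdeg big_nil addr0 subrK.
rewrite sprod_cons ?(IHl l1 hl) ?[sprod (p :: l)]sprod_cons //; last by case: l l1 {IHl hl}.
rewrite sdeg_cons (_ : p.1 - m + sdeg l + m = p.1 + (sdeg l + m) - m); last by lia.
rewrite star_assoc //; first exact: deg_sprod.
by exists (sdeg l' + m); exact: deg_sprod.
Qed.

Lemma sprod_swap l p q l' : homs (l ++ p :: q :: l') ->
  sprod (l ++ p :: q :: l') =
  (-1) ^ ((p.1 - m) * (q.1 - m)) *: sprod (l ++ q :: p :: l').
Proof.
elim: l => [/homs_cons[hp /homs_cons[hq hl]]|r l IHl /homs_cons[hr hl]]; last first.
  by rewrite !cat_cons !sprod_cons ?IHl ?starZr // -size_eq0 size_cat addnS.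
have [->|l0] := eqVneq l' [::]; first by rewrite /= (star_comm hp hq).
rewrite !cat0s !sprod_cons // (star_CA hp hq) //.
by exists (sdeg l' + m); exact: deg_sprod.
Qed.

Lemma sprod_lin l l' k a s t : homs (l ++ (k, s) :: l') -> deg k t ->
  sprod (l ++ (k, a *: s + t) :: l') =
  a *: sprod (l ++ (k, s) :: l') + sprod (l ++ (k, t) :: l').
Proof.
move=> + ht; elim: l => [/homs_cons[hs hl]|r l IHl /homs_cons[hr hl]]; last first.
  by rewrite !cat_cons !sprod_cons ?IHl ?star_linr // -size_eq0 size_cat addnS.
have [->|l0] := eqVneq l' [::]; first by [].
by rewrite !cat0s !sprod_cons // star_linl.
Qed.

Local Arguments sprod : simpl never.

Lemma kers_cons p l : kers (p :: l) <-> ker p.1 p.2 /\ kers l.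
Proof.
split=> [h|[hp hl] q]; last by rewrite inE => /orP[/eqP->|/hl].
by split=> [|q ql]; apply: h; rewrite inE ?eqxx ?ql ?orbT.
Qed.

Lemma homs_take n l : homs l -> homs (take n l).
Proof. by move=> hl p /mem_take; exact: hl. Qed.
Lemma homs_drop n l : homs l -> homs (drop n l).
Proof. by move=> hl p /mem_drop; exact: hl. Qed.

Lemma star_sumr i s (I : Type) (r : seq I) (P : pred I) (F : I -> V) : deg i s ->
  star i s (\sum_(j <- r | P j) F j) = \sum_(j <- r | P j) star i s (F j).
Proof.
move=> hs; apply: (big_morph (star i s)); last exact: star0r.
by move=> t t'; rewrite -[t in LHS]scale1r star_linr // scale1r.
Qed.

(* For p and q killed by D this is D (p q) - (+/-) (D p) q - (+/-) p (D q). *)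
Definition bvbr p q : item := (p.1 + q.1 - m + 1, D (star p.1 p.2 q.2)).

Lemma deg_bvbr p q : deg p.1 p.2 -> deg q.1 q.2 -> deg (bvbr p q).1 (bvbr p q).2.
Proof. by move=> hp hq; exact/(bv_degD A)/deg_star. Qed.

Lemma bvder_sprod a l : l != [::] -> ker a.1 a.2 -> kers l ->
  bvder a.1 a.2 (sprod l) = \sum_(j < size l)
    (-1) ^ (((ith l j).1 - m) * sdeg (take j l)) *:
    sprod (bvbr a (ith l j) :: take j l ++ drop j.+1 l).
Proof.
move=> + ka; elim: l => // p l IHl _ /kers_cons[kp kl].
have [ha hp hl] := And3 (bv_ker_deg A ka) (bv_ker_deg A kp) (kers_homs kl).
rewrite big_ord_recl /= /sdeg big_nil mulr0 expr0z scale1r drop0.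
have [->|l0] := eqVneq l [::].
  (* With a single factor p the bracket is D(a p), because D p = 0. *)
  by rewrite big_ord0 addr0 /bvder (bv_ker0 A kp) star0r // scaler0 subr0.
rewrite sprod_cons // (bvder_star ka kp (deg_sprod hl)) [X in _ = X + _]sprod_cons //.
congr (_ + _); rewrite (IHl l0 kl) star_sumr // scaler_sumr; apply: eq_bigr => j _.
rewrite starZr // big_cons /= -/(sdeg _).
set R := take j l ++ drop j.+1 l; set d := bvbr a _.
have hd : deg d.1 d.2 by apply: deg_bvbr => //; apply: hl; exact: mem_nth.
have -> : star p.1 p.2 (sprod (d :: R)) = sprod ([::] ++ p :: d :: R) by exact: esym (sprod_cons _ _).
rewrite sprod_swap; last first.
  apply/homs_cons; split=> //; apply/homs_cons; split=> //; apply/homs_cat.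
  by split; [exact: homs_take | exact: homs_drop].
rewrite /= -/R; by koszul.
Qed.

Definition bvsign l i j : int :=
  sdeg (take i l) * ((ith l i).1 - m) + sdeg (take j l) * ((ith l j).1 - m)
  + ((ith l i).1 - m) * ((ith l j).1 - m).

(** D(a l) is the bracket of a with l, which yields the pairs with i = 0, plus a D(l) up to sign,
    which yields the other pairs by induction. *)
Lemma bv_sprod l : kers l ->
  D (sprod l) = \sum_(j < size l) \sum_(i < j)
    (-1) ^ bvsign l i j *: sprod (bvbr (ith l i) (ith l j) :: remove2 l i j).
Proof.
have bv0 : D 0 = 0 by apply: (lin0 (f := D)) => a v v'; exact: (bv_lin A).
elim: l => [_|a l IHl /kers_cons[ka kl]]; first by rewrite big_ord0.
have [ha hl] := (bv_ker_deg A ka, kers_homs kl).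
rewrite big_ord_recl /= big_ord0 add0r.
have [->|l0] := eqVneq l [::]; first by rewrite big_ord0 /= (bv_ker0 A ka).
rewrite sprod_cons //; transitivity (bvder a.1 a.2 (sprod l)
    + (-1) ^ (a.1 - m) *: star a.1 a.2 (D (sprod l))).
  by rewrite /bvder subrK.
rewrite bvder_sprod // (IHl kl) star_sumr // scaler_sumr -big_split /=.
apply: eq_bigr => j _; rewrite big_ord_recl /=; congr (_ + _).
  rewrite /remove2 /= drop0 /bvsign /= /sdeg big_nil big_cons.
  by koszul.
rewrite star_sumr // scaler_sumr; apply: eq_bigr => i _.
rewrite starZr //= /bump /= add1n /bvsign /= !sdeg_cons.
set d := bvbr _ _; set R := remove2 l i j.
have ij := ltn_ord i; have jl := ltn_ord j.
have il : (i < size l)%N by exact: ltn_trans jl.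
have hd : deg d.1 d.2 by apply: deg_bvbr; apply: hl; exact: mem_nth.
have -> : star a.1 a.2 (sprod (d :: R)) = sprod ([::] ++ a :: d :: R) by exact: esym (sprod_cons _ _).
rewrite sprod_swap; last first.
  apply/homs_cons; split=> //; apply/homs_cons; split=> //; apply/homs_cat.
  split; first exact: homs_take.
  by apply/homs_cat; split; apply: homs_drop => //; exact: homs_take.
have -> : remove2 (a :: l) i.+1 j.+1 = a :: R by [].
by rewrite /=; koszul.
Qed.

(** The two cases of the generalized Jacobi identity before E is applied. *)
Lemma sprod_bv l l' : l != [::] -> kers l -> homs l' ->
  (if l' != [::] then sprod ((sdeg l + m + 1, D (sprod l)) :: l') else D (sprod l)) =
  \sum_(j < size l) \sum_(i < j) (-1) ^ bvsign l i j *: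
    sprod (bvbr (ith l i) (ith l j) :: remove2 l i j ++ l').
Proof.
move=> l0 kl hl'; have hl := kers_homs kl; have [->|l'0] := eqVneq l' [::].
  by rewrite bv_sprod //; apply: eq_bigr => j _; apply: eq_bigr => i _; rewrite cats0.
rewrite sprod_cons //= bv_sprod //.
have hd (j : 'I_(size l)) (i : 'I_j) :
    homs (bvbr (ith l i) (ith l j) :: remove2 l i j) /\
    sdeg (bvbr (ith l i) (ith l j) :: remove2 l i j) + m = sdeg l + m + 1.
  have ij := ltn_ord i; have jl := ltn_ord j.
  have il : (i < size l)%N by exact: ltn_trans jl.
  split.
    apply/homs_cons; split; first by apply: deg_bvbr; apply: hl; exact: mem_nth.
    apply/homs_cat; split; first exact: homs_take.
    by apply/homs_cat; split; apply: homs_drop => //; exact: homs_take.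
  rewrite [in RHS](split_nth (0, 0) jl) (take_split (0, 0) ij jl) !(sdeg_cons, sdeg_cat) /=.
  by lia.
have hD : deg (sdeg l + m + 1) (D (sprod l)).
  exact/(bv_degD A)/deg_sprod.
have starsum (I : Type) (r : seq I) (F : I -> V) : (forall i, deg (sdeg l + m + 1) (F i)) ->
    deg (sdeg l + m + 1) (\sum_(i <- r) F i) /\
    star (sdeg l + m + 1) (\sum_(i <- r) F i) (sprod l') =
    \sum_(i <- r) star (sdeg l + m + 1) (F i) (sprod l').
  move=> hF; elim: r => [|i r [IH1 IH2]]; first by rewrite !big_nil star0l; split=> //; exact: (bv_deg0 A).
  rewrite !big_cons; split; first by have := bv_deg_lin A 1 (hF i) IH1; rewrite scale1r.
  by rewrite -IH2 -[F i in LHS]scale1r star_linl // scale1r.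
have hB (j : 'I_(size l)) (i : 'I_j) : deg (sdeg l + m + 1)
    ((-1) ^ bvsign l i j *: sprod (bvbr (ith l i) (ith l j) :: remove2 l i j)).
  by have [h <-] := hd j i; exact/degZ/deg_sprod.
rewrite (starsum _ _ _ _).2 => [|j]; last exact: (starsum _ _ _ (hB j)).1.
apply: eq_bigr => j _; rewrite (starsum _ _ _ (hB j)).2; apply: eq_bigr => i _.
have [h e] := hd j i; rewrite -cat_cons sprod_cat // e starZl //.
by rewrite -e; exact: deg_sprod.
Qed.

End BVAlgebra.

Local Arguments sprod : simpl never.

(** * Gravity brackets from E, M and Delta *)

Section GravityOfBV.
Variables (K : fieldType) (m : int) (V W : lmodType K).
Variables (deg : int -> set V) (ker : int -> V -> Prop).
Variables (dot : V -> V -> V) (D : V -> V).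
Variables (H : int -> set W) (E : V -> W) (M : W -> V).

(** What the brackets use of Connes' exact sequence. [cp_ker] asks for [ker], which for chains is a
    condition on a representative and not only D (M t) = 0. *)
Record is_connes_pair : Prop := {
  cp_linE : forall a s t, E (a *: s + t) = a *: E s + E t;
  cp_linM : forall a s t, M (a *: s + t) = a *: M s + M t;
  cp_deg : forall k t, deg k t -> H k (E t);
  cp_ker : forall k t, H k t -> ker (k + 1) (M t);
  cp_ME : forall t, M (E t) = D t;
  cp_ED : forall k t, deg k t -> E (D t) = 0
}.

Hypothesis A : is_bv m deg ker dot D.
Hypothesis B : is_connes_pair.
Notation G := (gshift H (m - 2)).
Notation arg := (int * W)%type.
Notation sdeg := (sdeg m).
Notation sprod := (sprod m dot).
Notation kers := (kers ker).
Implicit Types (x y : arg) (l : seq arg).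
Notation ith l i := (nth (0, 0) l i).

Definition decal l : int := \sum_(i < size l) (size l - i.+1)%N%:Z * (ith l i).1.

Lemma decal_cons x l : decal (x :: l) = (size l)%:Z * x.1 + decal l.
Proof. by rewrite [LHS]big_ord_recl [in LHS]/= subSS subn0; congr (_ + _); apply: eq_bigr. Qed.

Lemma dsum_cons x l : dsum (x :: l) = x.1 + dsum l. Proof. exact: big_cons. Qed.
Lemma dsum_cat l l' : dsum (l ++ l') = dsum l + dsum l'. Proof. exact: big_cat. Qed.

Lemma decal_cat l l' : decal (l ++ l') = decal l + (size l')%:Z * dsum l + decal l'.
Proof.
elim: l => [|x l IHl]; first by rewrite cat0s [decal [::]]big_ord0 [dsum [::]]big_nil mulr0 !add0r.
by rewrite cat_cons !decal_cons IHl dsum_cons size_cat PoszD; lia.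
Qed.

(** Degree x.1 in HC[m-2] is x.1 + m - 2 in HC, and M adds one. Relative to the shift by m of the
    product this is x.1 - 1: the suspension that makes brackets from a commutative product
    skew-symmetric. *)
Definition marg x : int * V := (x.1 + (m - 2) + 1, M x.2).

Definition br l : W := (-1) ^ decal l *: E (sprod (map marg l)).

Lemma brE l : br l = (-1) ^ decal l *: E (sprod (map marg l)).
Proof. by []. Qed.

Lemma marg_ker l : homog G l -> kers (map marg l).
Proof. by move=> hl p /mapP[x /hl hx ->]; exact: (cp_ker B). Qed.

Lemma sdeg_marg l : sdeg (map marg l) = dsum l - (size l)%:Z.
Proof.
elim: l => [|x l IHl]; first by rewrite [LHS]big_nil [dsum _]big_nil subr0.
by rewrite /= sdeg_cons IHl dsum_cons /=; lia.
Qed.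

Lemma E0 : E (0 : V) = 0.
Proof. by apply: (lin0 (f := E)) => a s t; exact: (cp_linE B). Qed.
Lemma EZ a (t : V) : E (a *: t) = a *: E t.
Proof. by apply: linZ_of => b u v; exact: (cp_linE B). Qed.
Lemma MZ a (t : W) : M (a *: t) = a *: M t.
Proof. by apply: linZ_of => b u v; exact: (cp_linM B). Qed.

Lemma M_br l : M (br l) = (-1) ^ decal l *: D (sprod (map marg l)).
Proof. by rewrite brE MZ (cp_ME B). Qed.

Lemma marg_brk l : marg (brk br l) =
  (sdeg (map marg l) + m + 1, (-1) ^ decal l *: D (sprod (map marg l))).
Proof. by rewrite -M_br sdeg_marg; congr (_, _); rewrite /=; lia. Qed.

Lemma gravity_deg l : homog G l -> G (brk br l).1 (brk br l).2.
Proof.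
move=> hl; have := deg_sprod A (kers_homs A (marg_ker hl)); rewrite sdeg_marg => h.
have := cp_deg B (degZ A ((-1) ^ decal l) h); rewrite EZ -brE /gshift.
by congr (H _ _); rewrite /=; lia.
Qed.

Lemma gravity_lin pre post k a (s t : W) : homog G (pre ++ (k, s) :: post) -> G k t ->
  br (pre ++ (k, a *: s + t) :: post) =
  a *: br (pre ++ (k, s) :: post) + br (pre ++ (k, t) :: post).
Proof.
move=> hl ht; rewrite !brE !map_cat /= /marg /= (cp_linM B) (sprod_lin A); first last.
- exact: (bv_ker_deg A) (cp_ker B ht).
- by have := kers_homs A (marg_ker hl); rewrite map_cat.
rewrite (cp_linE B) !decal_cat !decal_cons /=.
by koszul.
Qed.

Lemma gravity_skew pre post x y : homog G (pre ++ x :: y :: post) ->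
  br (pre ++ x :: y :: post) = - ((-1) ^ (x.1 * y.1) *: br (pre ++ y :: x :: post)).
Proof.
move=> hl; have := kers_homs A (marg_ker hl); rewrite !brE !map_cat /= => /(sprod_swap A) ->.
rewrite EZ !decal_cat !decal_cons /= !intS.
by koszul.
Qed.

Lemma sprodZ k a (t : V) (l : seq (int * V)) : deg k t ->
  sprod ((k, a *: t) :: l) = a *: sprod ((k, t) :: l).
Proof.
move=> ht; have [->//|l0] := eqVneq l [::].
by rewrite !sprod_cons //= (starZl A).
Qed.

(* The decalage signs turn the signs of the gravity relation into the Koszul
   signs of the shifted degrees. *)
Lemma decal_sign (U : lmodType K) (v : U) xs ys i j : (i < j)%N -> (j < size xs)%N ->
  ((-1) ^+ (i + j.-1) * (-1) ^ eps_sign xs i j) *: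
   ((-1) ^ decal (brk br [:: ith xs i; ith xs j] :: remove2 xs i j ++ ys) *:
     ((-1) ^ decal [:: ith xs i; ith xs j] *: v)) =
  (-1) ^ decal (xs ++ ys) *: ((-1) ^ bvsign m (map marg xs) i j *: v).
Proof.
move=> ij jk; have ik := ltn_trans ij jk.
have E1 := take_split (0, 0) ij jk; have E2 := split_nth (0, 0) jk.
have sP : size (take i xs) = i by rewrite size_take ik.
have sJ : size (take j xs) = j by rewrite size_take jk.
have mi n : (n < size xs)%N -> nth (0, 0) (map marg xs) n = marg (ith xs n).
  by move=> nk; rewrite (nth_map (0, 0)).
rewrite /bvsign !mi // -!map_take !sdeg_marg sP sJ /eps_sign /remove2.
have dxs : decal (xs ++ ys) = decal ((take j xs ++ ith xs j :: drop j.+1 xs) ++ ys) by rewrite -E2.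
have sQ : j = (i + size (drop i.+1 (take j xs))).+1 by rewrite size_drop sJ; lia.
move: dxs sQ sP; rewrite E1; move: (take i xs) (drop i.+1 _) (drop j.+1 xs) (ith xs i) (ith xs j).
move=> P Q R x y -> -> <- {E1 E2 sJ mi ij jk ik}; rewrite /= -catA !exprnP.
have -> : drop (size P).+1 (P ++ x :: Q) = Q by rewrite -cat_rcons drop_size_cat ?size_rcons.
rewrite /brk /= !(decal_cat, decal_cons, dsum_cat, dsum_cons) [dsum [::]]big_nil [decal [::]]big_ord0.
have z0 : Posz 0 = 0 by [].
rewrite !size_cat /= !(PoszD, intS) !z0.
by koszul.
Qed.

Lemma gravity_jacobi xs ys : homog G xs -> homog G ys ->
  let k := size xs in let l := size ys in (2 <= k)%N ->
  \sum_(j < k) \sum_(i < j)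
     ((-1) ^+ (i + j.-1) * (-1) ^ eps_sign xs i j) *:
       br (brk br [:: ith xs i; ith xs j] :: remove2 xs i j ++ ys) =
  if (0 < l)%N then (-1) ^+ (k * l) *: br (brk br xs :: ys) else 0.
Proof.
move=> hx hy k l k2.
have kx := marg_ker hx; have ky := kers_homs A (marg_ker hy).
have x0 : map marg xs != [::] by rewrite -size_eq0 size_map -lt0n; exact: ltn_trans k2.
(* The intermediate expression is E of the left-hand side of [sprod_bv]. The right-hand side takes
   this form because the inner bracket is entered through M E = D. *)
transitivity ((-1) ^ decal (xs ++ ys) *: E (if map marg ys != [::]
   then sprod ((sdeg (map marg xs) + m + 1, D (sprod (map marg xs))) :: map marg ys)
   else D (sprod (map marg xs)))); last first.
  rewrite -size_eq0 size_map -lt0n -/l; case: ifP => l0; last first.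
    by rewrite (cp_ED B (deg_sprod A (kers_homs A kx))) scaler0.
  rewrite brE map_cons marg_brk.
  rewrite !sprod_cons; try by rewrite -size_eq0 size_map -lt0n.
  rewrite (starZl A) /=; last exact/(bv_degD A)/(deg_sprod A)/(kers_homs A).
  rewrite EZ decal_cat decal_cons /= -/k -/l exprnP PoszM.
  by koszul.
rewrite (sprod_bv A) // size_map -/k.
have Esum (I : Type) (r : seq I) (F : I -> V) :
    E (\sum_(i <- r) F i) = \sum_(i <- r) E (F i).
  elim: r => [|i r IHr]; first by rewrite !big_nil E0.
  by rewrite !big_cons -IHr -[F i in LHS]scale1r (cp_linE B) scale1r.
rewrite Esum scaler_sumr; apply: eq_bigr => j _; rewrite Esum scaler_sumr; apply: eq_bigr => i _.
have ij := ltn_ord i; have jk := ltn_ord j.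
have ik : (i < size xs)%N by exact: ltn_trans jk.
rewrite brE /= EZ.
have mi n : (n < size xs)%N -> nth (0, 0) (map marg xs) n = marg (ith xs n).
  by move=> nk; rewrite (nth_map (0, 0)).
have -> : map marg (remove2 xs i j ++ ys) = remove2 (map marg xs) i j ++ map marg ys.
  by rewrite /remove2 !map_cat !map_drop !map_take.
rewrite !mi // marg_brk sprodZ; last first.
  apply/(bv_degD A)/(deg_sprod A)/(kers_homs A)/marg_ker => x.
  by rewrite !inE => /orP[/eqP->|/eqP->]; apply: hx; exact: mem_nth.
rewrite EZ -decal_sign // /bvbr; do 3 congr (_ *: _); congr (E (sprod ((_, _) :: _))).
by rewrite sdeg_marg dsum_cons dsum_cons [dsum [::]]big_nil /=; lia.
Qed.

Lemma gravity_of_bv : is_grading H -> is_gravity G br.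
Proof.
move=> gH; split.
- exact: gshift_grading.
- by move=> s _; exact: gravity_deg.
- by move=> pre post k a x y _; exact: gravity_lin.
- exact: gravity_skew.
by move=> xs ys hx hy k l k2 _; exact: gravity_jacobi.
Qed.

End GravityOfBV.

(** * Mixed complexes *)

Lemma chains_ind (K : pzRingType) (V : lmodType K) (H : int -> set V) (P : V -> Prop) :
  P 0 -> (forall a x y, P x -> P y -> P (a *: x + y)) -> (forall k x, H k x -> P x) ->
  forall x, chains H x -> P x.
Proof.
move=> P0 Pl PH x [l [lH ->]]; elim: l lH => [|[a v] l IHl] lH; first by rewrite big_nil.
rewrite big_cons; apply: Pl.
  by have [k hk] : exists k, H k v := lH (a, v) (mem_head _ _); apply: PH hk.
by apply: IHl => q ql; apply: lH; rewrite inE ql orbT.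
Qed.

Section MixedComplex.
Variables (K : fieldType) (V : lmodType K) (H : int -> set V) (b B : {linear V -> V}).

Record is_mixed : Prop := {
  mixed0 : forall k, H k 0;
  mixed_lin : forall k a x y, H k x -> H k y -> H k (a *: x + y);
  mixed_b : forall k x, H k x -> H (k - 1) (b x);
  mixed_B : forall k x, H k x -> H (k + 1) (B x);
  mixed_bB : forall k x, H k x -> b (B x) + B (b x) = 0;
  mixed_BB : forall k x, H k x -> B (B x) = 0
}.

Hypothesis X : is_mixed.
Notation cls := (hclass H b).
Notation cyc := (cyclep H b).

Lemma mixed_bB_chain x : chains H x -> b (B x) = - B (b x).
Proof.
move=> cx; apply/eqP; rewrite -subr_eq0 opprK; apply/eqP; move: x cx.
apply: chains_ind => [|a x y hx hy|k x hx]; first by rewrite !linear0 addr0.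
  by rewrite !linearP /= addrACA hy -scalerDr hx scaler0 addr0.
exact: mixed_bB hx.
Qed.

Lemma mixed_BB_chain x : chains H x -> B (B x) = 0.
Proof.
move: x; apply: chains_ind => [|a x y hx hy|k x hx]; first by rewrite !linear0.
  by rewrite !linearP /= hx hy scaler0 addr0.
exact: mixed_BB hx.
Qed.

Lemma chains_mixed_B x : chains H x -> chains H (B x).
Proof.
move: x; apply: chains_ind => [|a x y hx hy|k x hx]; first by rewrite linear0; exact: span0.
  by rewrite linearP; exact: span_lin.
exact: chains_gen (mixed_B X hx).
Qed.

Lemma cyc_mixed_B x : cyc x -> cyc (B x).
Proof.
move=> /cycP[cx bx]; apply/cycP; split; first exact: chains_mixed_B.
by rewrite mixed_bB_chain // bx linear0 oppr0.
Qed.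

Definition mixed_op (t : homology H b) : homology H b := cls (B (hrepr t)).

Lemma mixed_op_cls x : cyc x -> mixed_op (cls x) = cls (B x).
Proof.
move=> cx; have [w cw bw] := hrepr_hclass cx.
apply/(hclass_eq (cyc_mixed_B (cyc_hrepr _)) (cyc_mixed_B cx)).
exists (- B w); first exact/spanN/chains_mixed_B.
by rewrite linearN mixed_bB_chain // opprK bw linearB.
Qed.

Lemma mixed_op_lin a s t : mixed_op (a *: s + t) = a *: mixed_op s + mixed_op t.
Proof.
rewrite -(hreprK s) -(hreprK t) -hclass_lin ?cyc_hrepr // !mixed_op_cls ?cyc_hrepr //; last first.
  by apply: cyc_lin; exact: cyc_hrepr.
by rewrite linearP hclass_lin //; apply: cyc_mixed_B; exact: cyc_hrepr.
Qed.

Lemma hdeg_mixed_op k t : hdeg k t -> hdeg (k + 1) (mixed_op t).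
Proof.
move=> [x [hx bx ->]]; have cx := cyc_hom hx bx; rewrite mixed_op_cls //.
have /cycP[_ b0] := cyc_mixed_B cx.
by exists (B x); split=> //; exact: mixed_B.
Qed.

(** B has to vanish on a representative, which is stronger than [mixed_op t = 0]; [bv_chain] works
    with such representatives. *)
Definition mixed_ker k (t : homology H b) : Prop :=
  exists x, [/\ H k x, b x = 0, B x = 0 & t = cls x].

Lemma mixed_ker_deg k t : mixed_ker k t -> hdeg k t.
Proof. by move=> [x [hx bx _ ->]]; exists x. Qed.

Lemma mixed_ker_op k t : mixed_ker k t -> mixed_op t = 0.
Proof. by move=> [x [hx bx Bx ->]]; rewrite (mixed_op_cls (cyc_hom hx bx)) Bx hclass0. Qed.

(** The complex with coefficients in K[u], described by two equations that hold by definition for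
    [CCu] and [bCCu]. *)
Variables (Hu : int -> set (nat -> V)) (bu : {linear (nat -> V) -> (nat -> V)}).
Hypothesis HuE : forall k al, Hu k al <->
  (forall j, H (k - 2 * j%:Z) (al j)) /\ exists N, forall j, (N <= j)%N -> al j = 0.
Hypothesis buE : forall al j, bu al j = b (al j) + B (al j.+1).
Notation clu := (hclass Hu bu).
Notation cycu := (cyclep Hu bu).
Implicit Types (x y w : V) (al : nat -> V).

Lemma mixedu_lin k a al be : Hu k al -> Hu k be -> Hu k (a *: al + be).
Proof.
move=> /HuE[h [N hN]] /HuE[h' [N' hN']]; apply/HuE; split=> [j|].
  exact: (mixed_lin X a (h j) (h' j)).
exists (maxn N N') => j; rewrite geq_max => /andP[/hN aj /hN' bj].
by rewrite -[LHS]/(a *: al j + be j) aj bj scaler0 addr0.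
Qed.

Lemma mixedu_b k al : Hu k al -> Hu (k - 1) (bu al).
Proof.
move=> /HuE[h [N hN]]; apply/HuE; split=> [j|]; last first.
  by exists N => j Nj; rewrite buE (hN j Nj) (hN j.+1 (leqW Nj)) !linear0 addr0.
rewrite buE -[b _]scale1r; apply: (mixed_lin X).
  by rewrite (_ : k - 1 - 2 * j%:Z = k - 2 * j%:Z - 1); [exact: mixed_b X _ _ (h j) | lia].
by rewrite (_ : k - 1 - 2 * j%:Z = k - 2 * j.+1%:Z + 1); [exact: mixed_B X _ _ (h j.+1) | lia].
Qed.

Lemma mixedu_grading (p : int -> V -> V) : (forall k, linear (p k)) ->
  (forall k x, H k x -> p k x = x) -> (forall k j x, j != k -> H j x -> p k x = 0) ->
  is_grading (hdeg (H := Hu) (D := bu)).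
Proof.
move=> p_lin p_id p_0.
apply: (@hdeg_grading _ _ Hu bu _ _ _ (fun k al j => p (k - 2 * j%:Z) (al j))).
- exact: mixedu_lin.
- by move=> k; apply/HuE; split=> [j|]; [exact: (mixed0 X) | exists 0%N].
- exact: mixedu_b.
- by move=> k a al be; apply/funext => j; exact: p_lin.
- by move=> k al /HuE[h _]; apply/funext => j; exact: p_id.
move=> k i al ik /HuE[h _]; apply/funext => j; apply: p_0 (h j).
by rewrite (inj_eq (addIr _)).
Qed.

Definition mixed_incl x : nat -> V := fun j => if j is 0 then x else 0.
Definition mixed_mulu al : nat -> V := fun j => if j is i.+1 then al i else 0.
Definition mixed_E (t : homology H b) : homology Hu bu := clu (mixed_incl (hrepr t)).
Definition mixed_M (t : homology Hu bu) : homology H b := cls (bu (mixed_mulu (hrepr t)) 0%N).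

Lemma bu_incl x : bu (mixed_incl x) = mixed_incl (b x).
Proof. by apply/funext => -[|j]; rewrite buE /= !linear0 addr0. Qed.

Lemma incl_lin a x y : mixed_incl (a *: x + y) = a *: mixed_incl x + mixed_incl y.
Proof. by apply/funext => -[|j] //; rewrite -[RHS]/(a *: 0 + 0) scaler0 addr0. Qed.

Lemma incl0 : mixed_incl 0 = 0. Proof. by apply/funext => -[]. Qed.

Lemma Hu_incl k x : H k x -> Hu k (mixed_incl x).
Proof.
move=> hx; apply/HuE; split=> [[|j]|]; last by exists 1%N => -[].
  by rewrite mulr0 subr0.
exact: mixed0.
Qed.

Lemma chains_incl x : chains H x -> chains Hu (mixed_incl x).
Proof.
move: x; apply: chains_ind => [|a x y hx hy|k x hx]; first by rewrite incl0; exact: span0.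
  by rewrite incl_lin; exact: span_lin.
exact: chains_gen (Hu_incl hx).
Qed.

Lemma cyc_incl x : cyc x -> cycu (mixed_incl x).
Proof.
move=> /cycP[cx bx]; apply/cycP; split; first exact: chains_incl.
by rewrite bu_incl bx incl0.
Qed.

Lemma mixed_E_cls x : cyc x -> mixed_E (cls x) = clu (mixed_incl x).
Proof.
move=> cx; have [w cw bw] := hrepr_hclass cx.
apply/(hclass_eq (cyc_incl (cyc_hrepr _)) (cyc_incl cx)).
exists (mixed_incl w); first exact: chains_incl.
by rewrite bu_incl bw -(scaleN1r x) addrC incl_lin scaleN1r addrC.
Qed.

Lemma mixed_E_lin a s t : mixed_E (a *: s + t) = a *: mixed_E s + mixed_E t.
Proof.
rewrite -(hreprK s) -(hreprK t) -hclass_lin ?cyc_hrepr // !mixed_E_cls ?cyc_hrepr //; last first.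
  by apply: cyc_lin; exact: cyc_hrepr.
by rewrite incl_lin hclass_lin //; apply: cyc_incl; exact: cyc_hrepr.
Qed.

Lemma hdeg_mixed_E k t : hdeg k t -> hdeg k (mixed_E t).
Proof.
move=> [x [hx bx ->]]; have cx := cyc_hom hx bx; rewrite mixed_E_cls //.
by have /cycP[_ b0] := cyc_incl cx; exists (mixed_incl x); split=> //; exact: Hu_incl.
Qed.

Lemma mixed_E_op k t : hdeg k t -> mixed_E (mixed_op t) = 0.
Proof.
move=> [x [hx bx ->]]; have cx := cyc_hom hx bx.
rewrite mixed_op_cls // mixed_E_cls ?cyc_mixed_B //; apply: hclass_eq0; first exact/cyc_incl/cyc_mixed_B.
(* The witness is u x, whose boundary is u b(x) + B(x) = B(x). *)
exists (mixed_mulu (mixed_incl x)).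
  apply: (@chains_gen _ _ _ (k + 2)); apply/HuE; split=> [[|[|j]]|]; last by exists 2%N => -[|[]].
  - exact: mixed0.
  - by rewrite mulr1 addrK.
  - exact: mixed0.
apply/funext => -[|[|j]]; rewrite buE /= !linear0 ?add0r ?addr0 //.
Qed.

Lemma chainsu_at al j : chains Hu al -> chains H (al j).
Proof.
move: al; apply: chains_ind => [|a al be hal hbe|k al /HuE[hal _]]; first exact: span0.
  by rewrite -[(_ + _) j]/(a *: al j + be j); exact: span_lin.
exact: chains_gen (hal j).
Qed.

(** For a cycle a_0 + a_1 u + ... one has b a_0 = - B a_1, hence b B a_0 = - B b a_0 = B B a_1 =
    0. *)
Lemma cyc_connecting al : cycu al -> cyc (B (al 0%N)) /\ B (B (al 0%N)) = 0.
Proof.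
move=> /cycP[cal bal]; have c0 := chainsu_at 0 cal; have c1 := chainsu_at 1 cal.
split; last exact: mixed_BB_chain.
apply/cycP; split; first exact: chains_mixed_B.
rewrite mixed_bB_chain //; have := congr1 (fun f => f 0%N) bal.
by rewrite buE => /eqP; rewrite addr_eq0 => /eqP ->; rewrite linearN mixed_BB_chain // !oppr0.
Qed.

(** The lift u al has constant coefficient 0, so the constant coefficient of its boundary is B of
    that of al. *)
Lemma mixed_M_clu al : cycu al -> mixed_M (clu al) = cls (B (al 0%N)).
Proof.
move=> cal; rewrite /mixed_M buE linear0 add0r; have [w cw bw] := hrepr_hclass cal.
apply/(hclass_eq (cyc_connecting (cyc_hrepr _)).1 (cyc_connecting cal).1).
have := congr1 (fun f => f 0%N) bw; rewrite buE -[RHS]/(hrepr _ 0%N - al 0%N) => E.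
exists (- B (w 0%N)); first exact/spanN/chains_mixed_B/chainsu_at.
rewrite linearN (mixed_bB_chain (chainsu_at 0 cw)) opprK -linearB -E linearD.
by rewrite (mixed_BB_chain (chainsu_at 1 cw)) addr0.
Qed.

Lemma mixed_M_lin a s t : mixed_M (a *: s + t) = a *: mixed_M s + mixed_M t.
Proof.
rewrite -(hreprK s) -(hreprK t) -hclass_lin ?cyc_hrepr // !mixed_M_clu ?cyc_hrepr //; last first.
  by apply: cyc_lin; exact: cyc_hrepr.
rewrite -[(_ + _) 0%N]/(a *: hrepr s 0%N + hrepr t 0%N) linearP hclass_lin //.
  exact: (cyc_connecting (cyc_hrepr _)).1.
exact: (cyc_connecting (cyc_hrepr _)).1.
Qed.

Lemma mixed_M_ker k t : hdeg k t -> mixed_ker (k + 1) (mixed_M t).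
Proof.
move=> [al [hal bal ->]]; have cal := cyc_hom hal bal.
have [/cycP[_ b0] B0] := cyc_connecting cal.
exists (B (al 0%N)); split=> //; last exact: mixed_M_clu.
by apply: (mixed_B X); have /HuE[/(_ 0%N)] := hal; rewrite mulr0 subr0.
Qed.

Lemma mixed_M_E t : mixed_M (mixed_E t) = mixed_op t.
Proof.
rewrite -(hreprK t) mixed_E_cls ?cyc_hrepr // mixed_M_clu; last exact/cyc_incl/cyc_hrepr.
by rewrite mixed_op_cls ?cyc_hrepr.
Qed.

Lemma mixed_connes_pair : is_connes_pair (hdeg (H := H) (D := b)) mixed_ker mixed_op
  (hdeg (H := Hu) (D := bu)) mixed_E mixed_M.
Proof.
split.
- exact: mixed_E_lin.
- exact: mixed_M_lin.
- exact: hdeg_mixed_E.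
- exact: mixed_M_ker.
- exact: mixed_M_E.
exact: mixed_E_op.
Qed.

End MixedComplex.

(** * Hochschild and cyclic homology of C *)

Section CyclicGrading.
Variables (K : fieldType) (m : int) (C : openFrobenius K m).
Notation "<[ w ]>" := (wd (unit_rel C) w) (format "<[ w ]>").
Notation hom := (@hom K m C).

(** The projection to total degree k; it descends to [ccw C] because all the relations are
    homogeneous. *)
Definition wproj (k : int) : {linear ccw C -> ccw C} :=
  lin_ext (fun w => if wdeg w == k then <[w]> else 0).

Lemma wproj_wd k w : wproj k <[w]> = if wdeg w == k then <[w]> else 0.
Proof.
rewrite /wproj lin_extE //; apply: compatible_unit => [pre post c x y z h|a pre post u u1].
  have [dx dy _] := h; have wE (v : letter C) : deg v = deg z ->
      wdeg (pre ++ v :: post) = wdeg (pre ++ z :: post).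
    by move=> dv; case: pre => [|b pre]; rewrite /= ?degE ?dv.
  rewrite !(wE x) // !(wE y) // (wd_multilin _ pre post h).
  by case: ifP => _ //; rewrite scaler0 addr0.
by rewrite wd_unit // if_same.
Qed.

Lemma wproj_hom n j k x : hom n j x -> wproj k x = if j == k then x else 0.
Proof.
move: x; apply: hom_eq => [a u v|a u v|c q _ dp _]; first by rewrite linearP.
  by case: ifP => _ //; rewrite scaler0 addr0.
by rewrite wproj_wd /= dp.
Qed.

End CyclicGrading.

(** * Product and operator on Hochschild homology *)

Section HochschildAlgebra.
Variables (K : fieldType) (m : int) (C : openFrobenius K m).
Notation fam := (nat -> ccw C).
Notation CC := (@CC K m C).
Notation bCC := (@bCC K m C).
Notation BCC := (@BCC K m C).
Notation HH_deg := (@HH_deg K m C).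
Notation cls := (hclass CC bCC).
Notation chain := (chains CC).
Notation cycle := (cyclep CC bCC).
Implicit Types (X Y Z W : fam).

Lemma cycleP X : reflect (chain X /\ bCC X = 0) (cycle X). Proof. exact: cycP. Qed.
Lemma cls_eq X Y : cycle X -> cycle Y ->
  cls X = cls Y <-> exists2 W, chain W & bCC W = X - Y.
Proof. exact: hclass_eq. Qed.
Lemma hrepr_cls X : cycle X -> exists2 W, chain W & bCC W = hrepr (cls X) - X.
Proof. exact: hrepr_hclass. Qed.

Lemma bCC0 : bCC 0 = 0. Proof. exact: (lin0 (@bCC_linear K m C)). Qed.
Lemma chains_dot X Y : chain X -> chain Y -> chain (dotCC X Y).
Proof.
move=> cX cY; move: X cX; apply: chains_ind => [|a X X' hX hX'|k X hX].
- by rewrite dotCC0l; exact: span0.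
- by rewrite dotCC_linear1; exact: span_lin.
move: Y cY; apply: chains_ind => [|a Y Y' hY hY'|k' Y hY].
- by rewrite dotCC0r; exact: span0.
- by rewrite dotCC_linear2; exact: span_lin.
exact: chains_gen (CC_dot hX hY).
Qed.

Lemma bCC_dotr x X W : CC x X -> bCC X = 0 -> chain W ->
  bCC (dotCC X W) = (-1) ^ (m + x) *: dotCC X (bCC W).
Proof.
move=> hX bX; move: W; apply: chains_ind => [|a W W' hW hW'|k W hW].
- by rewrite dotCC0r bCC0 dotCC0r scaler0.
- rewrite dotCC_linear2 !(bCC_linear, dotCC_linear2) hW hW'.
  by koszul.
by rewrite (bCC_dot hX hW) bX dotCC0l; koszul.
Qed.

Lemma bCC_dotl W Y : chain W -> chain Y -> bCC Y = 0 ->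
  bCC (dotCC W Y) = (-1) ^ m *: dotCC (bCC W) Y.
Proof.
move=> cW cY bY; move: W cW; apply: chains_ind => [|a W W' hW hW'|k W hW].
- by rewrite dotCC0l bCC0 dotCC0l scaler0.
- rewrite dotCC_linear1 !(bCC_linear, dotCC_linear1) hW hW'.
  by koszul.
suff -> : bCC (dotCC W Y) = (-1) ^ m *: (dotCC (bCC W) Y + (-1) ^ k *: dotCC W (bCC Y)).
  by rewrite bY dotCC0r scaler0 addr0.
move: Y cY {bY}; apply: chains_ind => [|a Y Y' hY hY'|k' Y hY].
- by rewrite dotCC0r bCC0 !dotCC0r !scaler0 addr0 scaler0.
- rewrite dotCC_linear2 !(bCC_linear, dotCC_linear2) hY hY'.
  by koszul.
exact: bCC_dot hW hY.
Qed.

Lemma cycle_dot X Y : cycle X -> cycle Y -> cycle (dotCC X Y).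
Proof.
move=> /cycleP[cX bX] /cycleP[cY bY]; apply/cycleP; split; first exact: chains_dot.
by rewrite bCC_dotl // bX dotCC0l scaler0.
Qed.

Lemma cycleD X Y : cycle X -> cycle Y -> cycle (X + Y).
Proof. by move=> cX cY; rewrite -[X]scale1r; exact: cyc_lin. Qed.

Lemma cycleZ a X : cycle X -> cycle (a *: X).
Proof. by move=> cX; rewrite -[_ *: _]addr0; apply: cyc_lin => //; exact: (cyclep_submod _ _).1. Qed.

Lemma cycle_hom k X : CC k X -> bCC X = 0 -> cycle X.
Proof. exact: (@cyc_hom _ _ CC bCC). Qed.

Lemma HHdot_cls x X Y : CC x X -> bCC X = 0 -> cycle Y -> HHdot (cls X) (cls Y) = cls (dotCC X Y).
Proof.
move=> hX bX cY; have cX := cycle_hom hX bX.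
rewrite /HHdot; have [W cW bW] := hrepr_cls cX; have [W' cW' bW'] := hrepr_cls cY.
have cYr := cyc_hrepr (cls Y); have /cycleP[hYr bYr] := cYr.
apply/(cls_eq (cycle_dot (cyc_hrepr _) cYr) (cycle_dot cX cY)).
(* X is changed first, then Y. The Leibniz sign depends on the degree of the first factor only, so
   the representative of Y may be inhomogeneous, as one picked by [hrepr] can be. *)
exists ((-1) ^ m *: dotCC W (hrepr (cls Y)) + (-1) ^ (m + x) *: dotCC X W').
  by apply: spanD; apply: spanZ; apply: chains_dot => //; exact: chains_gen hX.
rewrite bCCD !bCCZ (bCC_dotr hX bX cW') (bCC_dotl cW hYr bYr) bW bW'.
rewrite !(dotCCDl, dotCCDr) -!(scaleN1r X) -!(scaleN1r Y) dotCCZl dotCCZr.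
by koszul.
Qed.

Lemma CC_mixed : is_mixed CC bCC BCC.
Proof.
split=> [k|k a X Y|k X|k X|k X|k X].
- exact: CC0.
- exact: CC_lin.
- exact: CC_bCC.
- exact: CC_BCC.
- exact: bCC_BCC.
exact: BCC_BCC.
Qed.

Definition bvop : HH C -> HH C := mixed_op (H := CC) (b := bCC) BCC.

Lemma cycle_BCC X : cycle X -> cycle (BCC X).
Proof. exact: (cyc_mixed_B CC_mixed). Qed.

Lemma bvop_cls X : cycle X -> bvop (cls X) = cls (BCC X).
Proof. exact: (mixed_op_cls CC_mixed). Qed.

Lemma HH_deg_cls k X : CC k X -> bCC X = 0 -> HH_deg k (cls X).
Proof. by move=> hX bX; exists X. Qed.

Lemma HH_deg_dot i j s t : HH_deg i s -> HH_deg j t -> HH_deg (i + j - m) (HHdot s t).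
Proof.
move=> [X [hX bX ->]] [Y [hY bY ->]]; rewrite (HHdot_cls hX bX (cycle_hom hY bY)).
have /cycleP[_ b0] := cycle_dot (cycle_hom hX bX) (cycle_hom hY bY).
exact: HH_deg_cls (CC_dot hX hY) b0.
Qed.

Lemma HH_deg_lin k a s t : HH_deg k s -> HH_deg k t -> HH_deg k (a *: s + t).
Proof.
move=> [X [hX bX ->]] [Y [hY bY ->]].
rewrite -hclass_lin; [|exact: cycle_hom hX bX|exact: cycle_hom hY bY].
by apply: HH_deg_cls; [exact: CC_lin | rewrite bCC_linear bX bY scaler0 addr0].
Qed.

Lemma HH_deg0 k : HH_deg k 0.
Proof. by rewrite -(hclass0 CC bCC); exact: HH_deg_cls (CC0 C k) bCC0. Qed.

Lemma HHdot_linr i s a t t' : HH_deg i s -> HHdot s (a *: t + t') = a *: HHdot s t + HHdot s t'.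
Proof.
move=> [X [hX bX ->]]; rewrite -(hreprK t) -(hreprK t') -hclass_lin ?cyc_hrepr //.
have [ct ct'] := (cyc_hrepr t, cyc_hrepr t').
rewrite !(HHdot_cls hX bX) ?cyc_lin // dotCC_linear2 hclass_lin //.
  exact: cycle_dot (cycle_hom hX bX) ct.
exact: cycle_dot (cycle_hom hX bX) ct'.
Qed.

Lemma HHdot_linl i a s s' t : HH_deg i s -> HH_deg i s' ->
  HHdot (a *: s + s') t = a *: HHdot s t + HHdot s' t.
Proof.
move=> [X [hX bX ->]] [Y [hY bY ->]]; rewrite -(hreprK t); have ct := cyc_hrepr t.
have [cX cY] := (cycle_hom hX bX, cycle_hom hY bY).
rewrite -hclass_lin // (HHdot_cls hX bX) // (HHdot_cls hY bY) //.
rewrite (@HHdot_cls i _ _ (CC_lin a hX hY)) //; last by rewrite bCC_linear bX bY scaler0 addr0.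
by rewrite dotCC_linear1 hclass_lin //; exact: cycle_dot.
Qed.

Lemma HHdot_assoc i j s t u : HH_deg i s -> HH_deg j t -> (exists k, HH_deg k u) ->
  HHdot (HHdot s t) u = (-1) ^ (m * i + m) *: HHdot s (HHdot t u).
Proof.
move=> [X [hX bX ->]] [Y [hY bY ->]] [k [Z [hZ bZ ->]]].
have [[cX cY] cZ] := (cycle_hom hX bX, cycle_hom hY bY, cycle_hom hZ bZ).
have /cycleP[_ bXY] := cycle_dot cX cY; have cYZ := cycle_dot cY cZ.
rewrite (HHdot_cls hX bX) // (HHdot_cls (CC_dot hX hY) bXY) //.
rewrite (HHdot_cls hY bY) // (HHdot_cls hX bX) // (dotCC_assoc hX hY hZ) hclassZ //.
exact: cycle_dot.
Qed.

Lemma HHdot_comm i j s t : HH_deg i s -> HH_deg j t ->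
  HHdot s t = (-1) ^ (m + i * j) *: HHdot t s.
Proof.
move=> [X [hX bX ->]] [Y [hY bY ->]].
have [cX cY] := (cycle_hom hX bX, cycle_hom hY bY).
have [cXY cYX] := (cycle_dot cX cY, cycle_dot cY cX).
rewrite (HHdot_cls hX bX) // (HHdot_cls hY bY) // -hclassZ //.
apply/cls_eq => //; first exact: cycleZ.
exists ((-1) ^ m *: iotaCC X Y).
  apply: spanZ; apply: (@chains_gen _ _ _ (i + j - m + 1)) => n; apply: hom_sum => p _.
  have := hom_iota (hX p) (hY (n.+1 - p)%N).
  by rewrite subnKC // -ltnS.
by rewrite bCCZ (bCC_iota hX hY bX bY); koszul.
Qed.

Definition bvker : int -> HH C -> Prop := mixed_ker (H := CC) (b := bCC) BCC.

Lemma bvop_dot3 z x y s t u : bvker z s -> bvker x t -> HH_deg y u ->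
  bvop (HHdot s (HHdot t u)) =
    (-1) ^ (m * z) *: HHdot (bvop (HHdot s t)) u
    + (-1) ^ ((x + m) * (z + m + 1)) *: HHdot t (bvop (HHdot s u))
    + (-1) ^ (z + m) *: HHdot s (bvop (HHdot t u))
    + (-1) ^ (z + m + 1 + (z + m + 1) * (x + m)) *: HHdot t (HHdot s (bvop u)).
Proof.
move=> [Z [hZ bZ BZ ->]] [X [hX bX BX ->]] [Y [hY bY ->]].
have [[cX cY] cZ] := (cycle_hom hX bX, cycle_hom hY bY, cycle_hom hZ bZ).
have [[cXY cZX] cZY] := (cycle_dot cX cY, cycle_dot cZ cX, cycle_dot cZ cY).
have [[[cBXY cBZX] cBZY] cBY] := (cycle_BCC cXY, cycle_BCC cZX, cycle_BCC cZY, cycle_BCC cY).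
have cZXY := cycle_dot cZ cXY; have /cycleP[_ bBZX] := cBZX.
have c1 := cycle_dot cBZX cY; have c2 := cycle_dot cX cBZY.
have c3 := cycle_dot cZ cBXY; have c4 := cycle_dot cX (cycle_dot cZ cBY).
rewrite (HHdot_cls hX bX cY) (HHdot_cls hZ bZ cX) (HHdot_cls hZ bZ cY) (HHdot_cls hZ bZ cXY).
rewrite !bvop_cls // (HHdot_cls (CC_BCC (CC_dot hZ hX)) bBZX cY) (HHdot_cls hX bX cBZY).
rewrite (HHdot_cls hZ bZ cBXY) (HHdot_cls hZ bZ cBY) (HHdot_cls hX bX (cycle_dot cZ cBY)).
have cR := cycleD (cycleD (cycleD (cycleZ ((-1) ^ (m * z)) c1)
  (cycleZ ((-1) ^ ((x + m) * (z + m + 1))) c2)) (cycleZ ((-1) ^ (z + m)) c3))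
  (cycleZ ((-1) ^ (z + m + 1 + (z + m + 1) * (x + m))) c4).
rewrite -!hclassZ // -!hclassD //; try by do ?[apply: cycleD | apply: cycleZ].
have [W hW bW] := bv_chain hZ hX hY bZ bX bY BZ BX.
by apply/cls_eq; [exact: cycle_BCC| |by exists W; [exact: chains_gen hW|]].
Qed.

End HochschildAlgebra.

(** * The gravity structure on cyclic homology *)

Section CyclicGravity.
Variables (K : fieldType) (m : int) (C : openFrobenius K m).

Lemma HH_bv : is_bv m (@HH_deg K m C) (@bvker K m C) (@HHdot K m C) (@bvop K m C).
Proof.
have X := CC_mixed C; split.
- exact: HH_deg0.
- exact: HH_deg_lin.
- exact: HH_deg_dot.
- exact: HHdot_linr.
- exact: HHdot_linl.
- exact: HHdot_assoc.
- exact: HHdot_comm.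
- exact: (mixed_op_lin X).
- exact: (hdeg_mixed_op X).
- exact: mixed_ker_deg.
- exact: (mixed_ker_op X).
exact: bvop_dot3.
Qed.

Lemma CCuE k al : @CCu K m C k al <->
  (forall j, CC (k - 2 * j%:Z) (al j)) /\ exists N, forall j, (N <= j)%N -> al j = 0.
Proof. by []. Qed.

Lemma bCCuE al j : @bCCu K m C al j = bCC (al j) + BCC (al j.+1).
Proof. by []. Qed.

Lemma HC_connes : is_connes_pair (@HH_deg K m C) (@bvker K m C) (@bvop K m C)
  (HC_deg C) (@Emap K m C) (@Mmap K m C).
Proof.
exact (@mixed_connes_pair K _ (@CC K m C) (@bCC K m C) (@BCC K m C) (CC_mixed C)
  (@CCu K m C) (@bCCu K m C) CCuE bCCuE).
Qed.

Lemma HC_grading : is_grading (HC_deg C).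
Proof.
apply (@mixedu_grading K _ (@CC K m C) (@bCC K m C) (@BCC K m C) (CC_mixed C)
  (@CCu K m C) (@bCCu K m C) CCuE bCCuE (fun k x n => wproj C k (x n))) => [k a x y|k x hx|k j x jk hx].
- by apply/funext => n; exact: (linearP (wproj C k)).
- by apply/funext => n; rewrite (wproj_hom _ (hx n)) eqxx.
by apply/funext => n; rewrite (wproj_hom _ (hx n)) (negbTE jk).
Qed.

(** The abstract bracket [br] for this data unfolds to [cyc_bracket C]. *)
Lemma HC_gravity : is_gravity (gshift (HC_deg C) (m - 2)) (cyc_bracket C).
Proof. exact: (gravity_of_bv HH_bv HC_connes HC_grading). Qed.

End CyclicGravity.

Theorem corollary6 (m : int) (C : openFrobenius rat m) :
  is_gravity (gshift (HC_deg C) (m - 2)) (cyc_bracket C).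
Proof. exact: HC_gravity. Qed.
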